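(* Let $\ell>0$, $\mu_1,\mu_2,a$ and $\xi\in(0,\ell)$ be constants. (1) The problem $$u_{tt}-u_{xx}=0\ \text{ in }(0,\ell)\times(0,2\ell),\qquad u_{tt}-u_{xx}+a\,u_t(\xi,t-2\ell)\,\delta_\xi=0\ \text{ in }(0,\ell)\times(2\ell,+\infty),$$ $$u(0,t)=0,\ u_x(\ell,t)=0\ \text{ on }(0,+\infty),\qquad u(\cdot,0)=u_0,\ u_t(\cdot,0)=u_1\ \text{ in }(0,\ell)$$ is well-posed. More precisely, for every $(u_0,u_1)\in\mathcal H$ its solution is given by $(u,u_t)(t)=(u^0,u^0_t)(t)=\mathcal T(t)(u_0,u_1)$ for $0\le t\le2\ell$, and, for $j\ge1$ and $2j\ell\le t\le2(j+1)\ell$, by $(u,u_t)(t)=(u^j,u^j_t)(t)$, where $$\begin{pmatrix} u^{j}(t) \\ {} u^{j}_t(t) \end{pmatrix}=\mathcal T(t-2j\ell)\begin{pmatrix} u^{j-1}(2j\ell) \\ {} u^{j-1}_t(2j\ell) \end{pmatrix}+\int_{2j\ell}^t\mathcal T_{-1}(t-s)\begin{pmatrix} 0 \\ {} -a\,u^{j-1}_t(s-2\ell)\,\delta_\xi \end{pmatrix}ds,$$ and it satisfies $(u^j,u^j_t)\in C([2j\ell,2(j+1)\ell],\mathcal H)$ for all $j\in\mathbb N$. (2) The problem $$u_{tt}-u_{xx}=0\ \text{ in }(0,\ell)\times(0,+\infty),\qquad u(0,t)=0\ \text{ on }(0,+\infty),\qquad u_x(\ell,t)=0\ \text{ on }(0,2\ell),$$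 $$u_x(\ell,t)=\mu_1u_t(\ell,t)\ \text{ on }(2(2i+1)\ell,2(2i+2)\ell),\ \forall i\in\mathbb N,$$ $$u_x(\ell,t)=\mu_2u_t(\ell,t-2\ell)\ \text{ on }(2(2i+2)\ell,2(2i+3)\ell),\ \forall i\in\mathbb N,$$ $$u(\cdot,0)=u_0,\ u_t(\cdot,0)=u_1\ \text{ in }(0,\ell)$$ is well-posed. More precisely, for every $(u_0,u_1)\in\mathcal H$ its solution is given by $(u,u_t)(t)=(u^0,u^0_t)(t)=\mathcal T(t)(u_0,u_1)$ for $0\le t\le2\ell$. For $j\in\mathbb N$ and $2(2j+1)\ell\le t\le2(2j+2)\ell$ it is given by $(u,u_t)(t)=(u^{2j+1},u^{2j+1}_t)(t)$ with $$\begin{pmatrix} u^{2j+1}(t) \\ {} u^{2j+1}_t(t) \end{pmatrix}=\mathcal T_d(t-2(2j+1)\ell)\begin{pmatrix} u^{2j}(2(2j+1)\ell) \\ {} u^{2j}_t(2(2j+1)\ell) \end{pmatrix}.$$ For $j\in\mathbb N$ and $2(2j+2)\ell\le t\le2(2j+3)\ell$ it is given by $(u,u_t)(t)=(u^{2j+2},u^{2j+2}_t)(t)$ with $$\begin{pmatrix} u^{2j+2}(t) \\ {} u^{2j+2}_t(t) \end{pmatrix}=\mathcal T(t-2(2j+2)\ell)\begin{pmatrix} u^{2j+1}(2(2j+2)\ell) \\ {} u^{2j+1}_t(2(2j+2)\ell) \end{pmatrix}+\int_{2(2j+2)\ell}^t\mathcal T_{-1}(t-s)\begin{pmatrix} 0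 \\ {} -\mu_1\,u^{2j+1}_t(s-2\ell)\,\delta_\ell \end{pmatrix}ds.$$ It satisfies $(u^0,u^0_t)\in C([0,2\ell],\mathcal H)$ and, for all $j\in\mathbb N$, $(u^{2j+1},u^{2j+1}_t)\in C([2(2j+1)\ell,2(2j+2)\ell],\mathcal H)$ and $(u^{2j+2},u^{2j+2}_t)\in C([2(2j+2)\ell,2(2j+3)\ell],\mathcal H)$.
   Context: $\mathbb N=\{0,1,2,\dots\}$. $H=L^2(0,\ell)$, and $A=-\partial_x^2$ is the unbounded operator in $H$ with domain $H_1=\mathcal D(A)=\{u\in H^2(0,\ell):u(0)=0,\ u_x(\ell)=0\}$. $H_{1/2}=\mathcal D(A^{1/2})=\{u\in H^1(0,\ell):u(0)=0\}$, and $H_{-1/2}$ is its dual with respect to the pivot space $H$. $\mathcal H=H_{1/2}\times H$. For $x_0\in(0,\ell]$, $\delta_{x_0}\in H_{-1/2}$ is the Dirac mass at $x_0$. In the integrals, $u^{k}_t(s-2\ell)\,\delta_{x_0}$ denotes $u^{k}_t(x_0,s-2\ell)\,\delta_{x_0}$, with $x_0=\xi$ in (1) and $x_0=\ell$ in (2). $\mathcal A:\mathcal D(\mathcal A)=H_1\times H_{1/2}\subset\mathcal H\to\mathcal H$ is defined by $\mathcal A(u_1,u_2)=(u_2,-Au_1)$. $\mathcal A_d:\mathcal D(\mathcal A_d)\subset\mathcal H\to\mathcal H$ has domain $\mathcal D(\mathcal A_d)=\{(u,v)\in[H^2(0,\ell)\times H^1(0,\ell)]\cap\mathcal H:\ u_x(\ell)=\mu_2\,v(\ell)\}$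 and is defined by $\mathcal A_d(u_1,u_2)=(u_2,-Au_1)$, where $A$ acts as $-\partial_x^2$. The operators $\mathcal A$ and $\mathcal A_d$ are taken to generate strongly continuous semigroups of contractions on $\mathcal H$, denoted $(\mathcal T(t))_{t\ge0}$ and $(\mathcal T_d(t))_{t\ge0}$ respectively. $(\mathcal T_{-1}(t))_{t\ge0}$ is the extension of $(\mathcal T(t))_{t\ge0}$ to $[\mathcal D(\mathcal A)]'$, the dual of $\mathcal D(\mathcal A)$ with respect to the pivot space $\mathcal H$.
   Formalization: In (2) the printed boundary conditions contradict the displayed formulas; they are corrected to u_x(ℓ,t)=μ₂u_t(ℓ,t) without delay and u_x(ℓ,t)=−μ₁u_t(ℓ,t−2ℓ) with delay, as the formulas and D(A_d) require; A_d is required to map into H, so v(0)=0. *)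

(* Defs.v *)
From mathcomp Require Import all_boot all_order all_algebra.
From mathcomp Require Import all_classical all_reals all_analysis.

Set Implicit Arguments.
Unset Strict Implicit.
Unset Printing Implicit Defensive.

Import Order.TTheory GRing.Theory Num.Theory.
Import numFieldNormedType.Exports.

Local Open Scope classical_set_scope.
Local Open Scope ring_scope.

(* All spaces are real.  An element of L^2(0,l) is given by a representative
   f : R -> R; only the class of f modulo a.e. equality on ]0,l[ is meaningful.
   An element of H^1 is given by its absolutely continuous representative, of
   which only the values on the closed interval are meaningful. *)

Section Spaces.
Context {R : realType}.
Implicit Types (a b l : R) (f g u v : R -> R).

Definition L2 a b f : Prop := f \_ `]a, b[ \in Lfun (@lebesgue_measure R) 2%:E.

Definition dotL2 a b f g : R :=
  \int[@lebesgue_measure R]_(x in `[a, b]) (f x * g x).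

Definition normL2 a b f : R := Num.sqrt (dotL2 a b f f).

(* f belongs to H^1(a,b), and g is a weak derivative of f *)
Definition weak_deriv a b f g : Prop :=
  L2 a b g /\
  forall x, a <= x <= b ->
    f x = f a + \int[@lebesgue_measure R]_(y in `[a, x]) g y.

Definition H1 a b f : Prop := exists g, weak_deriv a b f g.

(* a weak derivative (unique up to a.e. equality) of f, if f is in H^1(a,b) *)
Definition wderiv a b f : R -> R := xget 0 [set g | weak_deriv a b f g].

(* u belongs to H^2(0,l), and g is the continuous representative of u_x *)
Definition H2_deriv l u g : Prop := weak_deriv 0 l u g /\ H1 0 l g.

(* H_{1/2} and H_1 = D(A) *)
Definition Hhalf l u : Prop := H1 0 l u /\ u 0 = 0.

Definition Hone l u : Prop := exists g, [/\ H2_deriv l u g, u 0 = 0 & g l = 0].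

(* u belongs to H^2(0,l), and f = u_xx *)
Definition second_deriv l u f : Prop :=
  exists g, weak_deriv 0 l u g /\ weak_deriv 0 l g f.

End Spaces.

(* representatives (u, v) of elements of H_{1/2} x H *)
Definition state (R : realType) : Type := ((R -> R) * (R -> R))%type.

Section EnergySpace.
Context {R : realType}.
Implicit Types (l : R) (z w : state R).

Definition calH l z : Prop := Hhalf l z.1 /\ L2 0 l z.2.

Definition eqH l z w : Prop :=
  (forall x, 0 <= x <= l -> z.1 x = w.1 x) /\
  ae_eq (@lebesgue_measure R) `]0, l[%classic z.2 w.2.

(* H_{1/2} = D(A^{1/2}) carries the norm |A^{1/2} u| = |u_x|, for which calA is
   skew-adjoint *)
Definition dotH l z w : R :=
  dotL2 0 l (wderiv 0 l z.1) (wderiv 0 l w.1) + dotL2 0 l z.2 w.2.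

Definition normH l z : R := Num.sqrt (dotH l z z).

Definition contH l (a b : R) (U : R -> state R) : Prop :=
  forall t, a <= t <= b ->
    calH l (U t) /\
    (fun s => normH l (U s - U t)) @ within `[a, b] (nbhs t) --> (0 : R).

Definition domA l z : Prop := Hone l z.1 /\ Hhalf l z.2.

(* w = calA z *)
Definition calA l z w : Prop :=
  [/\ domA l z, forall x, 0 <= x <= l -> w.1 x = z.2 x
    & second_deriv l z.1 w.2].

Definition domAd l (mu2 : R) z : Prop :=
  [/\ calH l z, H1 0 l z.2
    & exists g, H2_deriv l z.1 g /\ g l = mu2 * z.2 l].

(* w = calA_d z; that calA_d takes its values in calH forces z.2 0 = 0, which
   is not part of domAd *)
Definition calAd l (mu2 : R) z w : Prop :=
  [/\ domAd l mu2 z, calH l w, forall x, 0 <= x <= l -> w.1 x = z.2 x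
    & second_deriv l z.1 w.2].

End EnergySpace.

Section Semigroups.
Context {R : realType}.
Implicit Types (l : R) (T : R -> state R -> state R).

Record C0_contraction_semigroup l T : Prop := {
  sg_stable : forall t z, 0 <= t -> calH l z -> calH l (T t z);
  sg_linear : forall t k z w, 0 <= t -> calH l z -> calH l w ->
    eqH l (T t (k *: z + w)) (k *: T t z + T t w);
  sg_0 : forall z, calH l z -> eqH l (T 0 z) z;
  sg_D : forall s t z, 0 <= s -> 0 <= t -> calH l z ->
    eqH l (T (s + t) z) (T s (T t z));
  sg_contraction : forall t z, 0 <= t -> calH l z ->
    normH l (T t z) <= normH l z;
  sg_continuous : forall z, calH l z ->
    (fun t => normH l (T t z - z)) @ 0^'+ --> (0 : R)
}.

(* B is the graph of an operator on calH, given on suitable representatives *)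
Definition generates l (B : state R -> state R -> Prop) T : Prop :=
  C0_contraction_semigroup l T /\
  forall z w, calH l z -> calH l w ->
    ((fun h => normH l (h^-1 *: (T h z - z) - w)) @ 0^'+ --> (0 : R)) <->
    exists z', eqH l z z' /\ B z' w.

End Semigroups.

(* Elements of [D(calA)]' are given by functionals phi |-> F phi, phi in
   D(calA); elements of H_{-1/2} by functionals on H_{1/2}.  Only the values on
   D(calA), resp. H_{1/2}, are meaningful. *)
Section Dual.
Context {R : realType}.
Implicit Types (l : R) (F G : state R -> R) (z : state R).

Definition dual_bound l F (K : R) : Prop :=
  forall phi w, calA l phi w -> `|F phi| <= K * (normH l phi + normH l w).

Definition in_dual l F : Prop :=
  (forall k phi psi, domA l phi -> domA l psi ->
    F (k *: phi + psi) = k * F phi + F psi) /\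
  exists K, dual_bound l F K.

Definition eq_dual l F G : Prop := forall phi, domA l phi -> F phi = G phi.

(* the embedding of the pivot space calH *)
Definition pivot l z : state R -> R := fun phi => dotH l z phi.

(* the element (0, f) of [D(calA)]' for f in H_{-1/2} *)
Definition velocity_load (f : (R -> R) -> R) : state R -> R :=
  fun phi => f phi.2.

Definition dirac_mass (x0 : R) : (R -> R) -> R := fun psi => psi x0.

(* The integral over [a,b] in [D(calA)]' is taken in the weak sense. *)
Definition dual_integrable l (a b : R) (F : R -> state R -> R) : Prop :=
  forall phi, domA l phi ->
    (@lebesgue_measure R).-integrable `[a, b] (fun s => (F s phi)%:E).

Definition dual_integral (a b : R) (F : R -> state R -> R) : state R -> R :=
  fun phi => \int[@lebesgue_measure R]_(s in `[a, b]) F s phi.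

(* Tm t is the continuous linear extension of T t from calH to [D(calA)]' *)
Record dual_extension l (T : R -> state R -> state R)
    (Tm : R -> (state R -> R) -> (state R -> R)) : Prop := {
  ext_stable : forall t F, 0 <= t -> in_dual l F -> in_dual l (Tm t F);
  ext_linear : forall t k F G, 0 <= t -> in_dual l F -> in_dual l G ->
    eq_dual l (Tm t (k *: F + G)) (k *: Tm t F + Tm t G);
  ext_bounded : forall t, 0 <= t -> exists M, forall F K,
    in_dual l F -> dual_bound l F K -> dual_bound l (Tm t F) (M * K);
  ext_extends : forall t z, 0 <= t -> calH l z ->
    eq_dual l (Tm t (pivot l z)) (pivot l (T t z))
}.

End Dual.

Section Problems.
Context {R : realType}.
Implicit Types (l : R) (U : R -> state R) (c g : R -> R).

(* c is the trace u_t(x0, .) on (a,b) of a trajectory U = (u, u_t): as u_t(t) is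
   only in L^2, it is understood as the derivative of u(x0, .) in H^1(a,b) *)
Definition velocity_trace (a b x0 : R) U c : Prop :=
  weak_deriv a b (fun t => (U t).1 x0) c.

(* U = (u, u_t) in C([0,+oo), calH) satisfies U(0) = z0 and
     u_tt + A u = g(t) delta_{x0}   in H_{-1/2},
   integrated in time and tested with psi in H_{1/2}.  For x0 < l this is
   u_tt - u_xx = g(t) delta_{x0}, u(0,t) = 0, u_x(l,t) = 0; for x0 = l, by
   integration by parts, it is u_tt - u_xx = 0, u(0,t) = 0, u_x(l,t) = g(t). *)
Definition wave_solution l (x0 : R) (z0 : state R) U g : Prop :=
  [/\ forall tau, 0 < tau -> contH l 0 tau U,
      eqH l (U 0) z0,
      (forall t, 0 <= t ->
        (fun s => normL2 0 l ((s - t)^-1 *: ((U s).1 - (U t).1) - (U t).2))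
          @ within `[0, +oo[ t^' --> (0 : R))
    & forall t psi, 0 <= t -> Hhalf l psi ->
        dotL2 0 l (U t).2 psi - dotL2 0 l z0.2 psi
        + \int[@lebesgue_measure R]_(s in `[0, t])
            dotL2 0 l (wderiv 0 l (U s).1) (wderiv 0 l psi)
        = \int[@lebesgue_measure R]_(s in `[0, t]) (g s * psi x0)].

Definition interior_delay_problem l (xi a : R) (z0 : state R) U : Prop :=
  exists c g,
    [/\ forall tau, 0 < tau -> velocity_trace 0 tau xi U c,
        forall t, 0 < t < 2 * l -> g t = 0,
        forall t, 2 * l < t -> g t = - a * c (t - 2 * l)
      & wave_solution l xi z0 U g].

(* g is u_x(l, .); it equals k1 u_t(l,t) on the intervals without delay and
   k2 u_t(l,t-2l) on those with delay *)
Definition boundary_switching_problem l (k1 k2 : R) (z0 : state R) U : Prop :=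
  exists c g,
    [/\ forall tau, 0 < tau -> velocity_trace 0 tau l U c,
        forall t, 0 < t < 2 * l -> g t = 0,
        forall (i : nat) t,
          (2 * (2 * i + 1))%:R * l < t < (2 * (2 * i + 2))%:R * l ->
          g t = k1 * c t,
        forall (i : nat) t,
          (2 * (2 * i + 2))%:R * l < t < (2 * (2 * i + 3))%:R * l ->
          g t = k2 * c (t - 2 * l)
      & wave_solution l l z0 U g].

Definition well_posed l (P : state R -> (R -> state R) -> Prop) : Prop :=
  [/\ forall z0, calH l z0 -> exists U, P z0 U,
      forall z0 U V, calH l z0 -> P z0 U -> P z0 V ->
        forall t, 0 <= t -> eqH l (U t) (V t)
    & forall tau, 0 <= tau -> exists C : R, forall z0 w0 U V,
        calH l z0 -> calH l w0 -> P z0 U -> P w0 V ->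
        forall t, 0 <= t <= tau ->
          normH l (U t - V t) <= C * normH l (z0 - w0)].

(* U, on [t0,t1], is T(t - t0) z + \int_{t0}^t T_{-1}(t - s) (0, k c(s - 2l)
   delta_{x0}) ds, as an identity in [D(calA)]' *)
Definition duhamel l (T : R -> state R -> state R)
    (Tm : R -> (state R -> R) -> (state R -> R))
    (x0 t0 t1 k : R) (z : state R) c U : Prop :=
  forall t, t0 <= t <= t1 ->
    let F := fun s =>
      Tm (t - s) (velocity_load ((k * c (s - 2 * l)) *: dirac_mass x0)) in
    dual_integrable l t0 t F /\
    eq_dual l (pivot l (U t))
      (pivot l (T (t - t0) z) + dual_integral t0 t F).

End Problems.

(* Main.v *)
(* Everything is written in d'Alembert form: a trajectory with source g delta_{x0}
   at x0 is determined by a profile p, with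
     u_x = p (t + x) + p (t - x) + ...,  u_t = p (t + x) - p (t - x) + ...,
   the dots being translates of g; the end condition at l is the recursion
     p (y + 2 l) + p y = (g (y + x0) - g (y - x0)) / 2,
   and the switching and delay rules express g through the trace u_t(x0, .), hence
   through values of p and g that are older by at least l.  So (p, g) is the fixed
   point of a recursion with delay l, bounded in L^2 step by step; this yields
   existence and continuous dependence.

   Conversely, pair any solution U with the solutions of the free equation that run
   backwards from a given final state: the product changes at the rate
   g(t) u_t(x0, t), where u is the test solution.  By density of these final states,
   U is determined by z0 and g, hence is the explicit one.  The same identity gives
   the adjoint of T, hence T_{-1} on the Dirac mass (approximated by bumps), hence
   Duhamel's formula.

   The semigroups are shifts of profiles satisfying q (y + 2 l) = rho q y, with
   rho = - 1 for calA and rho = - (1 + mu2) / (1 - mu2) for calAd (dissipativity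
   forces mu2 <= 0): on absolutely continuous profiles both have the same
   generator, and averages of profiles are dense. *)

(* The source and the trace are only in L^2 in time, so neither the equation nor the law linking
   them can be evaluated pointwise. Regularity is put on the test side: a test wave with absolutely
   continuous profile is Hoelder of exponent 1/2 in time, and against an L^2 source this leaves an
   error o(h) on [t,t+h]. A solution is not assumed to come from a profile. Its own trace defines a
   source; the explicit wave with that frozen source has the same trajectory, hence almost
   everywhere the same trace, so the source obeys the recursion. This makes the bounds on the
   recursion valid for every solution. The value of rho for calAd solves u_x = mu2 u_t at l, that is
   q (s + l) + q (s - l) = mu2 (q (s + l) - q (s - l)), for q (s + l). The same division by 1 - mu2
   occurs when g = mu2 u_t(l,.) is solved for g, because u_t(l,t) contains g t itself. Profiles are
   continued forwards only. Test waves running backwards exist because the undamped reflection has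
   period 4 l. *)
From HB Require Import structures.
From mathcomp Require Import all_boot all_order all_algebra.
From mathcomp Require Import all_classical all_reals all_analysis.
From mathcomp Require Import measurable_realfun ring lra zify.
Require Import Defs.
Import Order.TTheory GRing.Theory Num.Theory.
Import numFieldNormedType.Exports.
Set Implicit Arguments.
Unset Strict Implicit.
Unset Printing Implicit Defensive.
Local Open Scope classical_set_scope.
Local Open Scope ring_scope.

(** * Square integrable functions on the line *)

Section L2line.
Context {R : realType}.
Notation mu := (@lebesgue_measure R).
Implicit Types (f g h : R -> R) (a b c d : R) (D : set R).

(** Functions on ]0,l[ are extended by zero to the line, so that translations and reflections act
    isometrically on one single space. *)
Definition sqint f : Prop := f \in Lfun mu 2%:E.

Lemma sqint_meas f : sqint f -> measurable_fun setT f.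
Proof. by rewrite /sqint inE => /andP[/[!inE]]. Qed.

Lemma sqint_integrable f : sqint f -> mu.-integrable setT (EFin \o (fun x => f x ^+ 2)).
Proof. exact: Lfun2_integrable_sqr. Qed.

Lemma sqintP f : measurable_fun setT f ->
  mu.-integrable setT (EFin \o (fun x => f x ^+ 2)) -> sqint f.
Proof.
move=> mf If; rewrite /sqint inE; apply/andP; split; rewrite inE//=.
rewrite /finite_norm unlock /Lnorm poweR_lty//=.
move/integrableP : If => [_]; apply: le_lt_trans.
apply: ge0_le_integral => //=.
- apply/measurable_EFinP.
  apply/(@measurableT_comp _ _ _ _ _ _ (fun x : R => x `^ 2)%R) => //.
  exact/measurableT_comp.
- by apply/measurable_EFinP; apply: measurableT_comp => //; exact: measurable_funX.
- by move=> x _; rewrite lee_fin powR_mulrn// normrX.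
Qed.

Lemma sqintD f g : sqint f -> sqint g -> sqint (f + g).
Proof.
move=> Qf Qg; have [_ H] := @Lfun_submod_closed _ _ R mu 2%:E (lee1n 2).
by have := H 1 f g Qf Qg; rewrite scale1r.
Qed.

Lemma sqintZ k f : sqint f -> sqint (k *: f).
Proof.
move=> Qf; have [H0 H] := @Lfun_submod_closed _ _ R mu 2%:E (lee1n 2).
by have := H k f 0 Qf H0; rewrite addr0.
Qed.

Lemma sqintN f : sqint f -> sqint (- f).
Proof. by move=> Qf; rewrite -scaleN1r; exact: sqintZ. Qed.

Lemma sqintB f g : sqint f -> sqint g -> sqint (f - g).
Proof. by move=> Qf Qg; apply: sqintD => //; exact: sqintN. Qed.

Lemma sqint0 : sqint (0 : R -> R).
Proof. by have [] := @Lfun_submod_closed _ _ R mu 2%:E (lee1n 2). Qed.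

Lemma sqintM f g : sqint f -> sqint g -> mu.-integrable setT (EFin \o (f \* g)).
Proof. by move=> Qf Qg; apply/Lfun1_integrable; exact: Lfun2_mul_Lfun1. Qed.

Lemma le_sqint f g : measurable_fun setT f -> sqint g ->
  (forall x, `|f x| <= `|g x|) -> sqint f.
Proof.
move=> mf Qg fg; apply: sqintP => //.
apply: le_integrable (sqint_integrable Qg) => //.
  by apply/measurable_EFinP; exact: measurable_funX.
by move=> x _ /=; rewrite lee_fin !normrX lerXn2r ?nnegrE.
Qed.

Definition ip f g : R := \int[mu]_x (f x * g x).
Definition nm f : R := Num.sqrt (ip f f).

Lemma ipC f g : ip f g = ip g f.
Proof. by apply: eq_Rintegral => x _; rewrite mulrC. Qed.

Lemma ip_ge0 f : 0 <= ip f f.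
Proof. by apply: Rintegral_ge0 => x _; rewrite -expr2 sqr_ge0. Qed.

Lemma ipDl f g h : sqint f -> sqint g -> sqint h -> ip (f + g) h = ip f h + ip g h.
Proof.
move=> Qf Qg Qh; rewrite /ip -RintegralD//; try exact: sqintM.
by apply: eq_Rintegral => x _; rewrite -mulrDl.
Qed.

Lemma ipZl k f g : sqint f -> sqint g -> ip (k *: f) g = k * ip f g.
Proof.
move=> Qf Qg; rewrite /ip -RintegralZl//; try exact: sqintM.
by apply: eq_Rintegral => x _; rewrite -scalerAl.
Qed.

Lemma ipNl f g : sqint f -> sqint g -> ip (- f) g = - ip f g.
Proof. by move=> Qf Qg; rewrite -scaleN1r ipZl// mulN1r. Qed.

Lemma ipBl f g h : sqint f -> sqint g -> sqint h -> ip (f - g) h = ip f h - ip g h.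
Proof. by move=> Qf Qg Qh; rewrite ipDl ?ipNl//; exact: sqintN. Qed.

Lemma ipDr f g h : sqint f -> sqint g -> sqint h -> ip h (f + g) = ip h f + ip h g.
Proof. by move=> *; rewrite !(ipC h) ipDl. Qed.

Lemma ipZr k f g : sqint f -> sqint g -> ip f (k *: g) = k * ip f g.
Proof. by move=> *; rewrite !(ipC f) ipZl. Qed.

Lemma ip0l f : ip 0 f = 0.
Proof. by rewrite /ip; under eq_Rintegral do rewrite mul0r; rewrite Rintegral_cst// mul0r. Qed.

Lemma nm_ge0 f : 0 <= nm f. Proof. exact: sqrtr_ge0. Qed.

Lemma nm_sqr f : nm f ^+ 2 = ip f f.
Proof. by rewrite sqr_sqrtr// ip_ge0. Qed.

End L2line.

(* Cauchy-Schwarz from positivity of t |-> <u + t v, u + t v> *)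
Lemma discriminant_bound (R : realFieldType) (a b c : R) :
  0 <= a -> 0 <= c -> (forall t, 0 <= a + t * b *+ 2 + t ^+ 2 * c) -> b ^+ 2 <= a * c.
Proof.
move=> a0 c0 H; have [c00|cn0] := eqVneq c 0.
  have [->|bn0] := eqVneq b 0; first by rewrite expr0n/= mulr_ge0.
  have := H (- (a + 1) / (b *+ 2)).
  rewrite c00 mulr0 addr0.
  have -> : - (a + 1) / (b *+ 2) * b *+ 2 = - (a + 1) by field.
  lra.
have := H (- b / c).
have -> : a + - b / c * b *+ 2 + (- b / c) ^+ 2 * c = (a * c - b ^+ 2) / c.
  by field.
have cp : 0 < c by rewrite lt_def cn0.
by rewrite pmulr_lge0 ?invr_gt0// subr_ge0.
Qed.

Section L2line2.
Context {R : realType}.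
Notation mu := (@lebesgue_measure R).
Implicit Types (f g h : R -> R) (a b c d : R) (D : set R).

Lemma cauchy_schwarz f g : sqint f -> sqint g -> `|ip f g| <= nm f * nm g.
Proof.
move=> Qf Qg; rewrite -sqrtrM ?ip_ge0// -sqrtr_sqr ler_wsqrtr//.
apply: discriminant_bound => [||t]; try exact: ip_ge0.
have -> : ip f f + t * ip f g *+ 2 + t ^+ 2 * ip g g = ip (f + t *: g) (f + t *: g).
  have Qtg : sqint (t *: g) by exact: sqintZ.
  rewrite !ipDl ?ipDr//; last exact: sqintD.
  rewrite !ipZl ?ipZr// (ipC g f); ring.
exact: ip_ge0.
Qed.

Lemma nmD f g : sqint f -> sqint g -> nm (f + g) <= nm f + nm g.
Proof.
move=> Qf Qg; rewrite -(@ler_pXn2r _ 2)// ?nnegrE ?addr_ge0 ?nm_ge0//.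
rewrite sqrrD !nm_sqr ipDl ?ipDr//; last exact: sqintD.
rewrite (ipC g f).
have := cauchy_schwarz Qf Qg; have := ler_norm (ip f g); lra.
Qed.

Lemma nmZ k f : sqint f -> nm (k *: f) = `|k| * nm f.
Proof.
move=> Qf; rewrite /nm ipZl ?ipZr//; last exact: sqintZ.
by rewrite mulrA -expr2 sqrtrM ?sqr_ge0// sqrtr_sqr.
Qed.

Lemma nmN f : nm (- f) = nm f.
Proof. by rewrite /nm /ip; congr Num.sqrt; apply: eq_Rintegral => x _; rewrite mulrNN. Qed.

Lemma nmB f g : sqint f -> sqint g -> nm (f - g) <= nm f + nm g.
Proof. by move=> Qf Qg; rewrite -(nmN g) nmD//; exact: sqintN. Qed.

Lemma le_nm f g : measurable_fun setT f -> sqint g ->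
  (forall x, `|f x| <= `|g x|) -> nm f <= nm g.
Proof.
move=> mf Qg fg; have Qf := le_sqint mf Qg fg.
rewrite ler_wsqrtr// le_Rintegral//; try exact: sqintM.
by move=> x _; rewrite -!expr2 -(real_normK (num_real (f x))) -(real_normK (num_real (g x)))
  lerXn2r ?nnegrE.
Qed.

Lemma ae_nm0 f : measurable_fun setT f -> {ae mu, forall x, f x = 0} -> nm f = 0.
Proof.
move=> mf f0; rewrite /nm /ip /Rintegral.
rewrite (ae_eq_integral (cst 0%E)) ?integral0 ?sqrtr0//.
- by apply/measurable_EFinP; exact: measurable_funM.
- by apply: (@filterS _ _ (ae_filter_ringOfSetsType mu) _ _ _ f0) => x /= -> _; rewrite mul0r.
Qed.

Lemma nm0_ae f : sqint f -> nm f = 0 -> {ae mu, forall x, f x = 0}.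
Proof.
move=> Qf /eqP; rewrite sqrtr_eq0 => f0.
have {f0} : ip f f = 0 by apply/eqP; rewrite eq_le f0 ip_ge0.
move=> f0.
have If := sqint_integrable Qf.
have I0 : (\int[mu]_x `|(f x ^+ 2)%:E| = 0)%E.
  under eq_integral => x _ do rewrite gee0_abs ?lee_fin ?sqr_ge0//.
  rewrite -(fineK (integrable_fin_num _ If))//.
  by congr EFin; rewrite -[RHS]f0; apply: eq_Rintegral => x _; rewrite expr2.
have mf2 : measurable_fun setT (EFin \o (fun x => f x ^+ 2)).
  by apply/measurable_EFinP/measurable_funX; exact: sqint_meas.
have := ae_eq_integral_abs mu measurableT mf2.
rewrite I0 => -[/(_ erefl) H _].
by apply: (@filterS _ _ (ae_filter_ringOfSetsType mu) _ _ _ H) => x /(_ I)/= [] /eqP; rewrite expf_eq0/= => /eqP.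
Qed.

Lemma ae_nm f g : measurable_fun setT f -> measurable_fun setT g ->
  {ae mu, forall x, f x = g x} -> nm f = nm g.
Proof.
move=> mf mg fg; congr Num.sqrt; rewrite /ip /Rintegral; congr fine.
apply: ae_eq_integral => //; try (apply/measurable_EFinP; exact: measurable_funM).
by apply: (@filterS _ _ (ae_filter_ringOfSetsType mu) _ _ _ fg) => x /= ->.
Qed.

Lemma ae_ip f g h : measurable_fun setT f -> measurable_fun setT g -> measurable_fun setT h ->
  {ae mu, forall x, f x = g x} -> ip f h = ip g h.
Proof.
move=> mf mg mh fg; rewrite /ip /Rintegral; congr fine.
apply: ae_eq_integral => //; try (apply/measurable_EFinP; exact: measurable_funM).
by apply: (@filterS _ _ (ae_filter_ringOfSetsType mu) _ _ _ fg) => x /= ->.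
Qed.

Lemma sqint_patch f D : measurable D -> sqint f -> sqint (f \_ D).
Proof.
move=> mD Qf; apply: (le_sqint _ Qf).
  apply/(measurable_restrictT _ _).1 => //.
  exact: measurable_funS (sqint_meas Qf).
by move=> x; rewrite patchE; case: ifP => // _; rewrite normr0.
Qed.

Lemma nm_patch f D : measurable D -> sqint f -> nm (f \_ D) <= nm f.
Proof.
move=> mD Qf; apply: le_nm => //; first by apply: sqint_meas; exact: sqint_patch.
by move=> x; rewrite patchE; case: ifP => // _; rewrite normr0.
Qed.

Lemma ip_patch f g D : ip (f \_ D) g = ip f (g \_ D).
Proof.
by apply: eq_Rintegral => x _; rewrite !patchE; case: ifP; rewrite ?mulr0 ?mul0r.
Qed.

Lemma patchD f g D : (f + g) \_ D = f \_ D + g \_ D.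
Proof.
by apply/funext => x; rewrite !fctE /= !patchE; case: ifP; rewrite ?addr0.
Qed.
Lemma patchZ k f D : (k *: f) \_ D = k *: (f \_ D).
Proof. by apply/funext => x; rewrite !fctE /= !patchE; case: ifP; rewrite ?scaler0. Qed.
Lemma patchN f D : (- f) \_ D = - (f \_ D).
Proof. by rewrite -scaleN1r patchZ scaleN1r. Qed.
Lemma patchB f g D : (f - g) \_ D = f \_ D - g \_ D.
Proof. by rewrite patchD patchN. Qed.

End L2line2.

(** * Translations and reflections of the line *)

Section MeasurePreserving.
Context {R : realType}.
Notation mu := (@lebesgue_measure R).
Notation mR := (measurableTypeR R).
Implicit Types (f g h : R -> R) (a b c d : R) (D : set R).

Definition preserves (phi : R -> R) : Prop :=
  measurable_fun setT (phi : mR -> mR) /\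
  forall A, measurable A -> mu (phi @^-1` A) = mu A.

Lemma preserves_shift d : preserves (fun x => x + d).
Proof.
have mphi : measurable_fun setT ((fun x => x + d) : mR -> mR).
  by apply: measurable_funD => //; exact: measurable_cst.
split=> // A mA.
pose phi : {mfun mR >-> mR} := HB.pack ((fun x => x + d) : mR -> mR)
  (isMeasurableFun.Build _ _ _ _ _ mphi).
rewrite -[LHS]/(pushforward mu phi A).
apply/esym/lebesgue_measure_unique => //= _ [[a b]] _ <-.
rewrite /pushforward /=.
have -> : (fun x => x + d) @^-1` `]a, b]%classic = `]a - d, b - d]%classic.
  by apply/seteqP; split=> x /=; rewrite !in_itv/= ltrBlDr lerBrDr.
rewrite !lebesgue_measure_itv/= !lte_fin ltrD2r.
by case: ifP => // _; rewrite -!EFinB; congr EFin; lra.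
Qed.

Lemma preserves_opp : preserves (fun x => - x).
Proof.
have mphi : measurable_fun setT ((fun x => - x) : mR -> mR) by exact: oppr_measurable.
by split=> // A mA; exact: lebesgue_measureN.
Qed.

Lemma preserves_comp phi psi : preserves phi -> preserves psi -> preserves (phi \o psi).
Proof.
move=> [m1 p1] [m2 p2]; split; first exact: (measurableT_comp m1 m2).
move=> A mA; rewrite comp_preimage p2 ?p1//.
by rewrite -[X in measurable X]setTI; exact: m1.
Qed.

Lemma preserves_reflect d : preserves (fun x => d - x).
Proof.
have -> : (fun x => d - x) = (fun x => x + d) \o (fun x => - x).
  by apply/funext => x /=; rewrite addrC.
by apply: preserves_comp; [exact: preserves_shift|exact: preserves_opp].
Qed.

Lemma ge0_integral_preserves phi (F : R -> \bar R) : preserves phi ->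
  measurable_fun setT F -> (forall x, 0 <= F x)%E ->
  (\int[mu]_x F (phi x) = \int[mu]_x F x)%E.
Proof.
move=> [m1 p1] mF F0.
pose phi' : {mfun mR >-> mR} := HB.pack (phi : mR -> mR)
  (isMeasurableFun.Build _ _ _ _ _ m1).
have := @ge0_integral_pushforward _ _ mR mR R phi m1 mu setT F measurableT mF (fun x _ => F0 x).
rewrite preimage_setT /= => <-.
apply: eq_measure_integral => A mA _; exact: p1.
Qed.

Lemma integrable_preserves phi f : preserves phi ->
  mu.-integrable setT (EFin \o f) -> mu.-integrable setT (EFin \o (f \o phi)).
Proof.
move=> p /integrableP[mf If]; apply/integrableP; split.
  apply/measurable_EFinP; apply: measurableT_comp; last exact: p.1.
  exact/measurable_EFinP.
rewrite (@ge0_integral_preserves phi (fun x => `|(f x)%:E|%E))//.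
by apply: measurableT_comp.
Qed.

Lemma Rintegral_preserves phi f : preserves phi ->
  mu.-integrable setT (EFin \o f) -> \int[mu]_x f (phi x) = \int[mu]_x f x.
Proof.
move=> p If; have Ifp := integrable_preserves p If.
have [m1 p1] := p.
pose phi' : {mfun mR >-> mR} := HB.pack (phi : mR -> mR)
  (isMeasurableFun.Build _ _ _ _ _ m1).
have mf : measurable_fun setT (EFin \o f) by case/integrableP : If.
have /= := @integral_pushforward _ _ mR mR R phi m1 mu setT (EFin \o f) mf Ifp measurableT.
rewrite preimage_setT /Rintegral /= => H; congr fine; rewrite -[LHS]H.
by apply: eq_measure_integral => A mA _; exact: p1.
Qed.

Lemma meas_preserves phi f : preserves phi ->
  measurable_fun setT f -> measurable_fun setT (f \o phi).
Proof. by move=> [m1 _] mf; exact: (measurableT_comp mf m1). Qed.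

Lemma sqint_preserves phi f : preserves phi -> sqint f -> sqint (f \o phi).
Proof.
move=> p Qf; apply: sqintP; first by apply: meas_preserves => //; exact: sqint_meas.
exact: (integrable_preserves p (sqint_integrable Qf)).
Qed.

Lemma ip_preserves phi f g : preserves phi -> sqint f -> sqint g ->
  ip (f \o phi) (g \o phi) = ip f g.
Proof. by move=> p Qf Qg; apply: (Rintegral_preserves p (sqintM Qf Qg)). Qed.

Lemma nm_preserves phi f : preserves phi -> sqint f -> nm (f \o phi) = nm f.
Proof. by move=> p Qf; rewrite /nm ip_preserves. Qed.

Lemma preserves_ae phi (P : R -> Prop) : preserves phi ->
  {ae mu, forall x, P x} -> {ae mu, forall x, P (phi x)}.
Proof.
move=> [m1 p1] [N [mN N0 PN]]; exists (phi @^-1` N); split.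
- by rewrite -[X in measurable X]setTI; exact: m1.
- by rewrite -N0; exact: p1.
- by move=> x /= Px; exact: PN.
Qed.

End MeasurePreserving.

(** * Compactly supported square integrable functions and their primitives *)

Section Primitive.
Context {R : realType}.
Notation mu := (@lebesgue_measure R).
Implicit Types (f g h : R -> R) (a b c d : R) (D : set R).

(** Compact support makes these functions integrable on the line, so that they have a primitive from
    -oo, and the class is stable under translations and reflections. *)
Definition csq f : Prop := sqint f /\ exists M, forall x, M < `|x| -> f x = 0.

Definition itg f : Prop := mu.-integrable setT (EFin \o f).

Lemma itgD f g : itg f -> itg g -> itg (f + g).
Proof. exact: integrableD. Qed.

Lemma itgZ k f : itg f -> itg (k *: f).
Proof. by move=> If; exact: (integrableZl measurableT k If). Qed.

Lemma itgN f : itg f -> itg (- f).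
Proof. by move=> If; rewrite -scaleN1r; exact: itgZ. Qed.

Lemma itgB f g : itg f -> itg g -> itg (f - g).
Proof. by move=> If Ig; apply: itgD => //; exact: itgN. Qed.

Lemma itg_patch f D : measurable D -> itg f -> itg (f \_ D).
Proof.
move=> mD If; rewrite /itg -restrict_EFin.
apply/integrable_restrict => //; rewrite setTI.
exact: integrableS If.
Qed.

Lemma itg_meas f : itg f -> measurable_fun setT f.
Proof. by move=> /integrableP[/measurable_EFinP]. Qed.

Lemma sqint_indic a b : sqint (\1_`[a, b] : R -> R).
Proof.
apply: sqintP; first exact: measurable_indic.
have := @integrable_indic_itv R a b true false.
apply: eq_integrable => // x _ /=; congr EFin.
by rewrite indicE; case: (x \in _); rewrite ?expr1n ?expr0n.
Qed.

Lemma patch_indic f D : f \_ D = f \* \1_D.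
Proof. by rewrite patch_indic. Qed.

Lemma sqint_itg_patch f a b : sqint f -> itg (f \_ `[a, b]).
Proof.
by move=> Qf; rewrite patch_indic; apply: sqintM => //; exact: sqint_indic.
Qed.

Lemma csq_itg f : csq f -> itg f.
Proof.
move=> [Qf [M f0]].
have -> : f = f \_ `[- M, M]; last exact: sqint_itg_patch.
apply/funext => x; rewrite patchE; case: ifPn => // /negP.
by rewrite inE /= in_itv/= -ler_norml => /negP; rewrite -ltNge => /f0.
Qed.

Lemma csqD f g : csq f -> csq g -> csq (f + g).
Proof.
move=> [Qf [M f0]] [Qg [N g0]]; split; first exact: sqintD.
exists (Num.max M N) => x; rewrite gt_max => /andP[xM xN].
by rewrite !fctE f0// g0// addr0.
Qed.

Lemma csqZ k f : csq f -> csq (k *: f).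
Proof.
move=> [Qf [M f0]]; split; first exact: sqintZ.
by exists M => x /f0; rewrite !fctE => ->; rewrite scaler0.
Qed.

Lemma csqN f : csq f -> csq (- f).
Proof. by move=> Kf; rewrite -scaleN1r; exact: csqZ. Qed.

Lemma csqB f g : csq f -> csq g -> csq (f - g).
Proof. by move=> Kf Kg; apply: csqD => //; exact: csqN. Qed.

Lemma csq0 : csq (0 : R -> R).
Proof. by split; [exact: sqint0|exists 0]. Qed.

Lemma csq_patch f D : measurable D -> csq f -> csq (f \_ D).
Proof.
move=> mD [Qf [M f0]]; split; first exact: sqint_patch.
by exists M => x /f0; rewrite patchE => ->; case: ifP.
Qed.

Lemma csq_shift f d : csq f -> csq (fun x => f (x + d)).
Proof.
move=> [Qf [M f0]]; split.
  by apply: (@sqint_preserves _ (fun x => x + d)) => //; exact: preserves_shift.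
exists (M + `|d|) => x; rewrite -ltrBrDr => xM; apply: f0.
by apply: lt_le_trans xM _; have := ler_normD (x + d) (- d); rewrite addrK normrN; lra.
Qed.

Lemma csq_reflect f d : csq f -> csq (fun x => f (d - x)).
Proof.
move=> [Qf [M f0]]; split.
  by apply: (@sqint_preserves _ (fun x => d - x)) => //; exact: preserves_reflect.
exists (M + `|d|) => x; rewrite -ltrBrDr => xM; apply: f0.
apply: lt_le_trans xM _; have := ler_normD (d - x) (- d); rewrite normrN.
by rewrite (_ : d - x - d = - x) ?normrN; [lra|ring].
Qed.

Lemma sqint_csq_patch f a b : sqint f -> csq (f \_ `[a, b]).
Proof.
move=> Qf; split; first exact: sqint_patch.
exists (`|a| + `|b|) => x xab; rewrite patchE; case: ifPn => //.
rewrite inE/= in_itv/= => /andP[ax xb]; exfalso; move: xab; rewrite ltNge => /negP; apply.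
have := ler_norm b; have := ler_norm a; have := ler_norm (- a); rewrite normrN.
have := normr_ge0 a; have := normr_ge0 b.
by case: (ger0P x); lra.
Qed.

(** Based at -oo, primitives commute with translations without an additive constant. *)
Definition prim f y : R := \int[mu]_(x in `]-oo, y]) f x.

Lemma primE f y : prim f y = \int[mu]_x (f \_ `]-oo, y]) x.
Proof. by rewrite /prim Rintegral_mkcond. Qed.

Lemma primD f g y : itg f -> itg g -> prim (f + g) y = prim f y + prim g y.
Proof.
move=> If Ig; rewrite /prim -RintegralD//; exact: integrableS If || exact: integrableS Ig.
Qed.

Lemma primZ k f y : itg f -> prim (k *: f) y = k * prim f y.
Proof. by move=> If; rewrite /prim -RintegralZl//; exact: integrableS If. Qed.

Lemma primN f y : itg f -> prim (- f) y = - prim f y.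
Proof. by move=> If; rewrite -scaleN1r primZ// mulN1r. Qed.

Lemma primB f g y : itg f -> itg g -> prim (f - g) y = prim f y - prim g y.
Proof. by move=> If Ig; rewrite primD ?primN//; exact: itgN. Qed.

Lemma int_itv f a b : a <= b -> itg f -> \int[mu]_(x in `[a, b]) f x = prim f b - prim f a.
Proof.
move=> ab If; rewrite /prim Rintegral_itvB//=; last exact: integrableS If.
by rewrite Rintegral_itv_obnd_cbnd//; exact: integrableS If.
Qed.

Lemma int_itv_patch f a b : \int[mu]_(x in `[a, b]) f x = \int[mu]_x (f \_ `[a, b]) x.
Proof. by rewrite Rintegral_mkcond. Qed.

Lemma prim_shift f d y : itg f -> prim (fun x => f (x + d)) y = prim f (y + d).
Proof.
move=> If; rewrite !primE.
rewrite -[RHS](@Rintegral_preserves _ (fun x => x + d)); last 2 first.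
- exact: preserves_shift.
- exact: itg_patch.
apply: eq_Rintegral => x _; rewrite !patchE.
by congr (if _ then _ else _); apply/idP/idP; rewrite !inE/= !in_itv/= lerD2r.
Qed.

Lemma int_reflect f a b d : a <= b -> itg f ->
  \int[mu]_(x in `[a, b]) f (d - x) = prim f (d - a) - prim f (d - b).
Proof.
move=> ab If; rewrite -int_itv ?lerD2l ?lerN2//.
rewrite !int_itv_patch -[RHS](@Rintegral_preserves _ (fun x => d - x)); last 2 first.
- exact: preserves_reflect.
- exact: itg_patch.
apply: eq_Rintegral => x _; rewrite !patchE.
congr (if _ then _ else _); apply/idP/idP; rewrite !inE/= !in_itv/= => /andP[]; lra.
Qed.

Lemma int_shift f a b d : a <= b -> itg f ->
  \int[mu]_(x in `[a, b]) f (x + d) = prim f (b + d) - prim f (a + d).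
Proof.
move=> ab If; rewrite int_itv//; last first.
  by apply: (@integrable_preserves _ (fun x => x + d)) => //; exact: preserves_shift.
by rewrite !(@prim_shift f).
Qed.

Lemma nm_indic a b : a <= b -> nm (\1_`[a, b] : R -> R) = Num.sqrt (b - a).
Proof.
move=> ab; rewrite /nm /ip; congr Num.sqrt.
transitivity (\int[mu]_(x in `[a, b]) (1 : R)).
  rewrite int_itv_patch; apply: eq_Rintegral => x _.
  by rewrite patch_indic/= mul1r indicE; case: (_ \in _); rewrite ?mulr1 ?mulr0.
rewrite Rintegral_cst//= mul1r lebesgue_measure_itv/= lte_fin.
by case: ltgtP ab => // -> _; rewrite subrr.
Qed.

(** Cauchy-Schwarz against the indicator of [a,b]; this is the origin of the Hoelder exponent 1/2
    that recurs below. *)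
Lemma prim_diff_le f a b : a <= b -> csq f ->
  `|prim f b - prim f a| <= nm f * Num.sqrt (b - a).
Proof.
move=> ab Kf; rewrite -int_itv//; last exact: csq_itg.
rewrite int_itv_patch patch_indic.
rewrite -nm_indic//.
apply: cauchy_schwarz; [exact: Kf.1|exact: sqint_indic].
Qed.

Lemma prim_continuous f : csq f -> continuous (prim f).
Proof.
move=> Kf x; apply/cvgrPdist_le => e e0.
have nf := nm_ge0 f.
pose k := nm f + 1.
have k0 : 0 < k by rewrite /k; lra.
near=> y.
have H : `|prim f x - prim f y| <= nm f * Num.sqrt `|x - y|.
  case: (leP x y) => xy.
    by rewrite distrC (distrC x) (ger0_norm (_ : 0 <= y - x)) ?subr_ge0//; exact: prim_diff_le.
  have yx := ltW xy; rewrite (ger0_norm (_ : 0 <= x - y)) ?subr_ge0//.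
    exact: prim_diff_le.
apply: le_trans H _.
have : `|x - y| <= (e / k) ^+ 2.
  by near: y; apply: cvgr_dist_le; [exact: cvg_id|rewrite exprn_gt0// divr_gt0].
have ek : 0 <= e / k by rewrite divr_ge0// ltW.
move=> /ler_wsqrtr; rewrite sqrtr_sqr (ger0_norm ek).
move=> H; apply: le_trans (ler_wpM2l nf H) _.
by rewrite mulrCA ger_pMr// ler_pdivrMr// mul1r /k; lra.
Unshelve. all: by end_near. Qed.

End Primitive.

(** * Continuity of translations in L^2 *)

Section TranslationContinuity.
Context {R : realType}.
Notation mu := (@lebesgue_measure R).
Notation mR := (measurableTypeR R).
Implicit Types (f g h : R -> R) (a b c d : R) (D : set R).

Lemma nm_dominated (u : nat -> R -> R) G :
  (forall n, measurable_fun setT (u n)) -> sqint G ->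
  (forall n x, `|u n x| <= `|G x|) -> (forall x, u n x @[n --> \oo] --> 0) ->
  nm (u n) @[n --> \oo] --> 0.
Proof.
move=> mu_ QG uG u0.
have [] := @dominated_convergence _ mR R mu setT measurableT
  (fun n x => (u n x ^+ 2)%:E) (cst 0%E) (fun x => (G x ^+ 2)%:E).
- by move=> n; apply/measurable_EFinP; exact: (measurable_funX 2 (mu_ n)).
- exact: measurable_cst.
- apply: aeW => x _; apply: cvg_EFin; first by near=> n.
  rewrite -[X in _ --> X](expr0n R 2).
  under eq_fun do rewrite /= expr2; rewrite expr2.
  by apply: cvgM; exact: u0.
- exact: (sqint_integrable QG).
- apply: aeW => x n _; rewrite abse_EFin lee_fin normrX.
  rewrite -[leRHS](real_normK (num_real (G x))).
  by rewrite lerXn2r ?nnegrE.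
move=> _ _; rewrite integral0 => H.
have H2 : ip (u n) (u n) @[n --> \oo] --> 0.
  rewrite -[X in _ --> X]/(fine 0%E).
  under eq_fun do rewrite /ip /Rintegral; apply: fine_cvg => /=.
  apply: cvg_trans H; apply: near_eq_cvg; near=> n; apply: eq_integral => x _.
  by rewrite /= expr2.
rewrite -[X in _ --> X]sqrtr0.
by apply: (cvg_comp _ _ H2); exact: sqrt_continuous.
Unshelve. all: by end_near. Qed.

(** Cutting f off where it exceeds n converges pointwise and is dominated by f. *)
Lemma truncation_approx f e : 0 < e -> sqint f ->
  exists N : nat, exists2 h : R -> R, measurable_fun setT h & 
    [/\ forall x, `|h x| <= `|f x|, forall x, `|h x| <= N%:R & nm (f - h) < e].
Proof.
move=> e0 Qf; have mf := sqint_meas Qf.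
pose h (n : nat) := f \_ (fun x => `|f x| <= n%:R).
have mh n : measurable_fun setT (h n).
  apply/(measurable_restrictT _ _).1; last exact: measurable_funS mf.
  rewrite (_ : (fun x => _) = [set: R] `&` [set x | `|f x| <= n%:R]); last first.
    by rewrite setTI.
  have m1 : measurable_fun setT (Num.norm \o f) by exact: measurableT_comp.
  rewrite (_ : [set x | _] = (Num.norm \o f) @^-1` `]-oo, n%:R]); last first.
    by apply/seteqP; split=> x /=; rewrite in_itv.
  by apply: m1.
have hf n x : `|h n x| <= `|f x| by rewrite /h patchE; case: ifP; rewrite ?normr0.
have : nm ((fun n => f - h n) n) @[n --> \oo] --> 0.
  apply: (@nm_dominated _ f) => //.
  - by move=> n; apply: measurable_funB.
  - by move=> n x; rewrite !fctE /= /h patchE; case: ifP; rewrite ?subrr ?normr0 ?subr0.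
  - move=> x; apply: cvg_near_cst; near=> n.
    rewrite !fctE /= /h patchE ifT ?subrr// inE.
    near: n; exact: nbhs_infty_ger.
move=> /cvgrPdist_lt /(_ _ e0) [N _ /(_ N (leqnn N))]/=.
rewrite sub0r normrN ger0_norm ?nm_ge0// => H.
exists N; exists (h N) => //; split=> // x.
by rewrite /h patchE; case: ifP => [|_]; [rewrite inE|rewrite normr0].
Unshelve. all: by end_near. Qed.

Lemma clip_lipschitz (N x y : R) : 0 <= N ->
  `|Num.max (- N) (Num.min N x) - Num.max (- N) (Num.min N y)| <= `|x - y|.
Proof.
move=> N0; rewrite ler_norml /Num.max /Num.min.
do !case: ifP; case: (ger0P (x - y)); lra.
Qed.

Lemma clip_bound (N x : R) : 0 <= N -> `|Num.max (- N) (Num.min N x)| <= N.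
Proof. by move=> N0; rewrite ler_norml /Num.max /Num.min; do !case: ifP => //; lra. Qed.

Lemma clip_id (N x : R) : `|x| <= N -> Num.max (- N) (Num.min N x) = x.
Proof.
by rewrite ler_norml => /andP[x1 x2]; rewrite min_r// max_r.
Qed.

(* Clipping g at height N turns L^1-closeness to the bounded f into L^2-closeness. *)
Lemma continuous_approx f M e : 0 < e -> sqint f ->
  exists g, [/\ continuous g, exists N : nat, forall x, `|g x| <= N%:R
    & nm ((f - g) \_ `[- M, M]) < e].
Proof.
move=> e0 Qf; have e20 : 0 < e / 2 by rewrite divr_gt0.
have [N [h mh [hf hN Hfh]]] := truncation_approx e20 Qf.
have Qh : sqint h by exact: le_sqint hf.
set E := `[- M, M]%classic.
have mE : measurable E by exact: measurable_itv.
have Efin : (mu E < +oo)%E.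
  by rewrite lebesgue_measure_itv/=; case: ifP => // _; rewrite -EFinB ltry.
have Ih : mu.-integrable E (EFin \o h).
  apply/integrable_mkcond => //; rewrite restrict_EFin; exact: sqint_itg_patch.
have [g_ [cg Ig Hg]] := approximation_continuous_integrable mE Efin Ih.
pose clip x : R := Num.max (- N%:R) (Num.min N%:R x).
have N0 : (0 : R) <= N%:R by [].
have clipN x : `|clip x| <= N%:R by exact: clip_bound.
have clipd x y : `|x| <= N%:R -> `|x - clip y| <= `|x - y|.
  by move=> xN; rewrite -{1}(clip_id xN); exact: clip_lipschitz.
have cclip : continuous clip.
  move=> x; apply/cvgrPdist_lt => r r0; near=> y.
  apply: (@le_lt_trans _ _ `|x - y|); first exact: clip_lipschitz.
  by near: y; apply: cvgr_dist_lt => //; exact: cvg_id.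
have ccg n : continuous (clip \o g_ n).
  by move=> x; apply: continuous_comp; [exact: cg|exact: cclip].
have mcg n : measurable_fun setT (clip \o g_ n) by exact: continuous_measurable_fun.
have mg n : measurable_fun setT (g_ n) by exact: continuous_measurable_fun.
(* As h and the clipped function are bounded by N, the square of their difference is at most 2 N |h
   - g|. The added 1 keeps the divisor positive. *)
have K0 : 0 < 2 * N%:R + 1 :> R by rewrite ltr_wpDl// mulr_ge0.
have e40 : (0 < ((e / 2) ^+ 2 / (2 * N%:R + 1))%:E :> \bar R)%E.
  by rewrite lte_fin divr_gt0// exprn_gt0.
have [n Hn] : exists n, (\int[mu]_(z in E) `|(h z - g_ n z)%:E| < ((e / 2) ^+ 2 / (2 * N%:R + 1))%:E)%E.
  move/fine_cvgP : Hg => [Hfin /cvgrPdist_lt]; move: e40; rewrite lte_fin => e40 /(_ _ e40) Hlt.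
  have [n _ /(_ n (leqnn n))] := filterI Hfin Hlt.
  move=> [/= fin]; rewrite sub0r normrN => Hn; exists n.
  by rewrite -(fineK fin) lte_fin; apply: le_lt_trans Hn; exact: ler_norm.
exists (clip \o g_ n); split=> //; first by exists N => x; exact: clipN.
have QcE : sqint ((clip \o g_ n) \_ E).
  apply: (@le_sqint _ _ (N%:R *: \1_E)); last first.
  - move=> x; rewrite !fctE patchE indicE; case: (x \in E); last by rewrite normr0.
    by rewrite [`|_ *: _|]ger0_norm ?mulr1 ?clipN// [_ *: _]mulr1.
  - by apply: sqintZ; exact: sqint_indic.
  - by apply/(measurable_restrictT _ _).1 => //; exact: measurable_funS (mcg n).
rewrite patchB -(subrKA (h \_ E)).
have -> : e = e / 2 + e / 2 by field.
apply: le_lt_trans (nmD _ _) _.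
- by apply: sqintB; exact: sqint_patch.
- by apply: sqintB => //; exact: sqint_patch.
apply: ltr_leD.
  by rewrite -patchB; apply: le_lt_trans Hfh; apply: nm_patch => //; exact: sqintB.
have Hd : sqint (h \_ E - (clip \o g_ n) \_ E) by apply: sqintB => //; exact: sqint_patch.
rewrite -(@ler_pXn2r _ 2)// ?nnegrE ?nm_ge0 ?(ltW e20)// nm_sqr.
have I2 := sqintM Hd Hd.
rewrite -lee_fin /ip /Rintegral fineK; last exact: integrable_fin_num.
apply: (@le_trans _ _ (\int[mu]_x ((2 * N%:R + 1)%:E * `|((h - g_ n) \_ E x)%:E|))%E).
  apply: ge0_le_integral => //=.
  - by move=> x _; rewrite lee_fin -expr2 sqr_ge0.
  - by case/integrableP : I2.
  - apply/measurable_EFinP; apply: measurable_funM; first exact: measurable_cst.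
    apply: measurableT_comp => //; apply/(measurable_restrictT _ _).1 => //.
    by apply: measurable_funS (measurable_funB mh (mg n)).
  - move=> x _; rewrite lee_fin !fctE /= !patchE; case: ifP => _; last first.
      by rewrite subrr mul0r normr0 mulr0.
    rewrite -expr2 -[leLHS](real_normK (num_real _)) expr2 ler_pM//.
      apply: (le_trans (ler_normB _ _)); have := hN x; have := clipN (g_ n x); lra.
    exact: clipd.
rewrite ge0_integralZl//=; try by rewrite lee_fin ltW.
all: try (apply/measurable_EFinP; apply: measurableT_comp => //;
  apply/(measurable_restrictT _ _).1 => //;
  by apply: measurable_funS (measurable_funB mh (mg n))).
rewrite muleC -lee_pdivlMr// -EFinM; apply: le_trans (ltW Hn).
rewrite [leRHS]integral_mkcond; apply: ge0_le_integral => //=.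
- apply/measurable_EFinP; apply: measurableT_comp => //.
  apply/(measurable_restrictT _ _).1 => //.
  by apply: measurable_funS (measurable_funB mh (mg n)).
- apply/(measurable_restrictT _ _).1 => //; apply/measurable_EFinP.
  apply: measurableT_comp => //.
  by apply: measurable_funS (measurable_funB mh (mg n)).
- by move=> x _; rewrite !patchE !fctE; case: ifP => // _; rewrite normr0.
Unshelve. all: by end_near. Qed.

Lemma nm_shift f d : sqint f -> nm (fun x => f (x + d)) = nm f.
Proof. by move=> Qf; exact: (nm_preserves (preserves_shift d) Qf). Qed.

Lemma nm_reflect f d : sqint f -> nm (fun x => f (d - x)) = nm f.
Proof. by move=> Qf; exact: (nm_preserves (preserves_reflect d) Qf). Qed.

Lemma sqint_shift f d : sqint f -> sqint (fun x => f (x + d)).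
Proof. by move=> Qf; rewrite -[X in sqint X]/(f \o (fun x => x + d)); apply: sqint_preserves => //; exact: preserves_shift. Qed.

Lemma sqint_reflect f d : sqint f -> sqint (fun x => f (d - x)).
Proof. by move=> Qf; apply: (@sqint_preserves _ (fun x => d - x)) => //; exact: preserves_reflect. Qed.

Lemma translation_seq g M N (d : nat -> R) : continuous g ->
  (forall x, `|g x| <= N) -> d n @[n --> \oo] --> 0 ->
  nm ((fun x => g (x + d n) - g x) \_ `[- M, M]) @[n --> \oo] --> 0.
Proof.
move=> cg gN d0; have N0 : 0 <= N := le_trans (normr_ge0 _) (gN 0).
apply: (@nm_dominated _ ((N + N) *: \1_`[- M, M])).
- move=> n; apply/(measurable_restrictT _ _).1 => //.
  apply: (@measurable_funS _ _ _ _ setT) => //; apply: continuous_measurable_fun => x.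
  apply: cvgB; last exact: cg.
  by apply: continuous_comp; [apply: cvgD; [exact: cvg_id|exact: cvg_cst]|exact: cg].
- by apply: sqintZ; exact: sqint_indic.
- move=> n x; rewrite !fctE patchE indicE; case: (x \in _); last by rewrite normr0.
  rewrite [_ *: _]mulr1 [leRHS]ger0_norm ?addr_ge0//.
  by apply: (le_trans (ler_normB _ _)); exact: lerD.
- move=> x; have H : (fun n => g (x + d n) - g x) @ \oo --> 0.
    rewrite -(subrr (g x)); apply: cvgB; last exact: cvg_cst.
    apply: (@cvg_comp _ _ _ (fun n => x + d n) g _ (nbhs x)); last exact: cg.
    have := cvgD (cvg_cst (x : R)) d0; rewrite addr0; exact.
  under eq_fun do rewrite patchE; case: (x \in _) => //; exact: cvg_cst.
Qed.

Lemma translation_continuity f e : 0 < e -> csq f ->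
  exists2 dl : R, 0 < dl & forall d, `|d| < dl -> nm ((fun x => f (x + d)) - f) <= e.
Proof.
move=> e0 [Qf [M0 f0]].
pose M := `|M0| + 1.
have fM x : M - 1 < `|x| -> f x = 0.
  by move=> H; apply: f0; apply: le_lt_trans H; rewrite /M addrK ler_norm.
have e30 : 0 < e / 3 by rewrite divr_gt0.
(* The interval is longer by 1 than [-M,M], so that the approximation survives a shift by |r| <
   1. *)
have [g [cg [N gN] Hg]] := continuous_approx (M + 1) e30 Qf.
(* Dominated convergence is about sequences: if no [dl] works, there are bad shifts [d n] tending to
   0. *)
apply: contrapT => H.
have {H} /choice[d Hd] : forall n : nat, exists d : R, `|d| < n.+1%:R^-1 /\ e < nm ((fun x => f (x + d)) - f).
  move=> n; apply: contrapT => H1; apply: H; exists n.+1%:R^-1; first by rewrite invr_gt0.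
  move=> d dn; rewrite leNgt; apply/negP => H2; apply: H1; by exists d.
have d0 : d n @[n --> \oo] --> 0.
  apply/cvgr0Pnorm_lt => r r0; near=> n.
  apply: lt_trans (Hd n).1 _; near: n; exact: near_infty_natSinv_lt (PosNum r0).
have := @translation_seq g M N%:R d cg gN d0.
move=> /cvgrPdist_lt /(_ _ e30) [n _ /(_ n (leqnn n))]/=.
rewrite sub0r normrN ger0_norm ?nm_ge0//.
have [d1 Hf] := Hd n; move: d1 Hf; set r := d n => r1 Hf Hr.
have {}r1 : `|r| < 1.
  by apply: lt_le_trans r1 _; rewrite invf_le1 ?ler1n.
move: Hf; apply/negP; rewrite -leNgt.
set I := `[- M, M]%classic; set J := `[- (M + 1), M + 1]%classic.
have mI : measurable I by exact: measurable_itv.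
have mJ : measurable J by exact: measurable_itv.
have mg : measurable_fun setT g by exact: continuous_measurable_fun.
have mgr : measurable_fun setT (fun x : R => g (x + r)).
  exact: (meas_preserves (preserves_shift r) mg).
have bnd (k : R -> R) a b : measurable_fun setT k -> (forall x, `|k x| <= N%:R) -> sqint (k \_ `[a, b]).
  move=> mk kN; apply: (@le_sqint _ _ (N%:R *: \1_`[a, b])).
  - by apply/(measurable_restrictT _ _).1 => //; exact: measurable_funS mk.
  - by apply: sqintZ; exact: sqint_indic.
  - move=> x; rewrite !fctE patchE indicE; case: (x \in _); last by rewrite normr0.
    by rewrite [_ *: _]mulr1 [leRHS]ger0_norm.
have Qfr := sqint_shift r Qf.
have QJ : sqint ((f - g) \_ J).
  by rewrite patchB; apply: sqintB; [exact: sqint_patch|exact: bnd].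
(* The first and last terms are approximation errors, the middle one is the translation error of the
   continuous function. Outside [-M,M] both f and its translate vanish. *)
have -> : (fun x => f (x + r)) - f =
  ((fun x => f (x + r) - g (x + r)) \_ I + (fun x => g (x + r) - g x) \_ I) - (f - g) \_ I.
  apply/funext => x; rewrite !(fctE, patchE); case: ifPn => xI; first by ring.
  have xM : M < `|x|.
    move: xI; rewrite notin_setE /I /= in_itv/= -ler_norml => /negP; by rewrite -ltNge.
  rewrite (fM x); last by apply: lt_trans xM; rewrite ltrBlDr ltrDl.
  rewrite fM ?subrr ?addr0//; have := ler_normB (x + r) r; rewrite addrK; lra.
have e3 : e = e / 3 + e / 3 + e / 3 by field.
have Q1 : sqint ((fun x => f (x + r) - g (x + r)) \_ I).
  rewrite (_ : _ \_ _ = (fun x => f (x + r)) \_ I - (fun x => g (x + r)) \_ I); last by rewrite -patchB.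
  by apply: sqintB; [exact: sqint_patch|exact: bnd].
have Q2 : sqint ((fun x => g (x + r) - g x) \_ I).
  rewrite (_ : _ \_ _ = (fun x => g (x + r)) \_ I - g \_ I); last by rewrite -patchB.
  by apply: sqintB; exact: bnd.
have Q3 : sqint ((f - g) \_ I).
  by rewrite patchB; apply: sqintB; [exact: sqint_patch|exact: bnd].
rewrite e3; apply: (le_trans (nmB _ _)) => //; first exact: sqintD.
apply: lerD; last first.
  apply: le_trans (ltW Hg); apply: le_nm => //; first exact: sqint_meas.
  move=> x; rewrite !patchE; case: ifPn => [|_]; last by rewrite normr0.
  by rewrite inE /I /= in_itv/= => xI; rewrite ifT// inE/= in_itv/=; lra.
apply: (le_trans (nmD _ _)) => //; apply: lerD; last exact: ltW.
apply: le_trans (ltW Hg); rewrite -(nm_shift r QJ).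
apply: le_nm; [exact: sqint_meas|exact: sqint_shift|move=> x].
rewrite !patchE; case: ifPn => [|_]; last by rewrite normr0.
rewrite inE /I /= in_itv/= => xI; rewrite ifT// inE /J /= in_itv/=.
by move: r1; rewrite ltr_norml; lra.
Unshelve. all: by end_near. Qed.

End TranslationContinuity.

(** * Difference quotients of primitives *)

Ltac itv_tac := rewrite ?mem_setE ?in_itv/=; do ?case: ifPn => ?; by [|exfalso; lra].

Section Fubini.
Context {R : realType}.
Notation mu := (@lebesgue_measure R).
Notation mR := (measurableTypeR R).
Implicit Types (f g h : R -> R) (a b c d : R) (D : set R).

Lemma itg_EFin f : itg f -> (\int[mu]_x (f x)%:E = (\int[mu]_x f x)%:E)%E.
Proof. by move=> If; rewrite /Rintegral fineK// integrable_fin_num. Qed.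

Lemma Rintegral_fubini (F : R -> R -> R) :
  measurable_fun setT (fun z : mR * mR => F z.1 z.2) ->
  (forall x, itg (F x)) -> (forall y, itg (F ^~ y)) ->
  (\int[mu]_x \int[mu]_y `|F x y|%:E < +oo)%E ->
  \int[mu]_x (\int[mu]_y F x y) = \int[mu]_y (\int[mu]_x F x y).
Proof.
move=> mF I1 I2 Ify.
have mF' : measurable_fun setT (fun z : mR * mR => (F z.1 z.2)%:E) by exact/measurable_EFinP.
have IF : (mu \x mu)%E.-integrable setT (fun z : mR * mR => (F z.1 z.2)%:E).
  exact/(integrable12ltyP mu mu mF').
have H := Fubini IF.
have -> : \int[mu]_x (\int[mu]_y F x y) = fine (\int[mu]_x \int[mu]_y (F x y)%:E)%E.
  by rewrite {1}/Rintegral; congr fine; apply: eq_integral => x _; rewrite itg_EFin.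
have -> : \int[mu]_y (\int[mu]_x F x y) = fine (\int[mu]_y \int[mu]_x (F x y)%:E)%E.
  by rewrite {1}/Rintegral; congr fine; apply: eq_integral => y _; rewrite itg_EFin.
by rewrite H.
Qed.

Lemma le_sqint_integral f (M : R) : measurable_fun setT f ->
  (\int[mu]_x (f x ^+ 2)%:E <= (M ^+ 2)%:E)%E -> 0 <= M -> sqint f /\ nm f <= M.
Proof.
move=> mf Hf M0.
have Qf : sqint f.
  apply: sqintP => //; apply/integrableP; split.
    by apply/measurable_EFinP; exact: (measurable_funX 2 mf).
  apply: (@le_lt_trans _ _ (M ^+ 2)%:E); last exact: ltry.
  apply: le_trans Hf; apply: ge0_le_integral => //=.
  - by apply/measurable_EFinP; apply: measurableT_comp => //; exact: (measurable_funX 2 mf).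
  - by apply/measurable_EFinP; exact: (measurable_funX 2 mf).
  - by move=> x _; rewrite ger0_norm ?sqr_ge0.
split=> //; rewrite -(@ler_pXn2r _ 2)// ?nnegrE ?nm_ge0// nm_sqr.
rewrite -lee_fin /ip /Rintegral fineK; last exact: integrable_fin_num (sqintM Qf Qf).
by under eq_integral => x _ do rewrite -expr2.
Qed.

Lemma prim_shift_continuous f d : csq f -> continuous (fun x => prim f (x + d)).
Proof.
move=> Kf x; apply: (@continuous_comp _ _ _ (fun x => x + d) (prim f)).
  by apply: cvgD; [exact: cvg_id|exact: cvg_cst].
exact: prim_continuous.
Qed.

(* Jensen on [a, b] followed by Tonelli *)
Lemma average_translation f a b e : a < b -> csq f -> 0 <= e ->
  (forall r, a <= r <= b -> nm ((fun x => f (x + r)) - f) <= e) ->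
  let A := fun x => (b - a)^-1 * (prim f (x + b) - prim f (x + a)) in
  sqint (A - f) /\ nm (A - f) <= e.
Proof.
move=> ab Kf e0 He A.
have If := csq_itg Kf; have Qf := Kf.1; have mf := sqint_meas Qf.
have ba : 0 < b - a by rewrite subr_gt0.
have mA : measurable_fun setT A.
  apply: continuous_measurable_fun => x; apply: cvgM; first exact: cvg_cst.
  by apply: cvgB; exact: prim_shift_continuous.
apply: le_sqint_integral => //; first exact: measurable_funB.
pose G (x r : R) := (b - a)^-1 * ((f (x + r) - f x) * \1_`[a, b] r) ^+ 2.
have G0 x r : 0 <= G x r by rewrite mulr_ge0 ?sqr_ge0// invr_ge0 ltW.
have mG : measurable_fun setT (fun z : mR * mR => (G z.1 z.2)%:E).
  apply/measurable_EFinP; apply: measurable_funM; first exact: measurable_cst.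
  apply: (measurable_funX 2); apply: measurable_funM; last first.
    by apply: (@measurableT_comp _ _ _ _ _ _ (\1_`[a, b] : mR -> R)) => //; exact: measurable_indic.
  apply: measurable_funB.
    apply: (@measurableT_comp _ _ _ _ _ _ (f : mR -> R)) => //.
    by apply: measurable_funD; [exact: measurable_fst|exact: measurable_snd].
  by apply: (@measurableT_comp _ _ _ _ _ _ (f : mR -> R)) => //.
have Qk x : sqint (fun r => (f (x + r) - f x) * \1_`[a, b] r).
  rewrite (_ : (fun r => _) = (fun r => f (r + x)) \_ `[a, b] - f x *: \1_`[a, b]).
    apply: sqintB; first by apply: sqint_patch => //; exact: sqint_shift.
    by apply: sqintZ; exact: sqint_indic.
  by apply/funext => r; rewrite patch_indic !fctE /= mulrBl (addrC x r).
have pointwise x : (((A - f) x ^+ 2)%:E <= \int[mu]_r (G x r)%:E)%E.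
  have -> : (\int[mu]_r (G x r)%:E)%E =
      ((b - a)^-1 * nm (fun r => (f (x + r) - f x) * \1_`[a, b] r) ^+ 2)%:E.
    rewrite nm_sqr /ip -RintegralZl//; last exact: sqintM.
    rewrite /Rintegral fineK; last first.
      apply: integrable_fin_num => //.
      exact: (itgZ (b - a)^-1 (sqintM (Qk x) (Qk x))).
    by apply: eq_integral => r _; rewrite /G expr2.
  rewrite lee_fin.
  have -> : (A - f) x = (b - a)^-1 * ip (fun r => (f (x + r) - f x) * \1_`[a, b] r) \1_`[a, b].
    rewrite !fctE /A; have -> : prim f (x + b) - prim f (x + a) =
       \int[mu]_(r in `[a, b]) f (r + x).
      by rewrite int_shift ?(ltW ab)// !(addrC x).
    rewrite -[X in _ - X]mul1r -(@mulVf _ (b - a)) ?gt_eqF// -mulrA -mulrBr; congr (_ * _).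
    have -> : (b - a) * f x = \int[mu]_(r in `[a, b]) (f x).
      by rewrite Rintegral_cst//= lebesgue_measure_itv/= lte_fin ab mulrC.
    rewrite !int_itv_patch -RintegralB//; last 2 first.
    - by apply: itg_patch => //; apply: (@integrable_preserves _ (fun r => r + x)) => //; exact: preserves_shift.
    - rewrite patch_indic; exact: (itgZ (f x) (@integrable_indic_itv R a b true false)).
    apply: eq_Rintegral => r _; rewrite !patchE indicE (addrC x).
    by case: (_ \in _); rewrite ?mulr1 ?mulr0// subr0.
  have := cauchy_schwarz (Qk x) (sqint_indic a b); rewrite (nm_indic (ltW ab)).
  move: (ip _ _) (nm _) (nm_ge0 (fun r => (f (x + r) - f x) * \1_`[a, b] r)) => I N N0 CS.
  have I2 : I ^+ 2 <= N ^+ 2 * (b - a).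
    rewrite -(real_normK (num_real I)) -[X in _ * X](@sqr_sqrtr _ (b - a)) ?(ltW ba)// -exprMn.
    by rewrite lerXn2r ?nnegrE ?mulr_ge0 ?sqrtr_ge0.
  have -> : (b - a)^-1 * N ^+ 2 = (b - a)^-1 ^+ 2 * (N ^+ 2 * (b - a)).
    by field; rewrite gt_eqF.
  by rewrite exprMn ler_wpM2l// sqr_ge0.
apply: (@le_trans _ _ (\int[mu]_x \int[mu]_r (G x r)%:E)%E).
  apply: ge0_le_integral => //=.
  - by move=> x _; rewrite lee_fin sqr_ge0.
  - by apply/measurable_EFinP; exact: (measurable_funX 2 (measurable_funB mA mf)).
  - apply: (@measurable_fun_fubini_tonelli_F _ _ mR mR R mu (fun z => (G z.1 z.2)%:E)) => // z; by rewrite lee_fin.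
have -> : (\int[mu]_x \int[mu]_r (G x r)%:E = \int[mu]_r \int[mu]_x (G x r)%:E)%E.
  by apply: (@fubini_tonelli _ _ mR mR R mu mu (fun z => (G z.1 z.2)%:E)) => // z; rewrite lee_fin.
apply: (@le_trans _ _ (\int[mu]_r ((b - a)^-1 * e ^+ 2 * \1_`[a, b] r)%:E)%E).
  apply: ge0_le_integral => //=.
  - by move=> r _; apply: integral_ge0 => x _; rewrite lee_fin.
  - apply: (@measurable_fun_fubini_tonelli_G _ _ mR mR R mu (fun z => (G z.1 z.2)%:E)) => // z; by rewrite lee_fin.
  - by apply/measurable_EFinP; apply: measurable_funM; [exact: measurable_cst|exact: measurable_indic].
  - move=> r _; have Qr := sqintB (sqint_shift r Qf) Qf.
    have -> : (\int[mu]_x (G x r)%:E = ((b - a)^-1 * \1_`[a, b] r * nm ((fun x => f (x + r)) - f) ^+ 2)%:E)%E.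
      rewrite nm_sqr /ip -RintegralZl//; last exact: sqintM.
      rewrite /Rintegral fineK; last first.
        apply: integrable_fin_num => //.
        exact: (itgZ _ (sqintM Qr Qr)).
      apply: eq_integral => x _; congr EFin; rewrite /G indicE !fctE.
      by case: (_ \in _) => /=; ring.
    rewrite lee_fin -!mulrA ler_wpM2l ?invr_ge0 ?(ltW ba)// mulrC indicE.
    case: (boolP (r \in _)) => [|_] /=; last by rewrite !mulr0.
    rewrite inE /= in_itv/= !mulr1 -expr2 => rab.
    by rewrite lerXn2r ?nnegrE ?nm_ge0// He.
have II := @integrable_indic_itv R a b true false.
under eq_integral do rewrite EFinM.
rewrite integralZl//= integral_indic//= setIT lebesgue_measure_itv/= lte_fin ab -EFinB -EFinM lee_fin.
by rewrite mulrAC mulVf ?gt_eqF// mul1r.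
Qed.

(** The quotient is the mean of the translates of f by the numbers between 0 and d. Both signs of d
    are covered because the velocity of a wave is a two-sided limit. *)
Lemma diff_quotient f e : 0 < e -> csq f ->
  exists2 dl : R, 0 < dl & forall d, d != 0 -> `|d| < dl ->
    let A := fun x => d^-1 * (prim f (x + d) - prim f x) in
    sqint (A - f) /\ nm (A - f) <= e.
Proof.
move=> e0 Kf; have [dl dl0 Hdl] := translation_continuity e0 Kf.
exists dl => // d dn0 ddl /=.
have [dp|dn] := ltP 0 d.
  have := @average_translation f 0 d e dp Kf (ltW e0).
  have -> : (fun x => (d - 0)^-1 * (prim f (x + d) - prim f (x + 0))) =
    (fun x => d^-1 * (prim f (x + d) - prim f x)).
    by apply/funext => x; rewrite addr0 subr0.
  apply=> r /andP[r0 rd]; apply: Hdl; apply: le_lt_trans ddl.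
  by rewrite !ger0_norm// (le_trans r0).
have {}dn : d < 0 by rewrite lt_neqAle dn0.
have := @average_translation f d 0 e dn Kf (ltW e0).
have -> : (fun x => (0 - d)^-1 * (prim f (x + 0) - prim f (x + d))) =
  (fun x => d^-1 * (prim f (x + d) - prim f x)).
  by apply/funext => x; rewrite addr0 sub0r invrN mulNr -mulrN opprB.
apply=> r /andP[rd r0]; apply: Hdl; apply: le_lt_trans ddl.
by rewrite !ler0_norm ?lerN2// ltW.
Qed.

(** Lebesgue differentiation: near each point of ]a,b[ the primitive of the restriction is
    constantly 0. *)
Lemma ae_eq0_of_prim f a b : itg f ->
  (forall x, a <= x <= b -> \int[mu]_(y in `[a, x]) f y = 0) ->
  {ae mu, forall x, a < x < b -> f x = 0}.
Proof.
move=> If H; pose g := f \_ `[a, b].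
have Ig : itg g by exact: itg_patch.
have locg : locally_integrable setT g by apply: integrable_locally => //; exact: integrableS If.
have Igy y : mu.-integrable `]-oo, y] (EFin \o g) by exact: integrableS Ig.
have := FTC1Ny Igy locg.
apply: (@filterS _ _ (ae_filter_ringOfSetsType mu)) => x [_ Hx] /andP[ax xb].
have gx : g x = f x.
  by rewrite /g patchE ifT// inE/= in_itv/= !ltW.
rewrite -gx -Hx derive1E.
have -> : 'D_1 (fun y : R => \int[mu]_(t in `]-oo, y]) g t) x = 'D_1 (cst (0 : R)) x.
  apply: near_eq_derive.
  have : \forall y \near x, a < y < b.
    have xab : x \in `]a, b[ by rewrite in_itv/= ax.
    by have := near_in_itvoo xab; apply: filterS => y; rewrite in_itv.
  apply: filterS => y /andP[ay yb].
  rewrite Rintegral_mkcond [RHS](_ : _ = \int[mu]_(t in `[a, y]) f t); last first.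
    by rewrite H// !ltW.
  rewrite int_itv_patch; apply: eq_Rintegral => t _; rewrite /g !patchE.
  itv_tac.
exact: derive_cst.
Unshelve. all: by end_near. Qed.

(* The double integral of f(x) k(y) over the triangles x <= y and y <= x *)
Lemma integration_by_parts_ac a b f k (F K : R -> R) : a <= b -> sqint f -> sqint k ->
  (forall x, a <= x <= b -> F x = F a + \int[mu]_(y in `[a, x]) f y) ->
  (forall x, a <= x <= b -> K x = K a + \int[mu]_(y in `[a, x]) k y) ->
  \int[mu]_(x in `[a, b]) (F x * k x) + \int[mu]_(x in `[a, b]) (f x * K x) =
  F b * K b - F a * K a.
Proof.
move=> ab Qf0 Qk0 HF0 HK0.
pose f1 := f \_ `[a, b]; pose k1 := k \_ `[a, b].
have Kf : csq f1 by exact: sqint_csq_patch.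
have Kk : csq k1 by exact: sqint_csq_patch.
have If := csq_itg Kf; have Ik := csq_itg Kk.
have patch_int h x : a <= x <= b -> \int[mu]_(y in `[a, x]) h y = prim (h \_ `[a, b]) x.
  move=> /andP[ax xb]; rewrite int_itv_patch primE; apply: eq_Rintegral => y _.
  rewrite !patchE.
  itv_tac.
have HF x : a <= x <= b -> F x = F a + prim f1 x by move=> xab; rewrite HF0// patch_int.
have HK x : a <= x <= b -> K x = K a + prim k1 x by move=> xab; rewrite HK0// patch_int.
have intE h1 h2 g : (forall x, a <= x <= b -> h1 x = h2 x) ->
  \int[mu]_(x in `[a, b]) (h1 x * g x) = ip h2 (g \_ `[a, b]).
  move=> h12; rewrite int_itv_patch /ip; apply: eq_Rintegral => x _; rewrite !patchE.
  by case: ifPn => [|_]; rewrite ?mulr0// inE/= in_itv/= => /h12 ->.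
rewrite (intE _ _ _ HF).
under [X in _ + X = _]eq_Rintegral do rewrite mulrC.
rewrite (intE _ _ _ HK) -/f1 -/k1.
have aab : a <= a <= b by rewrite lexx.
have bab : a <= b <= b by rewrite lexx andbT.
have tot h : csq (h \_ `[a, b]) -> \int[mu]_x (h \_ `[a, b]) x = prim (h \_ `[a, b]) b.
  move=> Kh; rewrite primE; apply: eq_Rintegral => x _; rewrite !patchE.
  itv_tac.
have prim_a h : prim (h \_ `[a, b]) a = 0.
  by rewrite -patch_int// set_itv1 Rintegral_set1.
have bdd h : csq h -> exists M, forall x, `|prim h x| <= M.
  move=> Kh; exists (\int[mu]_x `|h x|) => x; rewrite primE.
  have Ih := csq_itg Kh.
  have Ihx : itg (h \_ `]-oo, x]) by exact: itg_patch.
  apply: (le_trans (le_normr_Rintegral measurableT Ihx)).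
  apply: le_Rintegral => //; [exact: integrable_norm|exact: integrable_norm|].
  by move=> y _; rewrite patchE; case: ifP => // _; rewrite normr0.
have Iprim h1 h2 : csq h1 -> csq h2 -> itg (fun x => prim h1 x * h2 x).
  move=> K1 K2; have [M HM] := bdd _ K1.
  apply: (@le_integrable _ _ _ mu setT measurableT _ (EFin \o (fun x => M * h2 x))).
  - apply/measurable_EFinP; apply: measurable_funM; last exact: sqint_meas K2.1.
    by apply: continuous_measurable_fun; exact: prim_continuous.
  - move=> x _ /=; rewrite lee_fin !normrM ler_wpM2r//.
    by apply: le_trans (HM x) _; exact: ler_norm.
  - exact: (itgZ M (csq_itg K2)).
have split_ip c h1 h2 : csq h1 -> csq (h2 \_ `[a, b]) ->
  ip (fun x => c + prim h1 x) (h2 \_ `[a, b]) = c * prim (h2 \_ `[a, b]) b + ip (prim h1) (h2 \_ `[a, b]).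
  move=> K1 K2; rewrite /ip -tot// -RintegralZl//; last exact: csq_itg.
  rewrite -RintegralD//; [|exact: (itgZ c (csq_itg K2))|exact: Iprim].
  by apply: eq_Rintegral => x _; rewrite mulrDl.
rewrite !split_ip//.
suff H : ip (prim f1) k1 + ip (prim k1) f1 = prim f1 b * prim k1 b.
  rewrite (HF _ bab) (HK _ bab); move: H; rewrite -/f1 -/k1.
  move: (ip (prim f1) k1) (ip (prim k1) f1) => u v H.
  have -> : u = prim f1 b * prim k1 b - v by rewrite -H addrK.
  ring.
pose Phi (x y : R) := if y <= x then k1 x * f1 y else 0.
have Phi1 x : \int[mu]_y Phi x y = prim f1 x * k1 x.
  rewrite mulrC primE -RintegralZl//; last exact: itg_patch.
  apply: eq_Rintegral => y _; rewrite /Phi patchE mem_setE in_itv/=.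
  by case: ifP => _; rewrite ?mulr0.
have Phi2 y : \int[mu]_x Phi x y = prim k1 b * f1 y - prim k1 y * f1 y.
  rewrite -mulrBl.
  have -> : prim k1 b - prim k1 y = \int[mu]_(x in `[y, +oo[) k1 x.
    rewrite -tot// /prim -Rintegral_itv_obnd_cbnd; last exact: integrableS Ik.
    rewrite -(@Rintegral_itvB _ _ -oo%O +oo%O y)//; first by rewrite set_itvNyy.
    by rewrite set_itvNyy.
  rewrite -RintegralZr//; last exact: integrableS Ik.
  rewrite [RHS]Rintegral_mkcond.
  apply: eq_Rintegral => x _; rewrite /Phi patchE mem_setE in_itv/= andbT.
  by case: ifP => _; rewrite ?mul0r.
have mPhi : measurable_fun setT (fun z : mR * mR => Phi z.1 z.2).
  apply: measurable_fun_ifT.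
  - by apply: measurable_fun_ler; [exact: measurable_snd|exact: measurable_fst].
  - apply: measurable_funM; apply: (@measurableT_comp _ _ _ _ _ _ (_ : mR -> R)) => //; exact: itg_meas.
  - exact: measurable_cst.
have le1 x y : `|Phi x y| <= `|k1 x| * `|f1 y|.
  by rewrite /Phi; case: ifP => _; rewrite ?normrM// normr0 mulr_ge0.
have IPx x : itg (Phi x).
  have -> : Phi x = k1 x *: (f1 \_ `]-oo, x]).
    apply/funext => y; rewrite /Phi !fctE patchE mem_setE in_itv/=.
    by case: ifP => _; rewrite ?scaler0.
  by apply: itgZ; exact: itg_patch.
have IPy y : itg (Phi ^~ y).
  have -> : Phi ^~ y = f1 y *: (k1 \_ `[y, +oo[).
    apply/funext => x; rewrite /Phi !fctE patchE mem_setE in_itv/= andbT mulrC.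
    by case: ifP => _; rewrite ?scaler0.
  by apply: itgZ; exact: itg_patch.
have nI h : itg h -> itg (fun x => `|h x|) by move=> Ih; exact: integrable_norm.
have Ify : (\int[mu]_x \int[mu]_y `|Phi x y|%:E < +oo)%E.
  apply: (@le_lt_trans _ _ (\int[mu]_x (`|k1 x| * \int[mu]_y `|f1 y|)%:E)%E); last first.
    have := integrable_lty measurableT (itgZ (\int[mu]_y `|f1 y|) (nI _ Ik)).
    apply: le_lt_trans; rewrite le_eqVlt; apply/orP; left; apply/eqP.
    by apply: eq_integral => x _ /=; rewrite mulrC.
  apply: ge0_le_integral => //=.
  - by move=> x _; apply: integral_ge0.
  - apply: (@measurable_fun_fubini_tonelli_F _ _ mR mR R mu (fun z => `|Phi z.1 z.2|%:E)) => //.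
    by apply/measurable_EFinP; apply: measurableT_comp.
  - apply/measurable_EFinP; apply: measurable_funM; last exact: measurable_cst.
    by apply: itg_meas; exact: nI.
  - move=> x _; rewrite -RintegralZl//; last exact: nI.
    rewrite -itg_EFin; last exact: (itgZ `|k1 x| (nI _ If)).
    apply: ge0_le_integral => //=.
    + by apply/measurable_EFinP; apply: itg_meas (nI _ (IPx x)).
    + by apply/measurable_EFinP; apply: measurable_funM; [exact: measurable_cst|exact: itg_meas (nI _ If)].
    + by move=> y _; rewrite lee_fin.
have := Rintegral_fubini mPhi IPx IPy Ify.
under eq_Rintegral do rewrite Phi1; under [RHS]eq_Rintegral do rewrite Phi2.
rewrite -/(ip (prim f1) k1) => ->.
rewrite RintegralB//; [|exact: (itgZ (prim k1 b) If)|exact: Iprim].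
rewrite RintegralZl// tot// /ip; ring.
Qed.

End Fubini.

(** * Weak derivatives and the energy space *)

Section WeakDerivatives.
Context {R : realType}.
Notation mu := (@lebesgue_measure R).
Implicit Types (f g h u v : R -> R) (a b c d x : R).

Lemma sqint_L2 a b f : sqint f -> L2 a b f.
Proof. by move=> Qf; apply: sqint_patch. Qed.

Lemma patchoo_cc f a b : (f \_ `]a, b[) \_ `[a, b] = f \_ `]a, b[.
Proof. by apply/funext => x; rewrite !patchE; itv_tac. Qed.

Lemma L2_csq a b f : L2 a b f -> csq (f \_ `]a, b[).
Proof. by move=> Lf; rewrite -patchoo_cc; exact: sqint_csq_patch. Qed.

Lemma L2D a b f g : L2 a b f -> L2 a b g -> L2 a b (f + g).
Proof. by move=> Lf Lg; rewrite /L2 patchD; exact: sqintD. Qed.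

Lemma L2Z a b k f : L2 a b f -> L2 a b (k *: f).
Proof. by move=> Lf; rewrite /L2 patchZ; exact: sqintZ. Qed.

Lemma patch_mul f g D : (f \* g) \_ D = (f \_ D) \* (g \_ D).
Proof. by apply/funext => x; rewrite !patchE/= !patchE; case: ifP; rewrite ?mulr0. Qed.

Lemma int_oo_cc a b h : itg (h \_ `]a, b[) ->
  \int[mu]_(x in `[a, b]) h x = \int[mu]_x (h \_ `]a, b[) x.
Proof.
move=> Ih; rewrite -Rintegral_mkcond /Rintegral integral_itv_bndoo//.
by apply/measurable_EFinP; have := itg_meas Ih => /(measurable_restrictT _ _).2; exact.
Qed.

Lemma dotL2E a b f g : L2 a b f -> L2 a b g ->
  dotL2 a b f g = ip (f \_ `]a, b[) (g \_ `]a, b[).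
Proof.
move=> Lf Lg; rewrite /dotL2 int_oo_cc -/(f \* g); last first.
  by rewrite patch_mul; exact: sqintM.
by rewrite patch_mul.
Qed.

Lemma patchoo_sub f a b x : a <= x <= b ->
  f \_ `]a, x[ = (f \_ `]a, b[) \_ `]a, x[.
Proof. by move=> /andP[ax xb]; apply/funext => y; rewrite !patchE; itv_tac. Qed.

(** The representative is arbitrary at a and b and known to be measurable on ]a,b[ only, so the
    closed interval has to be traded for the open one before restricting. *)
Lemma int_prim a b f x : L2 a b f -> a <= x <= b ->
  \int[mu]_(y in `[a, x]) f y = prim (f \_ `]a, b[) x.
Proof.
move=> Lf axb; have /andP[ax xb] := axb.
have If := csq_itg (L2_csq Lf).
rewrite int_oo_cc; last by rewrite (patchoo_sub _ axb); exact: itg_patch.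
rewrite -[LHS]int_oo_cc; last by rewrite (patchoo_sub _ axb); exact: itg_patch.
transitivity (\int[mu]_(y in `[a, x]) (f \_ `]a, b[) y).
  rewrite !int_oo_cc ?(patchoo_sub f axb)//; exact: itg_patch.
rewrite int_itv// [X in _ - X](_ : _ = 0) ?subr0//.
rewrite primE (_ : _ \_ _ = cst 0) ?Rintegral_cst ?mul0r//.
by apply/funext => y; rewrite !patchE; itv_tac.
Qed.

Lemma weak_derivP a b f g : L2 a b g -> weak_deriv a b f g <->
  forall x, a <= x <= b -> f x = f a + prim (g \_ `]a, b[) x.
Proof.
move=> Lg; split=> [[_ H] x xab|H]; first by rewrite (H x xab) (int_prim Lg xab).
by split=> // x xab; rewrite (int_prim Lg xab); exact: H.
Qed.

Lemma weak_deriv_prim a b f g : weak_deriv a b f g ->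
  forall x, a <= x <= b -> f x = f a + prim (g \_ `]a, b[) x.
Proof. by move=> H; exact: (weak_derivP _ H.1).1. Qed.

Lemma weak_derivD a b f g f' g' : weak_deriv a b f g -> weak_deriv a b f' g' ->
  weak_deriv a b (f + f') (g + g').
Proof.
move=> H H'; apply/weak_derivP; first by apply: L2D; [exact: H.1|exact: H'.1].
move=> x xab; rewrite !fctE (weak_deriv_prim H xab) (weak_deriv_prim H' xab).
rewrite patchD primD; [ring|exact/csq_itg/L2_csq/H.1|exact/csq_itg/L2_csq/H'.1].
Qed.

Lemma weak_derivZ a b k f g : weak_deriv a b f g -> weak_deriv a b (k *: f) (k *: g).
Proof.
move=> H; apply/weak_derivP; first by apply: L2Z; exact: H.1.
move=> x xab; rewrite !fctE (weak_deriv_prim H xab).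
rewrite patchZ primZ; last exact/csq_itg/L2_csq/H.1.
by rewrite scalerDr.
Qed.

Lemma weak_derivN a b f g : weak_deriv a b f g -> weak_deriv a b (- f) (- g).
Proof. by move=> H; rewrite -(scaleN1r f) -(scaleN1r g); exact: weak_derivZ. Qed.

Lemma weak_derivB a b f g f' g' : weak_deriv a b f g -> weak_deriv a b f' g' ->
  weak_deriv a b (f - f') (g - g').
Proof. by move=> H H'; apply: weak_derivD => //; exact: weak_derivN. Qed.

Lemma weak_deriv_ext a b f f' g : (forall x, a <= x <= b -> f x = f' x) -> a <= b ->
  weak_deriv a b f g -> weak_deriv a b f' g.
Proof.
move=> ff' ab [Lg H]; split=> // x xab.
by have aab : a <= a <= b; [rewrite lexx|rewrite -(ff' x xab) -(ff' a aab) H].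
Qed.

Lemma ae_patch a b f g : {ae mu, forall x, a < x < b -> f x = g x} ->
  {ae mu, forall x, (f \_ `]a, b[) x = (g \_ `]a, b[) x}.
Proof.
apply: (@filterS _ _ (ae_filter_ringOfSetsType mu)) => x H.
by rewrite !patchE mem_setE in_itv/=; case: ifP.
Qed.

Lemma prim_ae f g x : itg f -> itg g -> {ae mu, forall x, f x = g x} ->
  prim f x = prim g x.
Proof.
move=> If Ig fg; rewrite /prim /Rintegral; congr fine.
apply: ae_eq_integral => //.
- exact: measurable_int (integrableS _ _ _ If).
- exact: measurable_int (integrableS _ _ _ Ig).
- apply: (@filterS _ _ (ae_filter_ringOfSetsType mu) _ _ _ fg) => y /= -> //.
Qed.

Lemma weak_deriv_unique a b f g g' : weak_deriv a b f g -> weak_deriv a b f g' ->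
  {ae mu, forall x, a < x < b -> g x = g' x}.
Proof.
move=> H H'.
have Kg := L2_csq H.1; have Kg' := L2_csq H'.1.
pose d := g \_ `]a, b[ - g' \_ `]a, b[.
have Id : itg d by apply: csq_itg; exact: csqB.
have dE : d = d \_ `]a, b[ by rewrite /d -patchB; apply/funext => y; rewrite !patchE; itv_tac.
have Ld : L2 a b d by rewrite /L2 -dE; exact: (csqB Kg Kg').1.
have : {ae mu, forall x, a < x < b -> d x = 0}.
  apply: ae_eq0_of_prim => // x xab; rewrite (int_prim Ld xab) -dE /d primB; try exact: csq_itg.
  have := weak_deriv_prim H xab; rewrite (weak_deriv_prim H' xab) => /addrI ->.
  by rewrite subrr.
apply: (@filterS _ _ (ae_filter_ringOfSetsType mu)) => x Hx xab.
have := Hx xab; rewrite /d !fctE !patchE mem_setE in_itv/= xab => /eqP.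
by rewrite subr_eq0 => /eqP.
Qed.

Lemma wderivP a b f : H1 a b f -> weak_deriv a b f (wderiv a b f).
Proof. by move=> [g Hg]; rewrite /wderiv; apply: (@xgetPex _ 0 [set g | weak_deriv a b f g]); exists g. Qed.

Lemma wderiv_ae a b f g : weak_deriv a b f g ->
  {ae mu, forall x, (wderiv a b f \_ `]a, b[) x = (g \_ `]a, b[) x}.
Proof. by move=> H; apply: ae_patch; apply: (@weak_deriv_unique a b f) => //; apply: wderivP; exists g. Qed.

(** Functions equal on [a,b] have the same set of weak derivatives, hence the same chosen one: an
    exact equality, not one up to null sets. *)
Lemma wderiv_ext a b f f' : a <= b -> (forall x, a <= x <= b -> f x = f' x) ->
  wderiv a b f = wderiv a b f'.
Proof.
move=> ab ff'; rewrite /wderiv; congr xget; apply/seteqP; split=> g /=.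
- exact: weak_deriv_ext.
- by apply: weak_deriv_ext => // x /ff'.
Qed.

Lemma weak_deriv_diff a b f g x y : weak_deriv a b f g -> a <= x <= b -> a <= y <= b ->
  `|f x - f y| <= nm (g \_ `]a, b[) * Num.sqrt `|x - y|.
Proof.
move=> H xab yab; rewrite (weak_deriv_prim H xab) (weak_deriv_prim H yab).
rewrite opprD addrACA subrr add0r.
have K := L2_csq H.1.
have [xy|yx] := leP x y.
  by rewrite distrC (distrC x) (ger0_norm (_ : 0 <= y - x)) ?subr_ge0//; exact: prim_diff_le.
have {}yx := ltW yx.
by rewrite (ger0_norm (_ : 0 <= x - y)) ?subr_ge0//; exact: prim_diff_le.
Qed.

Lemma weak_deriv_by_parts a b f g h k : a <= b -> weak_deriv a b f g -> weak_deriv a b h k ->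
  dotL2 a b f k + dotL2 a b g h = f b * h b - f a * h a.
Proof.
move=> ab H H'.
have := @integration_by_parts_ac _ a b (g \_ `]a, b[) (k \_ `]a, b[) f h ab
   (L2_csq H.1).1 (L2_csq H'.1).1.
have intp (q : R -> R) x : L2 a b q -> a <= x <= b ->
   \int[mu]_(y in `[a, x]) (q \_ `]a, b[) y = prim (q \_ `]a, b[) x.
  move=> Lq xab; rewrite (int_prim (sqint_L2 a b Lq) xab).
  by congr prim; apply/funext => y; rewrite !patchE; itv_tac.
have Hf x (xab : a <= x <= b) : f x = f a + \int[mu]_(y in `[a, x]) (g \_ `]a, b[) y.
  by rewrite (intp _ _ H.1 xab); exact: weak_deriv_prim.
have Hh x (xab : a <= x <= b) : h x = h a + \int[mu]_(y in `[a, x]) (k \_ `]a, b[) y.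
  by rewrite (intp _ _ H'.1 xab); exact: weak_deriv_prim.
move=> /(_ Hf Hh).
have mcont (q : R -> R) r : weak_deriv a b q r -> measurable_fun `]a, b[ q.
  move=> Hq; apply: (@eq_measurable_fun _ _ _ _ _ (fun x => q a + prim (r \_ `]a, b[) x)).
    move=> x; rewrite inE/= in_itv/= => /andP[ax xb]; rewrite -(weak_deriv_prim Hq)// !ltW//.
  apply: measurable_funD; first exact: measurable_cst.
  apply: (@measurable_funS _ _ _ _ setT) => //; apply: continuous_measurable_fun.
  exact/prim_continuous/L2_csq/Hq.1.
have oo (p q : R -> R) r : weak_deriv a b q r -> L2 a b p ->
    \int[mu]_(x in `[a, b]) (q x * (p \_ `]a, b[) x) = dotL2 a b q p.
  move=> Hq Lp; rewrite /dotL2 /Rintegral; congr fine.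
  have mp : measurable_fun `]a, b[ p.
    by have := sqint_meas Lp => /(measurable_restrictT _ _).2; apply.
  have m1 : measurable_fun `]a, b[ (fun x => (q x * (p \_ `]a, b[) x)%:E).
    apply/measurable_EFinP; apply: measurable_funM; first exact: mcont Hq.
    exact: measurable_funS (sqint_meas Lp).
  have m2 : measurable_fun `]a, b[ (fun x => (q x * p x)%:E).
    by apply/measurable_EFinP; apply: measurable_funM => //; exact: mcont Hq.
  rewrite (integral_itv_bndoo true false m1) (integral_itv_bndoo true false m2).
  by apply: eq_integral => x xab; rewrite patchE xab.
move=> <-; rewrite (oo _ _ _ H)//; last exact: H'.1.
congr (_ + _); rewrite [LHS](_ : _ = dotL2 a b h g); last first.
  by apply: eq_Rintegral => x _; rewrite mulrC.
rewrite -(oo _ _ _ H')//; last exact: H.1.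
by apply: eq_Rintegral => x _; rewrite mulrC.
Qed.

End WeakDerivatives.

Section EnergySpaceTheory.
Context {R : realType}.
Notation mu := (@lebesgue_measure R).
Implicit Types (f g h u v : R -> R) (a b c d x l : R) (z w y : state R).

Lemma H1D a b f g : H1 a b f -> H1 a b g -> H1 a b (f + g).
Proof. by move=> [f' Hf] [g' Hg]; exists (f' + g'); exact: weak_derivD. Qed.

Lemma H1Z a b k f : H1 a b f -> H1 a b (k *: f).
Proof. by move=> [f' Hf]; exists (k *: f'); exact: weak_derivZ. Qed.

Lemma HhalfD l f g : Hhalf l f -> Hhalf l g -> Hhalf l (f + g).
Proof. by move=> [Hf f0] [Hg g0]; split; [exact: H1D|rewrite !fctE f0 g0 addr0]. Qed.

Lemma HhalfZ l k f : Hhalf l f -> Hhalf l (k *: f).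
Proof. by move=> [Hf f0]; split; [exact: H1Z|rewrite !fctE f0 scaler0]. Qed.

Lemma calHD l z w : calH l z -> calH l w -> calH l (z + w).
Proof. by move=> [h1 l1] [h2 l2]; split; [exact: HhalfD|exact: L2D]. Qed.

Lemma calHZ l k z : calH l z -> calH l (k *: z).
Proof. by move=> [h1 l1]; split; [exact: HhalfZ|exact: L2Z]. Qed.

Lemma calHN l z : calH l z -> calH l (- z).
Proof. by move=> Hz; rewrite -(scaleN1r z); exact: calHZ. Qed.

Lemma calHB l z w : calH l z -> calH l w -> calH l (z - w).
Proof. by move=> Hz Hw; apply: calHD => //; exact: calHN. Qed.

Lemma L2_0 a b : L2 a b (0 : R -> R).
Proof. exact/sqint_L2/sqint0. Qed.

Lemma weak_deriv0 a b : weak_deriv a b (0 : R -> R) 0.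
Proof.
by have := weak_derivP (0 : R -> R) (L2_0 a b); move=> /proj2; apply=> x _;
  rewrite add0r primE (_ : _ \_ _ = cst 0) ?Rintegral_cst ?mul0r//;
  apply/funext => y; rewrite !patchE; do !case: ifP.
Qed.

Lemma calH0 l : calH l 0.
Proof. by split; [split=> //; exists 0; exact: weak_deriv0|exact: L2_0]. Qed.

(* The two L^2 components of a state: u_x and u_t, cut off to the interval *)
Definition strain l z : R -> R := wderiv 0 l z.1 \_ `]0, l[.
Definition speed l z : R -> R := z.2 \_ `]0, l[.

Lemma strain_csq l z : calH l z -> csq (strain l z).
Proof. by move=> [[Hz _] _]; apply: L2_csq; exact: (wderivP Hz).1. Qed.

Lemma speed_csq l z : calH l z -> csq (speed l z).
Proof. by move=> [_ Lz]; exact: L2_csq. Qed.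

Lemma csq_meas f : csq f -> measurable_fun setT f.
Proof. by move=> [Qf _]; exact: sqint_meas. Qed.

Lemma strain_meas l z : calH l z -> measurable_fun setT (strain l z).
Proof. by move=> Hz; exact: csq_meas (strain_csq Hz). Qed.

Lemma dotHE l z w : calH l z -> calH l w ->
  dotH l z w = ip (strain l z) (strain l w) + ip (speed l z) (speed l w).
Proof.
move=> [[Hz z0] Lz] [[Hw w0] Lw]; rewrite /dotH !dotL2E//.
- exact: (wderivP Hz).1.
- exact: (wderivP Hw).1.
Qed.

Lemma dotHC l z w : dotH l z w = dotH l w z.
Proof. by rewrite /dotH; congr (_ + _); apply: eq_Rintegral => x _; rewrite mulrC. Qed.

Lemma dotH_ge0 l z : 0 <= dotH l z z.
Proof. by rewrite addr_ge0//; apply: Rintegral_ge0 => x _; rewrite -expr2 sqr_ge0. Qed.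

(** Only almost everywhere, since choosing a weak derivative is not a linear operation. *)
Lemma strain_lin l k z w : calH l z -> calH l w ->
  {ae mu, forall x, strain l (k *: z + w) x = (k *: strain l z + strain l w) x}.
Proof.
move=> [[Hz z0] Lz] [[Hw w0] Lw].
have := wderiv_ae (weak_derivD (weak_derivZ k (wderivP Hz)) (wderivP Hw)).
by rewrite patchD patchZ.
Qed.

Lemma dotH_linl l k z w y : calH l z -> calH l w -> calH l y ->
  dotH l (k *: z + w) y = k * dotH l z y + dotH l w y.
Proof.
move=> Hz Hw Hy; have Hzw : calH l (k *: z + w) by apply: calHD => //; exact: calHZ.
rewrite !dotHE// (ae_ip _ _ _ (strain_lin k Hz Hw)); first last.
- exact: strain_meas.
- by apply: csq_meas; apply: csqD; [apply: csqZ|]; exact: strain_csq.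
- exact: strain_meas.
have -> : speed l (k *: z + w) = k *: speed l z + speed l w.
  by rewrite /speed -patchZ -patchD.
have [Qz _] := strain_csq Hz; have [Qw _] := strain_csq Hw; have [Qy _] := strain_csq Hy.
have [Pz _] := speed_csq Hz; have [Pw _] := speed_csq Hw; have [Py _] := speed_csq Hy.
have Qkz := sqintZ k Qz; have Pkz := sqintZ k Pz.
by rewrite !ipDl// !ipZl//; ring.
Qed.

Lemma dotHDl l z w y : calH l z -> calH l w -> calH l y ->
  dotH l (z + w) y = dotH l z y + dotH l w y.
Proof. by move=> Hz Hw Hy; rewrite -[z]scale1r dotH_linl// mul1r scale1r. Qed.

Lemma dotH0l l y : calH l y -> dotH l 0 y = 0.
Proof.
move=> Hy; have := dotHDl (calH0 l) (calH0 l) Hy; rewrite addr0 => /eqP.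
by rewrite -subr_eq0 opprD addrA subrr sub0r oppr_eq0 => /eqP.
Qed.

Lemma dotHZl l k z y : calH l z -> calH l y -> dotH l (k *: z) y = k * dotH l z y.
Proof.
by move=> Hz Hy; have := dotH_linl k Hz (calH0 l) Hy; rewrite addr0 dotH0l// addr0.
Qed.

Lemma dotHBl l z w y : calH l z -> calH l w -> calH l y ->
  dotH l (z - w) y = dotH l z y - dotH l w y.
Proof.
move=> Hz Hw Hy; rewrite dotHDl//; last exact: calHN.
by rewrite -scaleN1r dotHZl// mulN1r.
Qed.

Lemma dotHBr l z w y : calH l z -> calH l w -> calH l y ->
  dotH l y (z - w) = dotH l y z - dotH l y w.
Proof. by move=> Hz Hw Hy; rewrite !(dotHC l y) dotHBl. Qed.

Lemma normH_ge0 l z : 0 <= normH l z. Proof. exact: sqrtr_ge0. Qed.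

Lemma normH_sqr l z : normH l z ^+ 2 = dotH l z z.
Proof. by rewrite sqr_sqrtr// dotH_ge0. Qed.

Lemma dotH_cauchy l z w : calH l z -> calH l w -> `|dotH l z w| <= normH l z * normH l w.
Proof.
move=> Hz Hw; rewrite -sqrtrM ?dotH_ge0// -sqrtr_sqr ler_wsqrtr//.
apply: discriminant_bound => [||t]; try exact: dotH_ge0.
have -> : dotH l z z + t * dotH l z w *+ 2 + t ^+ 2 * dotH l w w =
    dotH l (t *: w + z) (t *: w + z).
  have Hwz : calH l (t *: w + z) by apply: calHD => //; exact: calHZ.
  by rewrite dotH_linl// !(dotHC l _ (t *: w + z)) !dotH_linl// (dotHC l w z); ring.
exact: dotH_ge0.
Qed.

Lemma normHD l z w : calH l z -> calH l w -> normH l (z + w) <= normH l z + normH l w.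
Proof.
move=> Hz Hw; rewrite -(@ler_pXn2r _ 2)// ?nnegrE ?addr_ge0 ?normH_ge0//.
have Hzw := calHD Hz Hw.
rewrite sqrrD !normH_sqr dotHDl// !(dotHC l _ (z + w)) !dotHDl// (dotHC l w z).
have := dotH_cauchy Hz Hw; have := ler_norm (dotH l z w); lra.
Qed.

Lemma normHZ l k z : calH l z -> normH l (k *: z) = `|k| * normH l z.
Proof.
move=> Hz; have Hkz := calHZ k Hz.
rewrite /normH dotHZl// dotHC dotHZl// mulrA -expr2 sqrtrM ?sqr_ge0//.
by rewrite sqrtr_sqr.
Qed.

Lemma normHN l z : calH l z -> normH l (- z) = normH l z.
Proof. by move=> Hz; rewrite -scaleN1r normHZ// normrN normr1 mul1r. Qed.

Lemma normH_sym l z w : calH l z -> calH l w -> normH l (z - w) = normH l (w - z).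
Proof. by move=> Hz Hw; rewrite -normHN ?opprB//; exact: calHB. Qed.

Lemma normH_tri l z w y : calH l z -> calH l w -> calH l y ->
  normH l (z - y) <= normH l (z - w) + normH l (w - y).
Proof. by move=> Hz Hw Hy; rewrite -(subrKA w) normHD//; exact: calHB. Qed.

Lemma normH_strain l z : calH l z -> nm (strain l z) <= normH l z.
Proof. by move=> Hz; rewrite /nm /normH ler_wsqrtr// dotHE// lerDl ip_ge0. Qed.

Lemma normH_speed l z : calH l z -> nm (speed l z) <= normH l z.
Proof. by move=> Hz; rewrite /nm /normH ler_wsqrtr// dotHE// lerDr ip_ge0. Qed.

Lemma normH_le l z : calH l z -> normH l z <= nm (strain l z) + nm (speed l z).
Proof.
move=> Hz; rewrite -(@ler_pXn2r _ 2)// ?nnegrE ?addr_ge0 ?normH_ge0 ?nm_ge0//.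
rewrite normH_sqr dotHE// -!nm_sqr sqrrD.
have := mulr_ge0 (nm_ge0 (strain l z)) (nm_ge0 (speed l z)); lra.
Qed.

Lemma calH_val l z x : calH l z -> 0 <= x <= l -> z.1 x = prim (strain l z) x.
Proof.
by move=> [[Hz z0] Lz] xl; rewrite (weak_deriv_prim (wderivP Hz) xl) z0 add0r.
Qed.

Lemma calH_diff l z x (y : R) : calH l z -> 0 <= x <= l -> 0 <= y <= l ->
  `|z.1 x - z.1 y| <= normH l z * Num.sqrt `|x - y|.
Proof.
move=> Hz xl yl; have [[Hz1 z0] Lz] := Hz.
apply: le_trans (weak_deriv_diff (wderivP Hz1) xl yl) _.
by rewrite ler_wpM2r ?sqrtr_ge0//; exact: normH_strain.
Qed.

Lemma calH_val_le l z x : 0 < l -> calH l z -> 0 <= x <= l ->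
  `|z.1 x| <= normH l z * Num.sqrt l.
Proof.
move=> l0 Hz xl; have ol : 0 <= (0 : R) <= l by rewrite lexx ltW.
have [[_ z0] _] := Hz; have := calH_diff Hz xl ol; rewrite z0 !subr0 => H.
apply: le_trans H _; rewrite ler_wpM2l ?normH_ge0// ler_wsqrtr//.
by have /andP[x0 ?] := xl; rewrite ger0_norm.
Qed.

Lemma eqH_refl l z : eqH l z z.
Proof. by split=> //; exact: ae_eq_refl. Qed.

Lemma eqH_sym l z w : eqH l z w -> eqH l w z.
Proof. by move=> [h1 h2]; split=> [x xl|]; [rewrite h1|exact: ae_eq_sym]. Qed.

Lemma eqH_trans l z w y : eqH l z w -> eqH l w y -> eqH l z y.
Proof.
move=> [h1 h2] [g1 g2]; split=> [x xl|]; first by rewrite h1// g1.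
exact: ae_eq_trans h2 g2.
Qed.

Lemma ae_eq_oo f g l : ae_eq mu `]0, l[%classic f g <-> {ae mu, forall x, 0 < x < l -> f x = g x}.
Proof.
split; apply: (@filterS _ _ (ae_filter_ringOfSetsType mu)) => x /= H xl; apply: H; 
  by move: xl; rewrite /= in_itv.
Qed.

Lemma eqH_strain l z w : 0 <= l -> eqH l z w -> strain l z = strain l w.
Proof. by move=> l0 [H _]; rewrite /strain (wderiv_ext l0 H). Qed.

Lemma eqH_speed l z w : eqH l z w -> {ae mu, forall x, speed l z x = speed l w x}.
Proof. by move=> [_ /ae_eq_oo H]; exact: ae_patch. Qed.

Lemma eqH_dotH l z z' y : 0 <= l -> calH l z -> calH l z' -> calH l y -> eqH l z z' ->
  dotH l z y = dotH l z' y.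
Proof.
move=> l0 Hz Hz' Hy e; rewrite !dotHE// (eqH_strain l0 e); congr (_ + _).
by apply: ae_ip (eqH_speed e); apply: sqint_meas; exact: (speed_csq _).1.
Qed.

Lemma eqH_normHB l z w : 0 <= l -> calH l z -> calH l w -> eqH l z w -> normH l (z - w) = 0.
Proof.
move=> l0 Hz Hw e; rewrite /normH; have Hzw := calHB Hz Hw.
by rewrite dotHBl// (eqH_dotH l0 Hz Hw Hzw e) subrr sqrtr0.
Qed.

(** The norm sees u only through u_x; u(0) = 0 turns this into equality at every point of [0,l]. *)
Lemma normHB_eqH l z w : 0 < l -> calH l z -> calH l w -> normH l (z - w) = 0 -> eqH l z w.
Proof.
move=> l0 Hz Hw n0; have Hzw := calHB Hz Hw; split.
  move=> x xl; have := calH_val_le l0 Hzw xl; rewrite n0 mul0r normr_le0 => /eqP.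
  by rewrite -[X in X = _ -> _]/(z.1 x - w.1 x) => /eqP; rewrite subr_eq0 => /eqP.
have n0' : nm (speed l (z - w)) = 0.
  by apply/eqP; rewrite eq_le nm_ge0 andbT -n0 normH_speed.
apply/ae_eq_oo; have := nm0_ae (speed_csq Hzw).1 n0'.
apply: (@filterS _ _ (ae_filter_ringOfSetsType mu)) => x; rewrite /speed patchE mem_setE in_itv/=.
move=> + xl; rewrite xl => /eqP; rewrite -[X in X == _]/(z.2 x - w.2 x).
by rewrite subr_eq0 => /eqP.
Qed.

Lemma eqH_normH_l l z z' w : 0 <= l -> calH l z -> calH l z' -> calH l w -> eqH l z z' ->
  normH l (z - w) = normH l (z' - w).
Proof.
move=> l0 Hz Hz' Hw e; have := eqH_normHB l0 Hz Hz' e.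
have := normH_tri Hz Hz' Hw; have := normH_tri Hz' Hz Hw.
rewrite (normH_sym Hz' Hz) => h1 h2 h3; apply/eqP; rewrite eq_le; apply/andP; split; lra.
Qed.

Lemma eqH_normH l z z' : 0 <= l -> calH l z -> calH l z' -> eqH l z z' -> normH l z = normH l z'.
Proof.
move=> l0 Hz Hz' e; have := eqH_normH_l l0 Hz Hz' (calH0 l) e.
by rewrite !subr0.
Qed.

(** Inverse to taking strain and speed: waves are built from u_x and u_t, and u(0) = 0 is then
    automatic. *)
Definition mk (k v : R -> R) : state R := (fun x => \int[mu]_(y in `[0, x]) k y, v).

Lemma sqint_int k a x : sqint k -> mu.-integrable `[a, x] (EFin \o k).
Proof.
move=> Qk; apply/integrable_mkcond => //; rewrite restrict_EFin; exact: sqint_itg_patch.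
Qed.

Lemma mk_lin c k v k' v' : sqint k -> sqint k' -> mk (c *: k + k') (c *: v + v') = c *: mk k v + mk k' v'.
Proof.
move=> Qk Qk'; rewrite [RHS]surjective_pairing; congr (_, _) => /=; apply/funext => x.
rewrite -[RHS]/(c * \int[mu]_(y in `[0, x]) k y + \int[mu]_(y in `[0, x]) k' y).
rewrite -RintegralZl//; last exact: sqint_int.
by rewrite -RintegralD//; [apply: (sqint_int 0 x (sqintZ c Qk))|exact: sqint_int].
Qed.

Lemma mkB k v k' v' : sqint k -> sqint k' -> mk (k - k') (v - v') = mk k v - mk k' v'.
Proof.
move=> Qk Qk'; rewrite addrC -(scaleN1r k') (addrC v) -(scaleN1r v') mk_lin//.
by rewrite addrC scaleN1r.
Qed.

Lemma mk0 k v : (mk k v).1 0 = 0.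
Proof. by rewrite /= set_itv1 Rintegral_set1. Qed.

Lemma weak_deriv_mk l k v : L2 0 l k -> weak_deriv 0 l (mk k v).1 k.
Proof. by move=> Lk; split=> // x _; rewrite mk0 add0r. Qed.

Lemma calH_mk l k v : L2 0 l k -> L2 0 l v -> calH l (mk k v).
Proof. by move=> Lk Lv; split=> //; split; [exists k; exact: weak_deriv_mk|exact: mk0]. Qed.

Lemma strain_mk l k v : L2 0 l k -> {ae mu, forall x, strain l (mk k v) x = (k \_ `]0, l[) x}.
Proof. by move=> Lk; apply: wderiv_ae; exact: weak_deriv_mk. Qed.

Lemma dotH_strain l z w k : calH l z -> calH l w -> weak_deriv 0 l w.1 k ->
  dotH l z w = ip (strain l z) (k \_ `]0, l[) + ip (speed l z) (speed l w).
Proof.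
move=> Hz Hw Hk; rewrite dotHE//; congr (_ + _).
rewrite !(ipC (strain l z)); apply: ae_ip; last exact: wderiv_ae.
- exact: strain_meas.
- exact: sqint_meas Hk.1.
- exact: strain_meas.
Qed.

Lemma normH_mk_le l k v : L2 0 l k -> L2 0 l v ->
  normH l (mk k v) <= nm (k \_ `]0, l[) + nm (v \_ `]0, l[).
Proof.
move=> Lk Lv; have Hm := calH_mk Lk Lv; apply: (le_trans (normH_le Hm)).
rewrite lerD2r; rewrite (ae_nm _ _ (strain_mk v Lk))//; first exact: strain_meas.
exact: sqint_meas Lk.
Qed.

Lemma normH_mk_le_sq l k v : sqint k -> sqint v -> normH l (mk k v) <= nm k + nm v.
Proof.
move=> Qk Qv; apply: (le_trans (normH_mk_le _ _)); [exact: sqint_L2|exact: sqint_L2|].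
by apply: lerD; exact: nm_patch.
Qed.

Lemma eqH_mk l z : calH l z -> eqH l z (mk (strain l z) (speed l z)).
Proof.
move=> Hz; split.
  move=> x xl /=; rewrite (calH_val Hz xl).
  have Ls : L2 0 l (strain l z) by apply: sqint_L2; exact: (strain_csq Hz).1.
  rewrite (int_prim Ls xl); congr prim; apply/funext => y.
  by rewrite /strain !patchE; itv_tac.
by apply/ae_eq_oo; apply: aeW => x xl /=; rewrite /speed patchE mem_setE in_itv/= xl.
Qed.

End EnergySpaceTheory.

(** * D'Alembert waves with a point source *)

Section NearLemmas.
Context {R : realType}.

Lemma near_nbhsP (t : R) (P : set R) :
  (exists2 dl : R, 0 < dl & forall s, `|s - t| < dl -> P s) -> \forall s \near t, P s.
Proof.
move=> [dl dl0 H]; near=> s; apply: H; rewrite distrC.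
by near: s; apply: cvgr_dist_lt => //; exact: cvg_id.
Unshelve. all: by end_near. Qed.

Lemma at_right_nearP (P : set R) : (0 : R)^'+ P ->
  exists2 dl : R, 0 < dl & forall s, 0 < s -> s < dl -> P s.
Proof.
move=> [dl /= dl0 H]; exists dl => // s s0 sd; apply: H => //=.
by rewrite sub0r normrN gtr0_norm.
Qed.

Lemma within_nearP (D : set R) (t : R) (P : set R) : within D (nbhs t) P ->
  exists2 dl : R, 0 < dl & forall s, D s -> `|s - t| < dl -> P s.
Proof.
move=> [dl /= dl0 H]; exists dl => // s Ds sd; apply: H => //=.
by rewrite distrC.
Qed.

End NearLemmas.

Section ExplicitWave.
Context {R : realType}.
Notation mu := (@lebesgue_measure R).
Notation mR := (measurableTypeR R).
Implicit Types (f g h p : R -> R) (a b c d x t s l : R).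

Definition transl f d : R -> R := fun x => f (x + d).
Definition refl f d : R -> R := fun x => f (d - x).

Lemma csq_transl f d : csq f -> csq (transl f d). Proof. exact: csq_shift. Qed.
Lemma csq_refl f d : csq f -> csq (refl f d). Proof. exact: csq_reflect. Qed.
Lemma nm_transl f d : sqint f -> nm (transl f d) = nm f. Proof. exact: nm_shift. Qed.
Lemma nm_refl f d : sqint f -> nm (refl f d) = nm f. Proof. exact: nm_reflect. Qed.

(** The L^2 modulus of continuity, in terms of which time increments of waves are estimated. *)
Definition modulus f d : R := nm (transl f d - f).

Lemma translB f h d : transl (f - h) d = transl f d - transl h d. Proof. by []. Qed.
Lemma transl_transl f a b : transl (transl f a) b = transl f (b + a).
Proof. by apply/funext => x; rewrite /transl addrA. Qed.
Lemma nm_transl_diff f s t : csq f -> nm (transl f s - transl f t) = modulus f (s - t).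
Proof.
move=> Kf; rewrite /modulus -[RHS](@nm_transl _ t); last first.
  by have [] := csqB (csq_transl (s - t) Kf) Kf.
by rewrite translB transl_transl (_ : t + (s - t) = s); [|ring].
Qed.

Lemma nm_refl_diff f s t : csq f -> nm (refl f s - refl f t) = modulus f (s - t).
Proof.
move=> Kf; rewrite /modulus -[RHS](@nm_refl _ t); last first.
  by have [] := csqB (csq_transl (s - t) Kf) Kf.
congr nm; apply/funext => x; rewrite /refl /transl !fctE; congr (f _ - _); ring.
Qed.

Lemma combination_diff (k : R) (f1 f2 f3 f4 f5 h1 h2 h3 h4 h5 : R -> R) :
  (f1 + f2 + k *: (f3 + f4 - f5)) - (h1 + h2 + k *: (h3 + h4 - h5)) =
  (f1 - h1) + (f2 - h2) + k *: ((f3 - h3) + (f4 - h4) - (f5 - h5)).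
Proof.
apply/funext => x.
rewrite -[LHS]/((f1 x + f2 x + k * (f3 x + f4 x - f5 x)) - (h1 x + h2 x + k * (h3 x + h4 x - h5 x))).
rewrite -[RHS]/((f1 x - h1 x) + (f2 x - h2 x) + k * ((f3 x - h3 x) + (f4 x - h4 x) - (f5 x - h5 x))).
ring.
Qed.

Lemma combination_diff' (k : R) (f1 f2 f3 f4 f5 h1 h2 h3 h4 h5 : R -> R) :
  (f1 - f2 + k *: (f3 - f4 + f5)) - (h1 - h2 + k *: (h3 - h4 + h5)) =
  (f1 - h1) - (f2 - h2) + k *: ((f3 - h3) - (f4 - h4) + (f5 - h5)).
Proof.
apply/funext => x.
rewrite -[LHS]/((f1 x - f2 x + k * (f3 x - f4 x + f5 x)) - (h1 x - h2 x + k * (h3 x - h4 x + h5 x))).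
rewrite -[RHS]/((f1 x - h1 x) - (f2 x - h2 x) + k * ((f3 x - h3 x) - (f4 x - h4 x) + (f5 x - h5 x))).
ring.
Qed.

Section Wave.
Variables (l x0 : R) (p g : R -> R).

(* x_0 splits the string: the source sends a left-going wave into x < x_0 and a
   right-going one into x > x_0; the former is reflected at x = 0 *)
Definition forced_strain t : R -> R := transl p t + refl p t +
  2^-1 *: (transl g (t - x0) \_ `]-oo, x0[ + refl g (t - x0) - refl g (t + x0) \_ `[x0, +oo[).
Definition forced_speed t : R -> R := transl p t - refl p t +
  2^-1 *: (transl g (t - x0) \_ `]-oo, x0[ - refl g (t - x0) + refl g (t + x0) \_ `[x0, +oo[).
Definition forced_wave t : state R := mk (forced_strain t \_ `]0, l[) (forced_speed t \_ `]0, l[).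
(** This is u_t(x0,.): besides p it contains half of the source, emitted at x0, and the same half
    with opposite sign, returning from the end 0 after the time 2 x0. *)
Definition forced_trace : R -> R :=
  transl p x0 - transl p (- x0) + 2^-1 *: (g - transl g (- (x0 + x0))).

Lemma nm_combination f1 f2 f3 f4 f5 (m n : R) : sqint f1 -> sqint f2 -> sqint f3 -> sqint f4 -> sqint f5 ->
  nm f1 <= m -> nm f2 <= m -> nm f3 <= n -> nm f4 <= n -> nm f5 <= n ->
  nm (f1 + f2 + 2^-1 *: (f3 + f4 - f5)) <= 2 * m + 2 * n /\
  nm (f1 - f2 + 2^-1 *: (f3 - f4 + f5)) <= 2 * m + 2 * n.
Proof.
move=> Q1 Q2 Q3 Q4 Q5 n1 n2 n3 n4 n5.
have n0 : 0 <= n := le_trans (nm_ge0 f3) n3.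
have Q12 := sqintD Q1 Q2; have Q12' := sqintB Q1 Q2.
have Q34 := sqintD Q3 Q4; have Q34' := sqintB Q3 Q4.
have Q345 := sqintB Q34 Q5; have Q345' := sqintD Q34' Q5.
have h : `|2^-1 : R| = 2^-1 by rewrite ger0_norm.
split.
- apply: (le_trans (nmD Q12 (sqintZ _ Q345))); rewrite nmZ// h.
  have := nmD Q1 Q2; have := nmB Q34 Q5; have := nmD Q3 Q4; lra.
- apply: (le_trans (nmD Q12' (sqintZ _ Q345'))); rewrite nmZ// h.
  have := nmB Q1 Q2; have := nmD Q34' Q5; have := nmB Q3 Q4; lra.
Qed.

Lemma nm_kap_vel t : sqint p -> sqint g ->
  nm (forced_strain t) <= 2 * nm p + 2 * nm g /\ nm (forced_speed t) <= 2 * nm p + 2 * nm g.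
Proof.
move=> Qp Qg; have Q1 : sqint (transl p t) by exact: sqint_shift.
have Q2 : sqint (refl p t) by exact: sqint_reflect.
have Q3 : sqint (transl g (t - x0)) by exact: sqint_shift.
have Q4 : sqint (refl g (t - x0)) by exact: sqint_reflect.
have Q5 : sqint (refl g (t + x0)) by exact: sqint_reflect.
apply: nm_combination => //; try exact: sqint_patch.
- by rewrite nm_transl.
- by rewrite nm_refl.
- by apply: (le_trans (nm_patch _ Q3)) => //; rewrite nm_transl.
- by rewrite nm_refl.
- by apply: (le_trans (nm_patch _ Q5)) => //; rewrite nm_refl.
Qed.

Hypotheses (Kp : csq p) (Kg : csq g).

Lemma kap_csq t : csq (forced_strain t).
Proof.
apply: csqD; first by apply: csqD; [exact: csq_transl|exact: csq_refl].
apply: csqZ; apply: csqB; first apply: csqD.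
- by apply: csq_patch => //; exact: csq_transl.
- exact: csq_refl.
- by apply: csq_patch => //; exact: csq_refl.
Qed.

Lemma vel_csq t : csq (forced_speed t).
Proof.
apply: csqD; first by apply: csqB; [exact: csq_transl|exact: csq_refl].
apply: csqZ; apply: csqD; first apply: csqB.
- by apply: csq_patch => //; exact: csq_transl.
- exact: csq_refl.
- by apply: csq_patch => //; exact: csq_refl.
Qed.

Lemma wave_calH t : calH l (forced_wave t).
Proof. by apply: calH_mk; apply/sqint_L2/sqint_patch => //; [exact: (kap_csq t).1|exact: (vel_csq t).1]. Qed.

Lemma nm_kap_vel_diff s t :
  nm (forced_strain s - forced_strain t) <= 2 * modulus p (s - t) + 2 * modulus g (s - t) /\
  nm (forced_speed s - forced_speed t) <= 2 * modulus p (s - t) + 2 * modulus g (s - t).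
Proof.
have e1 f f' D : f \_ D - f' \_ D = (f - f') \_ D by rewrite patchB.
have d12 r r' : csq (transl p r - transl p r') by apply: csqB; exact: csq_transl.
have d12' r r' : csq (refl p r - refl p r') by apply: csqB; exact: csq_refl.
have d3 r r' : csq (transl g r - transl g r') by apply: csqB; exact: csq_transl.
have d4 r r' : csq (refl g r - refl g r') by apply: csqB; exact: csq_refl.
have -> : forced_strain s - forced_strain t = (transl p s - transl p t) + (refl p s - refl p t) +
  2^-1 *: ((transl g (s - x0) - transl g (t - x0)) \_ `]-oo, x0[ +
     (refl g (s - x0) - refl g (t - x0)) - (refl g (s + x0) - refl g (t + x0)) \_ `[x0, +oo[).
  by rewrite -!e1 -combination_diff.
have -> : forced_speed s - forced_speed t = (transl p s - transl p t) - (refl p s - refl p t) +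
  2^-1 *: ((transl g (s - x0) - transl g (t - x0)) \_ `]-oo, x0[ -
     (refl g (s - x0) - refl g (t - x0)) + (refl g (s + x0) - refl g (t + x0)) \_ `[x0, +oo[).
  by rewrite -!e1 -combination_diff'.
have sx : s - x0 - (t - x0) = s - t by ring.
have sx' : s + x0 - (t + x0) = s - t by ring.
apply: nm_combination; try exact: (d12 _ _).1; try exact: (d12' _ _).1; try exact: (d4 _ _).1.
- by apply: sqint_patch => //; exact: (d3 _ _).1.
- by apply: sqint_patch => //; exact: (d4 _ _).1.
- by rewrite nm_transl_diff.
- by rewrite nm_refl_diff.
- by apply: (le_trans (nm_patch _ (d3 _ _).1)) => //; rewrite nm_transl_diff// sx.
- by rewrite nm_refl_diff// sx.
- by apply: (le_trans (nm_patch _ (d4 _ _).1)) => //; rewrite nm_refl_diff// sx'.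
Qed.

Lemma waveB s t : forced_wave s - forced_wave t = mk ((forced_strain s - forced_strain t) \_ `]0, l[) ((forced_speed s - forced_speed t) \_ `]0, l[).
Proof.
by rewrite !patchB mkB//; apply: sqint_patch => //; exact: (kap_csq _).1.
Qed.

Lemma normH_wave t : normH l (forced_wave t) <= 4 * nm p + 4 * nm g.
Proof.
have Qk := (kap_csq t).1; have Qv := (vel_csq t).1.
apply: (le_trans (normH_mk_le_sq _ _ _)); try exact: sqint_patch.
have := nm_patch (measurable_itv `]0, l[) Qk; have := nm_patch (measurable_itv `]0, l[) Qv.
by have [] := nm_kap_vel t Kp.1 Kg.1; lra.
Qed.

Lemma normH_wave_diff s t :
  normH l (forced_wave s - forced_wave t) <= 4 * modulus p (s - t) + 4 * modulus g (s - t).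
Proof.
have Qk := (csqB (kap_csq s) (kap_csq t)).1; have Qv := (csqB (vel_csq s) (vel_csq t)).1.
rewrite waveB; apply: (le_trans (normH_mk_le_sq _ _ _)); try exact: sqint_patch.
have := nm_patch (measurable_itv `]0, l[) Qk; have := nm_patch (measurable_itv `]0, l[) Qv.
by have [] := nm_kap_vel_diff s t; lra.
Qed.

Lemma wave_uniform e : 0 < e -> exists2 dl : R, 0 < dl &
  forall s t, `|s - t| < dl -> normH l (forced_wave s - forced_wave t) <= e.
Proof.
move=> e0; have e80 : 0 < e / 8 by rewrite divr_gt0.
have [d1 d10 H1] := translation_continuity e80 Kp.
have [d2 d20 H2] := translation_continuity e80 Kg.
exists (Num.min d1 d2); first by rewrite lt_min d10.
move=> s t; rewrite lt_min => /andP[st1 st2].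
apply: (le_trans (normH_wave_diff s t)).
have := H1 _ st1; have := H2 _ st2; rewrite -/(modulus p _) -/(modulus g _).
lra.
Qed.

Lemma wave_cont t : normH l (forced_wave s - forced_wave t) @[s --> t] --> 0.
Proof.
apply/cvgr0Pnorm_le => e e0; have [dl dl0 H] := wave_uniform e0.
apply: near_nbhsP; exists dl => // s /H; rewrite ger0_norm ?normH_ge0//.
Qed.

Lemma wave_contH a b : contH l a b forced_wave.
Proof.
move=> t tab; split; first exact: wave_calH.
by apply: cvg_within_filter; exact: wave_cont.
Qed.

End Wave.
End ExplicitWave.

(** * Displacement, trace and velocity of the explicit wave *)

Section ExplicitWaveSolution.
Context {R : realType}.
Notation mu := (@lebesgue_measure R).
Notation mR := (measurableTypeR R).
Implicit Types (f g h p : R -> R) (a b c d x t s l : R).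

Lemma prim_patch_lt h b y : itg h -> prim (h \_ `]-oo, b[) y = prim h (Num.min y b).
Proof.
move=> Ih; rewrite /Num.min; case: ltP => yb.
  rewrite !primE; apply: eq_Rintegral => x _; rewrite !patchE; itv_tac.
have -> : prim h b = \int[mu]_(x in `]-oo, b[) h x.
  by rewrite /prim Rintegral_itv_bndo_bndc//; exact: integrableS Ih.
rewrite /prim [LHS]Rintegral_mkcond [RHS]Rintegral_mkcond.
by apply: eq_Rintegral => x _; rewrite !patchE; itv_tac.
Qed.

Lemma patch_ge h b : h \_ `[b, +oo[ = h - h \_ `]-oo, b[.
Proof.
apply/funext => x; rewrite !fctE !patchE !mem_setE !in_itv/= andbT.
by case: ltP => xb; rewrite ?subrr ?subr0.
Qed.

Lemma prim_patch_ge h b y : itg h ->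
  prim (h \_ `[b, +oo[) y = prim h y - prim h (Num.min y b).
Proof. by move=> Ih; rewrite patch_ge primB ?prim_patch_lt//; exact: itg_patch. Qed.

Lemma prim0_le g y : (forall s, s <= 0 -> g s = 0) -> y <= 0 -> prim g y = 0.
Proof.
move=> g0 y0; rewrite primE (_ : _ \_ _ = cst 0) ?Rintegral_cst ?mul0r//.
apply/funext => x; rewrite patchE mem_setE in_itv/=; case: ifP => // xy.
by rewrite g0//; exact: le_trans xy y0.
Qed.

Lemma weak_deriv_L2 a b f g : weak_deriv a b f g -> L2 a b f.
Proof.
move=> H; have K := L2_csq H.1; pose k := `|f a| + nm (g \_ `]a, b[) * Num.sqrt `|b - a|.
rewrite /L2 (_ : f \_ `]a, b[ = (fun x => f a + prim (g \_ `]a, b[) x) \_ `]a, b[); last first.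
  apply/funext => x; rewrite !patchE mem_setE in_itv/=; case: ifP => // /andP[ax xb].
  by apply: (weak_deriv_prim H); rewrite !ltW.
apply: (@le_sqint _ _ (k *: \1_`[a, b])).
- apply/(measurable_restrictT _ _).1 => //; apply: (@measurable_funS _ _ _ _ setT) => //.
  apply: measurable_funD; first exact: measurable_cst.
  by apply: continuous_measurable_fun; exact: prim_continuous.
- by apply: sqintZ; exact: sqint_indic.
- move=> x; rewrite patchE mem_setE in_itv/=; case: ifPn => [/andP[ax xb]|_]; last by rewrite normr0.
  have xab : a <= x <= b by rewrite !ltW.
  have aab : a <= a <= b by rewrite lexx/= ltW// (lt_trans ax).
  rewrite -(weak_deriv_prim H xab) !fctE indicE mem_setE in_itv/= xab.
  rewrite -[_ *: _]/(k * 1) mulr1 [leRHS]ger0_norm; last first.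
    by rewrite addr_ge0// mulr_ge0 ?nm_ge0 ?sqrtr_ge0.
  rewrite -(subrK (f a) (f x)) addrC; apply: (le_trans (ler_normD _ _)).
  rewrite lerD2l; apply: le_trans (weak_deriv_diff H xab aab) _.
  have ab := lt_trans ax xb.
  by rewrite ler_wpM2l ?nm_ge0// ler_wsqrtr// !gtr0_norm ?subr_gt0// lerD2r ltW.
Qed.

Section Wave.
Variables (l x0 : R) (p g : R -> R).
Hypotheses (l0 : 0 < l) (x00 : 0 < x0) (x0l : x0 <= l).
Hypotheses (Kp : csq p) (Kg : csq g).
Notation P := (prim p).
Notation G := (prim g).
Local Notation kap := (forced_strain x0 p g).
Local Notation vel := (forced_speed x0 p g).
Local Notation wave := (forced_wave l x0 p g).

Lemma int_transl f d x : csq f -> 0 <= x ->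
  \int[mu]_(y in `[0, x]) transl f d y = prim f (x + d) - prim f d.
Proof. by move=> Kf x_ge0; rewrite /transl int_shift ?add0r//; exact: csq_itg. Qed.

Lemma int_refl f d x : csq f -> 0 <= x ->
  \int[mu]_(y in `[0, x]) refl f d y = prim f d - prim f (d - x).
Proof. by move=> Kf x_ge0; rewrite /refl int_reflect ?subr0//; exact: csq_itg. Qed.

Lemma int_transl_lt f d x : csq f -> 0 <= x ->
  \int[mu]_(y in `[0, x]) (transl f d \_ `]-oo, x0[) y = prim f (Num.min x x0 + d) - prim f d.
Proof.
move=> Kf x_ge0; have Kt := csq_itg (csq_transl d Kf).
rewrite int_itv//; last exact: itg_patch.
rewrite !prim_patch_lt// (min_l (ltW x00)) -int_itv//; last by rewrite le_min x_ge0 ltW.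
by rewrite int_transl// le_min x_ge0 ltW.
Qed.

Lemma int_refl_ge f d x : csq f -> 0 <= x ->
  \int[mu]_(y in `[0, x]) (refl f d \_ `[x0, +oo[) y = prim f (d - Num.min x x0) - prim f (d - x).
Proof.
move=> Kf x_ge0; have Kt := csq_itg (csq_refl d Kf).
rewrite int_itv//; last exact: itg_patch.
rewrite !prim_patch_ge// (min_l (ltW x00)) subrr subr0 -int_itv//; last by rewrite ge_min lexx.
by rewrite /refl int_reflect//; [rewrite ge_min lexx|exact: csq_itg].
Qed.

Lemma int_combination f1 f2 f3 f4 f5 x : csq f1 -> csq f2 -> csq f3 -> csq f4 -> csq f5 ->
  let I := fun f => \int[mu]_(y in `[0, x]) f y in
  I (f1 + f2 + 2^-1 *: (f3 + f4 - f5)) = I f1 + I f2 + 2^-1 * (I f3 + I f4 - I f5) /\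
  I (f1 - f2 + 2^-1 *: (f3 - f4 + f5)) = I f1 - I f2 + 2^-1 * (I f3 - I f4 + I f5).
Proof.
move=> K1 K2 K3 K4 K5 I.
have ID f h : csq f -> csq h -> I (f + h) = I f + I h.
  by move=> [Qf _] [Qh _]; rewrite /I -RintegralD//; exact: sqint_int.
have IZ k f : csq f -> I (k *: f) = k * I f.
  by move=> [Qf _]; rewrite /I -RintegralZl//; exact: sqint_int.
have IB f h : csq f -> csq h -> I (f - h) = I f - I h.
  by move=> Kf Kh; rewrite -(scaleN1r h) (ID _ _ Kf (csqZ _ Kh)) IZ// mulN1r.
have K12 := csqD K1 K2; have K12' := csqB K1 K2.
have K34 := csqD K3 K4; have K34' := csqB K3 K4.
have K345 := csqB K34 K5; have K345' := csqD K34' K5.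
have KZ := csqZ 2^-1 K345; have KZ' := csqZ 2^-1 K345'.
split.
- by rewrite (ID _ _ K12 KZ) (ID _ _ K1 K2) (IZ _ _ K345) (IB _ _ K34 K5) (ID _ _ K3 K4).
- by rewrite (ID _ _ K12' KZ') (IB _ _ K1 K2) (IZ _ _ K345') (ID _ _ K34' K5) (IB _ _ K3 K4).
Qed.

Lemma int_kap_vel t x : 0 <= x ->
  \int[mu]_(y in `[0, x]) kap t y = P (x + t) - P t + (P t - P (t - x)) +
    2^-1 * (G (Num.min x x0 + (t - x0)) - G (t - x0) + (G (t - x0) - G (t - x0 - x)) -
      (G (t + x0 - Num.min x x0) - G (t + x0 - x))) /\
  \int[mu]_(y in `[0, x]) vel t y = P (x + t) - P t - (P t - P (t - x)) +
    2^-1 * (G (Num.min x x0 + (t - x0)) - G (t - x0) - (G (t - x0) - G (t - x0 - x)) +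
      (G (t + x0 - Num.min x x0) - G (t + x0 - x))).
Proof.
move=> x_ge0.
have K3 : csq (transl g (t - x0) \_ `]-oo, x0[) by apply: csq_patch => //; exact: csq_transl.
have K5 : csq (refl g (t + x0) \_ `[x0, +oo[) by apply: csq_patch => //; exact: csq_refl.
have := int_combination x (csq_transl t Kp) (csq_refl t Kp) K3 (csq_refl (t - x0) Kg) K5.
by rewrite /= (int_transl t Kp x_ge0) (int_refl t Kp x_ge0) (int_transl_lt (t - x0) Kg x_ge0)
  (int_refl (t - x0) Kg x_ge0) (int_refl_ge (t + x0) Kg x_ge0).
Qed.

(** The strain integrated from 0, with P and G primitives of p and g. The two branches agree at x0:
    u is continuous there although u_x jumps by - g t. *)
Definition displacement (P G : R -> R) t x : R := P (x + t) - P (t - x) +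
  2^-1 * ((if x < x0 then G (x + (t - x0)) else G (t + x0 - x)) - G (t - x0 - x)).

Lemma wave_val t x : 0 <= x <= l -> (wave t).1 x = displacement P G t x.
Proof.
move=> xl; have /andP[x_ge0 _] := xl.
have Qk := (kap_csq x0 Kp Kg t).1.
have Qk' : sqint (kap t \_ `]0, l[) by exact: sqint_patch.
have -> : (wave t).1 x = \int[mu]_(y in `[0, x]) kap t y.
  rewrite (int_prim (sqint_L2 0 l Qk) xl) /= (int_prim (sqint_L2 0 l Qk') xl).
  by congr prim; apply/funext => y; rewrite !patchE; itv_tac.
have [-> _] := int_kap_vel t x_ge0; rewrite /displacement /Num.min.
case: ltP => xx0; first by field.
rewrite (_ : x0 + (t - x0) = t); last by ring.
rewrite (_ : t + x0 - x0 = t); last by ring.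
by field.
Qed.

Lemma wave_trace tau : 0 <= tau -> 
  weak_deriv 0 tau (fun t => (wave t).1 x0) (forced_trace x0 p g).
Proof.
move=> tau0; have x0in : 0 <= x0 <= l by rewrite ltW.
have Kt : csq (forced_trace x0 p g).
  apply: csqD; first by apply: csqB; exact: csq_transl.
  by apply: csqZ; apply: csqB => //; exact: csq_transl.
split; first by apply: sqint_L2; exact: Kt.1.
move=> t /andP[t0 _]; rewrite !wave_val// /displacement ltxx.
have [_] := int_combination t (csq_transl x0 Kp) (csq_transl (- x0) Kp) Kg
  (csq_transl (- (x0 + x0)) Kg) csq0.
rewrite addr0 -/(forced_trace x0 p g) /= => ->.
rewrite (int_transl x0 Kp t0) (int_transl (- x0) Kp t0) (int_transl (- (x0 + x0)) Kg t0).
rewrite Rintegral_cst//= mul0r addr0 int_itv//; last exact: csq_itg.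
rewrite !add0r !(addrC x0) !addrK.
rewrite (_ : t - x0 - x0 = t - (x0 + x0)); last by ring.
rewrite (_ : - x0 - x0 = - (x0 + x0)); last by ring.
rewrite addNr; ring.
Qed.

Lemma velE (q h : R -> R) t x : forced_speed x0 q h t x = q (x + t) - q (t - x) +
  2^-1 * ((if x < x0 then h (x + (t - x0)) else 0) - h (t - x0 - x) + (if x < x0 then 0 else h (t + x0 - x))).
Proof.
rewrite -[LHS]/(transl q t x - refl q t x + 2^-1 * ((transl h (t - x0) \_ `]-oo, x0[) x - refl h (t - x0) x
  + (refl h (t + x0) \_ `[x0, +oo[) x)).
rewrite !patchE !mem_setE !in_itv/= andbT; by case: ltP.
Qed.

Lemma kapE (q h : R -> R) t x : forced_strain x0 q h t x = q (x + t) + q (t - x) +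
  2^-1 * ((if x < x0 then h (x + (t - x0)) else 0) + h (t - x0 - x) - (if x < x0 then 0 else h (t + x0 - x))).
Proof.
rewrite -[LHS]/(transl q t x + refl q t x + 2^-1 * ((transl h (t - x0) \_ `]-oo, x0[) x + refl h (t - x0) x
  - (refl h (t + x0) \_ `[x0, +oo[) x)).
rewrite !patchE !mem_setE !in_itv/= andbT; by case: ltP.
Qed.

Lemma normL2E f : L2 0 l f -> normL2 0 l f = nm (f \_ `]0, l[).
Proof. by move=> Lf; rewrite /normL2 dotL2E. Qed.

Lemma vel_sqint (q h : R -> R) t : sqint q -> sqint h -> sqint (forced_speed x0 q h t).
Proof.
move=> Qq Qh; apply: sqintD; first by apply: sqintB; [exact: sqint_shift|exact: sqint_reflect].
apply: sqintZ; apply: sqintD; first apply: sqintB.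
- by apply: sqint_patch => //; exact: sqint_shift.
- exact: sqint_reflect.
- by apply: sqint_patch => //; exact: sqint_reflect.
Qed.

(* The error of the difference quotient is vel applied to the errors of the
   difference quotients of the primitives of p and g. *)
Lemma wave_velocity t : (fun s => normL2 0 l ((s - t)^-1 *: ((wave s).1 - (wave t).1) - (wave t).2))
  @ t^' --> (0 : R).
Proof.
apply/cvgr0Pnorm_le => e e0; have e40 : 0 < e / 4 by rewrite divr_gt0.
have [d1 d10 H1] := diff_quotient e40 Kp.
have [d2 d20 H2] := diff_quotient e40 Kg.
suff : \forall s \near t, s != t -> `|normL2 0 l ((s - t)^-1 *: ((wave s).1 - (wave t).1) - (wave t).2)| <= e.
  by [].
apply: near_nbhsP; exists (Num.min d1 d2); first by rewrite lt_min d10.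
move=> s; rewrite lt_min => /andP[sd1 sd2] st.
have dn0 : s - t != 0 by rewrite subr_eq0.
pose Ep := (fun x => (s - t)^-1 * (P (x + (s - t)) - P x)) - p.
pose Eg := (fun x => (s - t)^-1 * (G (x + (s - t)) - G x)) - g.
have [Qp np] : sqint Ep /\ nm Ep <= e / 4 by exact: H1.
have [Qg ng] : sqint Eg /\ nm Eg <= e / 4 by exact: H2.
have [_ Hv] := nm_kap_vel x0 t Qp Qg.
have Qv := vel_sqint t Qp Qg.
have E : ((s - t)^-1 *: ((wave s).1 - (wave t).1) - (wave t).2) \_ `]0, l[ = forced_speed x0 Ep Eg t \_ `]0, l[.
  apply/funext => x; rewrite !patchE mem_setE in_itv/=; case: ifPn => // xl.
  rewrite -[LHS]/((s - t)^-1 * ((wave s).1 x - (wave t).1 x) - (vel t \_ `]0, l[) x).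
  have xl' : 0 <= x <= l by move/andP : xl => [? ?]; rewrite !ltW.
  rewrite !wave_val// patchE mem_setE in_itv/= xl !velE /displacement /Ep /Eg.
  have fE (q h : R -> R) (y : R) : (q - h) y = q y - h y by [].
  rewrite !fE.
  rewrite (_ : x + t + (s - t) = x + s); last by ring.
  rewrite (_ : t - x + (s - t) = s - x); last by ring.
  rewrite (_ : x + (t - x0) + (s - t) = x + (s - x0)); last by ring.
  rewrite (_ : t - x0 - x + (s - t) = s - x0 - x); last by ring.
  rewrite (_ : t + x0 - x + (s - t) = s + x0 - x); last by ring.
  by move: (prim p) (prim g) => PP PG; case: ltP => _; ring.
have LD : L2 0 l ((s - t)^-1 *: ((wave s).1 - (wave t).1) - (wave t).2).
  by rewrite /L2 E; exact: sqint_patch.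
rewrite normL2E// E ger0_norm ?nm_ge0//.
apply: (le_trans (nm_patch _ Qv)) => //; apply: (le_trans Hv); lra.
Qed.

End Wave.
End ExplicitWaveSolution.

(** * The weak wave equation for explicit waves *)

Section WeakIdentity.
Context {R : realType}.
Notation mu := (@lebesgue_measure R).
Notation mR := (measurableTypeR R).
Implicit Types (f g h p : R -> R) (a b c d x t s l : R).
Variables (l x0 : R) (p g : R -> R).
Hypotheses (l0 : 0 < l) (x00 : 0 < x0) (x0l : x0 <= l).
Hypotheses (Kp : csq p) (Kg : csq g).
Notation P := (prim p).
Notation G := (prim g).
Local Notation kap := (forced_strain x0 p g).
Local Notation vel := (forced_speed x0 p g).
Local Notation wave := (forced_wave l x0 p g).

Lemma meas_comp2 f (u v : mR * mR -> mR) : measurable_fun setT f ->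
  measurable_fun setT u -> measurable_fun setT v ->
  measurable_fun setT (fun z => f (u z + v z)).
Proof.
move=> mf mu_ mv; apply: (@measurableT_comp _ _ _ _ _ _ (f : mR -> R)) => //.
exact: measurable_funD.
Qed.

Lemma kap_measurable2 : measurable_fun setT (fun z : mR * mR => kap z.1 z.2).
Proof.
have mp := sqint_meas Kp.1; have mg := sqint_meas Kg.1.
have m1 : measurable_fun setT (fst : mR * mR -> mR) by exact: measurable_fst.
have m2 : measurable_fun setT (snd : mR * mR -> mR) by exact: measurable_snd.
have m2N : measurable_fun setT (fun z : mR * mR => - z.2 : mR).
  by apply: (@measurableT_comp _ _ _ _ _ _ (-%R : mR -> mR)) => //; exact: oppr_measurable.
have mc (q : mR) : measurable_fun setT (fun z : mR * mR => z.1 + q : mR).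
  by apply: measurable_funD => //; exact: measurable_cst.
have mlt : measurable_fun setT (fun z : mR * mR => z.2 < x0).
  by apply: measurable_fun_ltr => //; exact: measurable_cst.
have -> : (fun z : mR * mR => kap z.1 z.2) = (fun z : mR * mR => p (z.2 + z.1) + p (z.1 - z.2) +
  2^-1 * ((if z.2 < x0 then g (z.2 + (z.1 - x0)) else 0) + g (z.1 - x0 - z.2)
    - (if z.2 < x0 then 0 else g (z.1 + x0 - z.2)))).
  by apply/funext => z; rewrite kapE.
apply: measurable_funD; first by apply: measurable_funD; exact: meas_comp2.
apply: measurable_funM; first exact: measurable_cst.
apply: measurable_funB; first apply: measurable_funD.
- by apply: measurable_fun_ifT => //; exact: meas_comp2.
- exact: (meas_comp2 mg (mc (- x0)) m2N).
- by apply: measurable_fun_ifT => //; exact: (meas_comp2 mg (mc x0) m2N).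
Qed.

Lemma Rint_patch D f : \int[mu]_(x in D) f x = \int[mu]_x (f \_ D) x.
Proof. exact: Rintegral_mkcond. Qed.

(** The strain at x integrated over the times [0,t]. The closed form is what allows its derivative
    in x to be recognised as an increment of the speed. *)
Definition kap_int t x : R := P (x + t) - P x + (P (t - x) - P (- x)) +
  2^-1 * ((if x < x0 then G (x + (t - x0)) - G (x - x0) else 0) + (G (t - x0 - x) - G (- x0 - x))
     - (if x < x0 then 0 else G (t + x0 - x) - G (x0 - x))).

Lemma kap_time_csq x : csq ((fun s => kap s x) : R -> R).
Proof.
have -> : (fun s => kap s x) = transl p x + transl p (- x) +
  2^-1 *: ((if x < x0 then transl g (x - x0) else 0) + transl g (- x0 - x) -
    (if x < x0 then 0 else transl g (x0 - x))).
  apply/funext => s; rewrite kapE.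
  rewrite -[RHS]/(p (s + x) + p (s - x) + 2^-1 * ((if x < x0 then transl g (x - x0) else 0) s + g (s + (- x0 - x)) -
    (if x < x0 then 0 else transl g (x0 - x)) s)).
  rewrite (addrC x s) (_ : x + (s - x0) = s + (x - x0)); last by ring.
  rewrite (_ : s - x0 - x = s + (- x0 - x)); last by ring.
  rewrite (_ : s + x0 - x = s + (x0 - x)); last by ring.
  by case: ifP.
apply: csqD; first by apply: csqD; exact: csq_transl.
apply: csqZ; apply: csqB; first apply: csqD.
- by case: ifP => _; [exact: csq_transl|exact: csq0].
- exact: csq_transl.
- by case: ifP => _; [exact: csq0|exact: csq_transl].
Qed.

Lemma int_kap_time t x : 0 <= t -> \int[mu]_(s in `[0, t]) kap s x = kap_int t x.
Proof.
move=> t0.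
pose f3 := if x < x0 then transl g (x - x0) else 0.
pose f5 := if x < x0 then 0 else transl g (x0 - x).
have K3 : csq f3 by rewrite /f3; case: ifP => _; [exact: csq_transl|exact: csq0].
have K5 : csq f5 by rewrite /f5; case: ifP => _; [exact: csq0|exact: csq_transl].
have [+ _] := int_combination t (csq_transl x Kp) (csq_transl (- x) Kp) K3
  (csq_transl (- x0 - x) Kg) K5.
rewrite /= (int_transl x Kp t0) (int_transl (- x) Kp t0) (int_transl (- x0 - x) Kg t0).
have i0 : \int[mu]_(s in `[0, t]) (0 : R -> R) s = 0 by rewrite Rintegral_cst//= mul0r.
have -> : \int[mu]_(s in `[0, t]) f3 s = if x < x0 then G (x + (t - x0)) - G (x - x0) else 0.
  by rewrite /f3; case: ifP => _ //; rewrite int_transl// addrCA.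
have -> : \int[mu]_(s in `[0, t]) f5 s = if x < x0 then 0 else G (t + x0 - x) - G (x0 - x).
  by rewrite /f5; case: ifP => _ //; rewrite int_transl// addrA.
rewrite /kap_int (addrC x t) (addrA t (- x0)) => <-.
apply: eq_Rintegral => s _; rewrite kapE.
rewrite -[RHS]/(p (s + x) + p (s - x) + 2^-1 * (f3 s + g (s + (- x0 - x)) - f5 s)).
rewrite /f3 /f5 (addrC x s) (_ : x + (s - x0) = s + (x - x0)); last by ring.
rewrite (_ : s - x0 - x = s + (- x0 - x)); last by ring.
rewrite (_ : s + x0 - x = s + (x0 - x)); last by ring.
by case: ifP.
Qed.

Lemma kap_fubini t (chi : R -> R) : 0 <= t -> csq chi ->
  \int[mu]_(s in `[0, t]) ip (kap s) chi = \int[mu]_x (kap_int t x * chi x).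
Proof.
move=> t0 Kc.
pose F s x := \1_`[0, t] s * (kap s x * chi x).
have -> : \int[mu]_(s in `[0, t]) ip (kap s) chi = \int[mu]_s \int[mu]_x F s x.
  rewrite Rint_patch; apply: eq_Rintegral => s _; rewrite patchE /F indicE.
  case: (s \in _); first by apply: eq_Rintegral => x _; rewrite mul1r.
  by under eq_Rintegral do rewrite mul0r; rewrite Rintegral_cst ?mul0r.
have -> : \int[mu]_x (kap_int t x * chi x) = \int[mu]_x \int[mu]_s F s x.
  apply: eq_Rintegral => x _; rewrite -int_kap_time// Rint_patch -RintegralZr//; last first.
    by apply: itg_patch => //; exact/csq_itg/kap_time_csq.
  by apply: eq_Rintegral => s _; rewrite /F patch_indic /= mulrAC mulrC mulrA (mulrC (\1__ s)).
have II s : itg (F s).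
  exact: (itgZ (\1_`[0, t] s) (sqintM (kap_csq x0 Kp Kg s).1 Kc.1)).
apply: Rintegral_fubini => //.
- apply: measurable_funM.
    apply: (@measurableT_comp _ _ _ _ _ _ (\1_`[0, t] : mR -> R)) => //; exact: measurable_indic.
  apply: measurable_funM; first exact: kap_measurable2.
  by apply: (@measurableT_comp _ _ _ _ _ _ (chi : mR -> R)) => //; exact: sqint_meas Kc.1.
- move=> x.
  have -> : (F ^~ x) = chi x *: ((fun s => kap s x) \_ `[0, t]).
    apply/funext => s; rewrite /F patch_indic.
    by rewrite -[RHS]/(chi x * (kap s x * \1_`[0, t] s)) mulrC mulrCA mulrA.
  by apply: itgZ; apply: itg_patch => //; exact/csq_itg/kap_time_csq.
(* A bound for the product of |u_x(s)| and |chi| that is uniform in s, so that the double integral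
   over [0,t] is finite. *)
pose M := (2 * nm p + 2 * nm g) * nm chi.
apply: (@le_lt_trans _ _ (\int[mu]_s (M * \1_`[0, t] s)%:E)%E); last first.
  apply: (integrable_lty measurableT).
  exact: (itgZ M (@integrable_indic_itv R 0 t true false)).
have mF : measurable_fun setT (fun z : mR * mR => F z.1 z.2).
  apply: measurable_funM.
    apply: (@measurableT_comp _ _ _ _ _ _ (\1_`[0, t] : mR -> R)) => //; exact: measurable_indic.
  apply: measurable_funM; first exact: kap_measurable2.
  by apply: (@measurableT_comp _ _ _ _ _ _ (chi : mR -> R)) => //; exact: sqint_meas Kc.1.
apply: ge0_le_integral => //=.
- by move=> s _; exact: integral_ge0.
- apply: (@measurable_fun_fubini_tonelli_F _ _ mR mR R mu (fun z => `|F z.1 z.2|%:E)) => //.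
  by apply/measurable_EFinP; apply: measurableT_comp.
- by apply/measurable_EFinP; apply: measurable_funM; [exact: measurable_cst|exact: measurable_indic].
- move=> s _; rewrite itg_EFin; last exact: integrable_norm (II s).
  rewrite lee_fin /F.
  have Ka : sqint (fun x => `|kap s x|).
    apply: (le_sqint _ (kap_csq x0 Kp Kg s).1) => [|x]; last by rewrite normr_id.
    by apply: measurableT_comp => //; exact: sqint_meas (kap_csq x0 Kp Kg s).1.
  have Ca : sqint (fun x => `|chi x|).
    apply: (le_sqint _ Kc.1) => [|x]; last by rewrite normr_id.
    by apply: measurableT_comp => //; exact: sqint_meas Kc.1.
  have -> : \int[mu]_x `|\1_`[0, t] s * (kap s x * chi x)| = \1_`[0, t] s * ip (fun x => `|kap s x|) (fun x => `|chi x|).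
    rewrite -RintegralZl//; last exact: sqintM.
    apply: eq_Rintegral => x _; rewrite !normrM ger0_norm//.
  rewrite mulrC ler_wpM2r//.
  apply: (le_trans (ler_norm _)); apply: (le_trans (cauchy_schwarz Ka Ca)).
  apply: ler_pM; rewrite ?nm_ge0//.
    apply: (le_trans (le_nm _ (kap_csq x0 Kp Kg s).1 _)); first exact: sqint_meas.
      by move=> x; rewrite normr_id.
    by have [] := nm_kap_vel x0 s Kp.1 Kg.1.
  apply: le_nm; [exact: sqint_meas|exact: Kc.1|by move=> x; rewrite normr_id].
Qed.

Hypothesis g0 : forall s, s <= 0 -> g s = 0.

Definition kap_jump t x : R := kap_int t x + (if x < x0 then 0 else G t).

(* Adding the jump G t at x_0 makes the time integral of u_x absolutely continuous. *)
Lemma kap_jump_deriv t : 0 <= t -> weak_deriv 0 l (kap_jump t) (vel t - vel 0).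
Proof.
move=> t0; have Kv := csqB (vel_csq x0 Kp Kg t) (vel_csq x0 Kp Kg 0).
split; first by apply: sqint_L2; exact: Kv.1.
move=> x /andP[x_ge0 xl].
have -> : \int[mu]_(y in `[0, x]) (vel t - vel 0) y =
    \int[mu]_(y in `[0, x]) vel t y - \int[mu]_(y in `[0, x]) vel 0 y.
  by rewrite -RintegralB//; apply: sqint_int; exact: (vel_csq x0 Kp Kg _).1.
have [_ ->] := int_kap_vel x00 Kp Kg t x_ge0.
have [_ ->] := int_kap_vel x00 Kp Kg 0 x_ge0.
have Gn (y : R) : y <= 0 -> G y = 0 by exact: prim0_le.
rewrite /kap_jump /kap_int x00 /Num.min !sub0r !add0r !subr0 !oppr0 !addr0.
have x00' := x00; rewrite (Gn (- x0)) ?oppr_le0 ?(ltW x00)// (Gn (- x0 - x)); last lra.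
move: (prim g) (prim p) Gn => PG PP Gn.
case: ltP => xx0.
  rewrite (Gn (x - x0)); last lra.
  rewrite (_ : PG (x0 - x) - PG (x0 - x) = 0) ?subrr//.
  by field.
rewrite (Gn (x0 - x)); last lra.
rewrite subrr (_ : x0 + (t - x0) = t); last by ring.
rewrite (_ : t + x0 - x0 = t); last by ring.
by rewrite (Gn 0)//; field.
Qed.

Lemma int_ae_oo a b f h : (forall x, a < x < b -> f x = h x) -> itg f -> itg h ->
  \int[mu]_(x in `[a, b]) f x = \int[mu]_(x in `[a, b]) h x.
Proof.
move=> fh If Ih; rewrite !int_oo_cc; try exact: itg_patch.
apply: eq_Rintegral => x _; rewrite !patchE mem_setE in_itv/=; case: ifP => // xab.
exact: fh.
Qed.

(** Integrated over ]-l,t-l[, the recursion says that [kap_int] vanishes at l, taken on the right of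
    x0; only the added jump remains. *)
Lemma kap_jump_l t : 0 <= t ->
  (forall y, - l < y < t - l -> p (y + (l + l)) + p y = 2^-1 * (g (y + x0) - g (y - x0))) ->
  kap_jump t l = G t.
Proof.
move=> t0 rec; have lt : - l <= t - l by lra.
have x00' := x00; have x0l' := x0l; have l0' := l0.
have Gn (y : R) : y <= 0 -> G y = 0 by exact: prim0_le.
have K1 := csqD (csq_transl (l + l) Kp) Kp.
have K2 := csqZ 2^-1 (csqB (csq_transl x0 Kg) (csq_transl (- x0) Kg)).
have := int_ae_oo rec (csq_itg K1) (csq_itg K2).
rewrite !int_itv//; try exact: csq_itg.
have I1 := csq_itg Kp; have I2 := csq_itg (csq_transl (l + l) Kp).
have I3 := csq_itg (csq_transl x0 Kg); have I4 := csq_itg (csq_transl (- x0) Kg).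
have I5 := itgB I3 I4.
rewrite !primD// !primZ// !primB// /transl !prim_shift; try exact: csq_itg.
rewrite (_ : t - l + (l + l) = l + t); last by ring.
rewrite (_ : - l + (l + l) = l); last by ring.
rewrite (Gn (- l + x0)); last lra.
rewrite (Gn (- l - x0)); last lra.
rewrite /kap_jump /kap_int ltNge x0l/=.
rewrite (Gn (- x0 - l)); last lra.
rewrite (Gn (x0 - l)); last lra.
rewrite (_ : t - l + x0 = t + x0 - l); last by ring.
rewrite (_ : t - l - x0 = t - x0 - l); last by ring.
lra.
Qed.

Lemma dotL2_wave_strain s psi : Hhalf l psi ->
  dotL2 0 l (wderiv 0 l (wave s).1) (wderiv 0 l psi) = ip (kap s) (wderiv 0 l psi \_ `]0, l[).
Proof.
move=> [Hpsi _]; have Hw := wave_calH l x0 Kp Kg s.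
have Lc := (wderivP Hpsi).1.
rewrite dotL2E//; last exact: (wderivP Hw.1.1).1.
have Lk : L2 0 l (kap s \_ `]0, l[).
  by apply/sqint_L2/sqint_patch => //; exact: (kap_csq x0 Kp Kg s).1.
have Qk : sqint (kap s \_ `]0, l[) by apply: sqint_patch => //; exact: (kap_csq x0 Kp Kg s).1.
have pp f : (f \_ `]0, l[) \_ `]0, l[ = f \_ `]0, l[.
  by apply/funext => y; rewrite !patchE; itv_tac.
rewrite (ae_ip _ _ _ (strain_mk (vel s \_ `]0, l[) Lk)).
- by rewrite pp ip_patch pp.
- exact: strain_meas.
- by rewrite pp; exact: sqint_meas.
- exact: sqint_meas Lc.
Qed.

Lemma wave_weak t psi : 0 <= t ->
  (forall y, - l < y < t - l -> p (y + (l + l)) + p y = 2^-1 * (g (y + x0) - g (y - x0))) ->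
  Hhalf l psi ->
  dotL2 0 l (wave t).2 psi - dotL2 0 l (wave 0).2 psi +
    \int[mu]_(s in `[0, t]) dotL2 0 l (wderiv 0 l (wave s).1) (wderiv 0 l psi)
  = \int[mu]_(s in `[0, t]) (g s * psi x0).
Proof.
move=> t0 rec Hpsi; have [Hpsi1 psi0] := Hpsi.
have Wpsi := wderivP Hpsi1; have Lc := Wpsi.1; have Kc := L2_csq Lc.
have Lpsi := weak_deriv_L2 Wpsi.
set chi := wderiv 0 l psi in Wpsi Lc Kc *.
have l_in : 0 <= l <= l by rewrite lexx ltW.
have x0_in : 0 <= x0 <= l by rewrite ltW.
have -> : \int[mu]_(s in `[0, t]) dotL2 0 l (wderiv 0 l (wave s).1) chi =
    \int[mu]_(s in `[0, t]) ip (kap s) (chi \_ `]0, l[).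
  by apply: eq_Rintegral => s _; exact: dotL2_wave_strain.
rewrite kap_fubini//.
have Wj := kap_jump_deriv t0; have Lj := weak_deriv_L2 Wj.
(* Undoing the jump costs G t times the integral of psi_x over [x0,l]. Together with the boundary
   term G t * psi l this leaves the load G t * psi x0. *)
have -> : \int[mu]_x (kap_int t x * (chi \_ `]0, l[) x) =
    dotL2 0 l (kap_jump t) chi - G t * (psi l - psi x0).
  rewrite dotL2E// -[X in _ - G t * X]/(psi l - psi x0).
  rewrite (weak_deriv_prim Wpsi l_in) (weak_deriv_prim Wpsi x0_in).
  have -> : psi 0 + prim (chi \_ `]0, l[) l - (psi 0 + prim (chi \_ `]0, l[) x0) =
     \int[mu]_(x in `[x0, l]) (chi \_ `]0, l[) x.
    rewrite int_itv//; [by ring|exact: csq_itg].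
  rewrite -RintegralZl//; last exact: sqint_int Kc.1.
  rewrite (Rint_patch `[x0, l]%classic) /ip -RintegralB//; last 2 first.
  - exact: sqintM.
  - by apply: itg_patch => //; exact: (itgZ (G t) (csq_itg Kc)).
  apply: eq_Rintegral => x _; rewrite /kap_jump !patchE !mem_setE !in_itv/=.
  case: (ltP x x0) => xx0 /=.
    by case: ifP => _; rewrite ?addr0 ?subr0 ?mulr0.
  case: (ltP x l) => xl /=; last by rewrite andbF !mulr0; case: ifP; rewrite subrr.
  rewrite (ltW xl) (lt_le_trans x00 xx0)/=; ring.
have := weak_deriv_by_parts (ltW l0) Wj Wpsi.
rewrite psi0 mulr0 subr0 (kap_jump_l t0 rec) => Hparts.
have -> : \int[mu]_(s in `[0, t]) (g s * psi x0) = G t * psi x0.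
  rewrite RintegralZr//; last exact: sqint_int Kg.1.
  by rewrite int_itv//; [rewrite (prim0_le g0 (lexx 0)) subr0|exact: csq_itg].
have -> : dotL2 0 l (wave t).2 psi - dotL2 0 l (wave 0).2 psi = dotL2 0 l (vel t - vel 0) psi.
  have Lv s : L2 0 l (vel s) by apply: sqint_L2; exact: (vel_csq x0 Kp Kg s).1.
  have Lv' s : L2 0 l (vel s \_ `]0, l[).
    by apply/sqint_L2/sqint_patch => //; exact: (vel_csq x0 Kp Kg s).1.
  have pp f : (f \_ `]0, l[) \_ `]0, l[ = f \_ `]0, l[.
    by apply/funext => y; rewrite !patchE; itv_tac.
  rewrite [RHS]dotL2E//; last exact: Wj.1.
  rewrite !dotL2E//; try exact: Lv'.
  by rewrite /= !pp patchB ipBl//; (exact: Lv || exact: Lpsi).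
rewrite -[dotL2 0 l (kap_jump t) chi](addrK (dotL2 0 l (vel t - vel 0) psi)) Hparts; ring.
Qed.

End WeakIdentity.

(** * Free waves *)

Section LocallyL2.
Context {R : realType}.
Notation mu := (@lebesgue_measure R).
Implicit Types (f g h p q : R -> R) (a b c d x t s l : R).

(** Profiles live on the whole time axis and need not be in L^2 globally; on bounded time ranges,
    finite speed of propagation reduces them to [csq] functions. *)
Definition lsq q : Prop := forall a b, L2 a b q.

Lemma sqint_lsq f : sqint f -> lsq f. Proof. by move=> Qf a b; exact: sqint_L2. Qed.
Lemma lsqD f g : lsq f -> lsq g -> lsq (f + g). Proof. by move=> Lf Lg a b; exact: L2D. Qed.
Lemma lsqZ k f : lsq f -> lsq (k *: f). Proof. by move=> Lf a b; exact: L2Z. Qed.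
Lemma lsqN f : lsq f -> lsq (- f). Proof. by move=> Lf; rewrite -(scaleN1r f); exact: lsqZ. Qed.
Lemma lsqB f g : lsq f -> lsq g -> lsq (f - g). Proof. by move=> Lf Lg; apply: lsqD => //; exact: lsqN. Qed.
Lemma lsq0 : lsq (0 : R -> R). Proof. exact/sqint_lsq/sqint0. Qed.

Lemma patch_transl f a b d : transl f d \_ `]a, b[ = transl (f \_ `]a + d, b + d[) d.
Proof.
apply/funext => x; rewrite /transl !patchE !mem_setE !in_itv/=.
by rewrite !ltrD2r.
Qed.

Lemma patch_refl f a b d : refl f d \_ `]a, b[ = refl (f \_ `]d - b, d - a[) d.
Proof.
apply/funext => x; rewrite /refl !patchE !mem_setE !in_itv/=.
by rewrite !ltrD2l !ltrN2 andbC.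
Qed.

Lemma lsq_transl f d : lsq f -> lsq (transl f d).
Proof. by move=> Lf a b; rewrite /L2 patch_transl; apply: sqint_shift; exact: Lf. Qed.

Lemma lsq_refl f d : lsq f -> lsq (refl f d).
Proof. by move=> Lf a b; rewrite /L2 patch_refl; apply: sqint_reflect; exact: Lf. Qed.

Lemma weak_deriv_itv a b f g a' b' : weak_deriv a b f g -> a <= a' -> b' <= b -> a' <= b' ->
  weak_deriv a' b' f g.
Proof.
move=> H aa' bb' ab'.
have E : g \_ `]a', b'[ = (g \_ `]a, b[) \_ `]a', b'[.
  by apply/funext => x; rewrite !patchE; itv_tac.
have Lg : L2 a' b' g by rewrite /L2 E; apply: sqint_patch => //; exact: H.1.
apply/weak_derivP => // x /andP[a'x xb'].
have xab : a <= x <= b by rewrite (le_trans aa')//= (le_trans xb').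
have aab : a <= a' <= b by rewrite aa'/= (le_trans ab').
have I := csq_itg (L2_csq H.1).
rewrite (weak_deriv_prim H xab) (weak_deriv_prim H aab) -addrA; congr (_ + _).
rewrite -[LHS](subrK (prim (g \_ `]a, b[) a')) addrC; congr (_ + _).
rewrite -(int_itv a'x I) -(int_prim Lg); last by rewrite a'x.
rewrite !int_oo_cc.
- apply: eq_Rintegral => y _; rewrite !patchE; itv_tac.
- rewrite (patchoo_sub g (_ : a' <= x <= b')) ?a'x//; apply: itg_patch => //; exact/csq_itg/L2_csq.
- exact: itg_patch.
Qed.

(** Absolutely continuous profiles. The constant is there because [prim eps] vanishes far to the
    left, while the profile of an element of D(calA) need not vanish at - l. *)
Definition affprim (k : R) (eps : R -> R) : R -> R := fun y => k + prim eps y.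

Lemma affprim_deriv k eps a b : a <= b -> csq eps -> weak_deriv a b (affprim k eps) eps.
Proof.
move=> ab K; split; first by apply: sqint_L2; exact: K.1.
move=> x /andP[ax xb]; rewrite int_itv//; [|exact: csq_itg].
by rewrite /affprim; ring.
Qed.

Lemma affprim_lsq k eps : csq eps -> lsq (affprim k eps).
Proof.
move=> K a b; case: (leP a b) => ab.
  exact: (weak_deriv_L2 (affprim_deriv k ab K)).
rewrite /L2 (_ : _ \_ _ = 0); first exact: sqint0.
by apply/funext => x; rewrite patchE mem_setE in_itv/=; case: ifPn => // H; exfalso; lra.
Qed.

End LocallyL2.

Section FreeWaves.
Context {R : realType}.
Notation mu := (@lebesgue_measure R).
Implicit Types (f g h p q : R -> R) (a b c d x t s : R).
Variable l : R.
Hypothesis l0 : 0 < l.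

Definition sp q s : R -> R := transl q s + refl q s.
Definition sm q s : R -> R := transl q s - refl q s.
(* d'Alembert: u_x = q (s + x) + q (s - x) and u_t = q (s + x) - q (s - x) *)
Definition free q s : state R := mk (sp q s \_ `]0, l[) (sm q s \_ `]0, l[).

Lemma sp_lsq q s : lsq q -> lsq (sp q s).
Proof. by move=> Lq; apply: lsqD; [exact: lsq_transl|exact: lsq_refl]. Qed.
Lemma sm_lsq q s : lsq q -> lsq (sm q s).
Proof. by move=> Lq; apply: lsqB; [exact: lsq_transl|exact: lsq_refl]. Qed.

Lemma free_calH q s : lsq q -> calH l (free q s).
Proof. by move=> Lq; apply: calH_mk; apply: sqint_L2; [exact: sp_lsq|exact: sm_lsq]. Qed.

(** Finite speed of propagation: at time s the string sees only the values of the profile on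
    ]s-l,s+l[. The equality is exact because [free] cuts off to ]0,l[. *)
Lemma free_local q q' s s' : (forall y, - l < y < l -> q (y + s) = q' (y + s')) ->
  free q s = free q' s'.
Proof.
move=> qq'; have E x : 0 < x < l -> q (x + s) = q' (x + s') /\ q (s - x) = q' (s' - x).
  move=> xl; split; first by apply: qq'; have l0' := l0; lra.
  by rewrite !(addrC _ (- x)); apply: qq'; have l0' := l0; lra.
rewrite /free; congr mk; apply/funext => x; rewrite !patchE mem_setE in_itv/=;
  case: ifP => // /E[e1 e2].
- by rewrite -[LHS]/(q (x + s) + q (s - x)) -[RHS]/(q' (x + s') + q' (s' - x)) e1 e2.
- by rewrite -[LHS]/(q (x + s) - q (s - x)) -[RHS]/(q' (x + s') - q' (s' - x)) e1 e2.
Qed.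

Lemma free_lin k q q' s : lsq q -> lsq q' -> free (k *: q + q') s = k *: free q s + free q' s.
Proof.
move=> Lq Lq'; rewrite /free -mk_lin; last 2 first.
- exact: sp_lsq.
- exact: sp_lsq.
rewrite -!patchZ -!patchD; congr mk; congr (_ \_ _); apply/funext => x.
- rewrite -[LHS]/(k * q (x + s) + q' (x + s) + (k * q (s - x) + q' (s - x))).
  by rewrite -[RHS]/(k * (q (x + s) + q (s - x)) + (q' (x + s) + q' (s - x))); ring.
- rewrite -[LHS]/(k * q (x + s) + q' (x + s) - (k * q (s - x) + q' (s - x))).
  by rewrite -[RHS]/(k * (q (x + s) - q (s - x)) + (q' (x + s) - q' (s - x))); ring.
Qed.

Lemma freeZ k q s : lsq q -> free (k *: q) s = k *: free q s.
Proof.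
move=> Lq; have := free_lin k s Lq lsq0.
rewrite addr0 => ->; rewrite (_ : free 0 s = 0) ?addr0//.
have := free_lin 1 s lsq0 lsq0; rewrite scale1r addr0 => /eqP.
by rewrite -subr_eq0 scale1r opprD addrA subrr sub0r oppr_eq0 => /eqP.
Qed.

Lemma freeB q q' s : lsq q -> lsq q' -> free (q - q') s = free q s - free q' s.
Proof. by move=> Lq Lq'; rewrite addrC -(scaleN1r q') free_lin// scaleN1r addrC. Qed.

Lemma normH_free q s : sqint q -> normH l (free q s) <= 4 * nm q.
Proof.
move=> Qq; have Q1 := sqint_shift s Qq; have Q2 := sqint_reflect s Qq.
have Qp := sqintD Q1 Q2; have Qm := sqintB Q1 Q2.
apply: (le_trans (normH_mk_le_sq _ _ _)); try exact: sqint_patch.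
have := nm_patch (measurable_itv `]0, l[) Qp; have := nm_patch (measurable_itv `]0, l[) Qm.
have := nmD Q1 Q2; have := nmB Q1 Q2; rewrite nm_shift// nm_reflect//.
rewrite /sp /sm /transl /refl; lra.
Qed.

Lemma free_transl q a s : free (transl q a) s = free q (s + a).
Proof. by apply: free_local => y _; rewrite /transl addrA. Qed.

(** Moving in time is translating the profile, so the error of the difference quotient is itself a
    free wave, with a small profile; hence [dl] does not depend on s. *)
Lemma free_generator k eps e : 0 < e -> csq eps ->
  exists2 dl : R, 0 < dl & forall (h s : R), h != 0 -> `|h| < dl ->
    normH l (h^-1 *: (free (affprim k eps) (s + h) - free (affprim k eps) s) - free eps s) <= e.
Proof.
move=> e0 K; have e40 : 0 < e / 4 by rewrite divr_gt0.
have [dl dl0 H] := diff_quotient e40 K; exists dl => // h s hn0 hd.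
have /= [] := H h hn0 hd; set E := (_ - eps : R -> R) => QE nE.
have La := affprim_lsq k K; have Le := sqint_lsq K.1.
have LD : lsq (transl (affprim k eps) h - affprim k eps) by apply: lsqB => //; exact: lsq_transl.
rewrite -free_transl -freeB//; last exact: lsq_transl.
rewrite -freeZ// -freeB//; last exact: lsqZ.
have -> : h^-1 *: (transl (affprim k eps) h - affprim k eps) - eps = E.
  apply/funext => x; rewrite -[LHS]/(h^-1 * (k + prim eps (x + h) - (k + prim eps x)) - eps x).
  by rewrite -[RHS]/(h^-1 * (prim eps (x + h) - prim eps x) - eps x); ring.
by apply: (le_trans (normH_free _ QE)); lra.
Qed.

Lemma free_wave x0 q s : free q s = forced_wave l x0 q 0 s.
Proof.
rewrite /free /forced_wave; congr mk; congr (_ \_ _); apply/funext => x.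
- by rewrite kapE -[LHS]/(q (x + s) + q (s - x)) !if_same addr0 subr0 mulr0 addr0.
- by rewrite velE -[LHS]/(q (x + s) - q (s - x)) !if_same subr0 addr0 mulr0 addr0.
Qed.

Lemma free_uniform q e : 0 < e -> csq q -> exists2 dl : R, 0 < dl &
  forall s t, `|s - t| < dl -> normH l (free q s - free q t) <= e.
Proof.
move=> e0 Kq; have [dl dl0 H] := @wave_uniform _ l l q 0 Kq csq0 _ e0.
by exists dl => // s t st; rewrite !(free_wave l); exact: H.
Qed.

Lemma lsq_csq_cut q M : lsq q -> csq (q \_ `]- M, M[).
Proof. by move=> Lq; exact: L2_csq. Qed.

Lemma free_cont q t e : 0 < e -> lsq q -> exists2 dl : R, 0 < dl &
  forall s, `|s - t| < dl -> normH l (free q s - free q t) <= e.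
Proof.
move=> e0 Lq; pose M := `|t| + l + 1.
(* At times within 1 of t, only values of q on ]-M,M[ are seen. *)
have [dl dl0 H] := free_uniform e0 (lsq_csq_cut M Lq).
exists (Num.min dl 1); first by rewrite lt_min dl0/=.
move=> s; rewrite lt_min => /andP[sd s1].
have E r : `|r - t| < 1 -> free q r = free (q \_ `]- M, M[) r.
  move=> rt; apply: free_local => y yl; rewrite patchE mem_setE in_itv/=.
  rewrite ifT// /M; have := ler_norm t; have := ler_norm (- t); rewrite normrN.
  by move: rt; rewrite ltr_norml; lra.
by rewrite (E s s1) (E t) ?subrr ?normr0//; exact: H.
Qed.

End FreeWaves.

Section Limits.
Context {R : realType}.
Implicit Types (T : Type) (l : R).

(** Only right derivatives are at hand: generators are one-sided limits and the wave equation is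
    used on [t,t+h]. The supremum of the times up to which |F r - F 0| <= r e' cannot lie before
    T. *)
Lemma right_derivative0 (F : R -> R) (T : R) : 0 <= T ->
  (forall t, 0 <= t <= T -> forall e, 0 < e -> exists2 dl : R, 0 < dl &
    forall s, 0 <= s <= T -> `|s - t| < dl -> `|F s - F t| <= e) ->
  (forall t, 0 <= t < T -> forall e, 0 < e -> exists2 dl : R, 0 < dl &
    forall h, 0 < h -> h < dl -> `|F (t + h) - F t| <= h * e) ->
  F T = F 0.
Proof.
move=> T0 cF dF; apply/eqP; rewrite -subr_eq0 -normr_le0; apply/ler_addgt0Pl => e e0.
have T10 : 0 < T + 1 by lra.
(* The divisor is T + 1 since T may be 0. *)
pose e' := e / (T + 1); have e'0 : 0 < e' by rewrite divr_gt0.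
pose A : set R := [set s | 0 <= s <= T /\ forall r, 0 <= r <= s -> `|F r - F 0| <= r * e'].
have A0 : A 0.
  split; first by rewrite lexx T0.
  move=> r /andP[r0 r0']; have -> : r = 0 by apply/eqP; rewrite eq_le r0 r0'.
  by rewrite subrr normr0 mul0r.
have ubA : ubound A T by move=> s [/andP[]].
have supA : has_sup A by split; [exists 0|exists T].
pose c := sup A.
have c0 : 0 <= c by apply: ub_le_sup => //; exists T.
have cT : c <= T by apply: ge_sup => //; exists 0.
have below r : 0 <= r < c -> `|F r - F 0| <= r * e'.
  move=> /andP[r0 rc]; have cr : 0 < c - r by rewrite subr_gt0.
  have [s [_ Hs] rs] := sup_adherent cr supA.
  by apply: Hs; rewrite r0/= ltW//; move: rs; rewrite -/c; lra.
have Fc : `|F c - F 0| <= c * e'.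
  apply/ler_addgt0Pl => d d0.
  have [dl dl0 Hd] := cF c (introT andP (conj c0 cT)) d d0.
  have [c00|cn0] := eqVneq c 0; first by rewrite c00 subrr normr0; lra.
  have cp : 0 < c by rewrite lt_neqAle eq_sym cn0.
  pose r := Num.max 0 (c - dl / 2).
  have r0 : 0 <= r by rewrite le_max lexx.
  have rc : r < c by rewrite gt_max cp/=; lra.
  have rd : `|r - c| < dl.
    rewrite ltr_norml; apply/andP; split; last by lra.
    have : c - dl / 2 <= r by rewrite le_max lexx orbT.
    lra.
  have := Hd r; rewrite r0 (le_trans (ltW rc))// => /(_ isT rd) H1.
  have := below r; rewrite r0 rc => /(_ isT) H2.
  rewrite -(subrKA (F r)); apply: (le_trans (ler_normD _ _)); rewrite distrC.
  have : r * e' <= c * e' by rewrite ler_wpM2r ?ltW.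
  lra.
have [cltT|Tlec] := ltP c T; last first.
  have -> : T = c by apply/eqP; rewrite eq_le Tlec cT.
  rewrite addr0; apply: (le_trans Fc).
  have : c * e' <= (T + 1) * e' by rewrite ler_wpM2r ?ltW//; lra.
  by rewrite /e' mulrC (mulrC (T + 1)) divfK ?gt_eqF// mulrC.
exfalso.
have [dl dl0 Hd] := dF c (introT andP (conj c0 cltT)) e' e'0.
pose h := Num.min (dl / 2) (T - c).
have h0 : 0 < h by rewrite lt_min divr_gt0//= subr_gt0.
have hdl : h < dl by rewrite gt_min; apply/orP; left; lra.
have hT : c + h <= T by rewrite -lerBrDl ge_min lexx orbT.
(* If c < T, the right derivative at c carries the estimate beyond c, against the choice of c. *)
have Ach : A (c + h).
  split; first by rewrite hT andbT addr_ge0// ltW.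
  move=> r /andP[r0 rch]; have [rc|cr] := ltP r c; first by apply: below; rewrite r0.
  have [->|rnc] := eqVneq r c => //.
  have crs : 0 < r - c by rewrite subr_gt0 lt_neqAle eq_sym rnc.
  have := Hd (r - c) crs; rewrite (_ : c + (r - c) = r); last by ring.
  have rdl : r - c < dl by lra.
  move=> /(_ rdl) H1; rewrite -(subrKA (F c)).
  apply: (le_trans (ler_normD _ _)); rewrite mulrBl in H1; lra.
have : c + h <= c by apply: ub_le_sup => //; exists T.
lra.
Qed.

End Limits.

(** * Waves with locally square integrable profile and source *)

Section GlobalWave.
Context {R : realType}.
Notation mu := (@lebesgue_measure R).
Implicit Types (f g h p q : R -> R) (a b c d x t s : R).
Variables (l x0 : R).
Hypotheses (l0 : 0 < l) (x00 : 0 < x0) (x0l : x0 <= l).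

Definition cut f M : R -> R := f \_ `]- M, M[.

Lemma cutE f M y : - M < y < M -> cut f M y = f y.
Proof. by move=> H; rewrite /cut patchE mem_setE in_itv/= H. Qed.

(** All arguments at which a wave at time t reads p and g differ from t by less than 2 l, because x0
    <= l. *)
Lemma wave_cut p g tau t : `|t| <= tau ->
  forced_wave l x0 p g t = forced_wave l x0 (cut p (tau + 2 * l)) (cut g (tau + 2 * l)) t.
Proof.
move=> ttau; have l0' := l0; have x00' := x00; have x0l' := x0l.
have /andP[t1 t2] : - tau <= t <= tau by rewrite -ler_norml.
rewrite /forced_wave; congr mk; apply/funext => x; rewrite !patchE mem_setE in_itv/=; case: ifP => // xl;
  rewrite !(kapE, velE) !cutE//; lra.
Qed.

Lemma csq_cut f M : lsq f -> csq (cut f M).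
Proof. by move=> Lf; exact: L2_csq. Qed.

Lemma wave_calH_lsq p g t : lsq p -> lsq g -> calH l (forced_wave l x0 p g t).
Proof. by move=> Lp Lg; rewrite (wave_cut _ _ (lexx `|t|)); apply: wave_calH; exact: csq_cut. Qed.

Lemma eq_int_strain (W W' : R -> state R) t psi : (forall s, 0 <= s <= t -> W s = W' s) ->
  \int[mu]_(s in `[0, t]) dotL2 0 l (wderiv 0 l (W s).1) (wderiv 0 l psi) =
  \int[mu]_(s in `[0, t]) dotL2 0 l (wderiv 0 l (W' s).1) (wderiv 0 l psi).
Proof.
by move=> E; apply: eq_Rintegral => s; rewrite mem_setE in_itv/= => st; rewrite E.
Qed.

Lemma wave_solution_explicit p g : lsq p -> lsq g ->
  (forall s, s <= 0 -> g s = 0) ->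
  (forall y, - l < y -> p (y + (l + l)) + p y = 2^-1 * (g (y + x0) - g (y - x0))) ->
  wave_solution l x0 (forced_wave l x0 p g 0) (forced_wave l x0 p g) g.
Proof.
move=> Lp Lg g0 rec; have l0' := l0; have x00' := x00; have x0l' := x0l.
split.
- move=> tau tau0 t /andP[t0 tt].
  have Kp := csq_cut (tau + 2 * l) Lp; have Kg := csq_cut (tau + 2 * l) Lg.
  have nt s : 0 <= s <= tau -> `|s| <= tau by move=> /andP[s0 st]; rewrite ger0_norm.
  have [] := @wave_contH _ l x0 _ _ Kp Kg 0 tau t; first by rewrite t0.
  have tn : `|t| <= tau by apply: nt; rewrite t0.
  rewrite -(wave_cut p g tn) => Ht ct; split => //.
  apply: cvg_trans ct; apply: near_eq_cvg; near=> s.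
  have st : s \in `[0, tau] by near: s; exact: withinT.
  by rewrite -wave_cut// nt//; move: st; rewrite in_itv.
- exact: eqH_refl.
- move=> t t0; pose tau := t + 1.
  have Kp := csq_cut (tau + 2 * l) Lp; have Kg := csq_cut (tau + 2 * l) Lg.
  have := @wave_velocity _ l x0 _ _ x00 Kp Kg t.
  rewrite -wave_cut; last by rewrite ger0_norm// /tau; lra.
  move=> H; apply: cvg_within_filter; apply: cvg_trans H; apply: near_eq_cvg.
  have : \forall s \near t, `|s - t| < 1.
    by apply: near_nbhsP; exists 1.
  move=> H; have : \forall s \near t^', `|s - t| < 1 by apply: nbhs_dnbhs.
  apply: filterS => s st; rewrite -wave_cut// /tau.
  by move: st; rewrite ltr_norml ler_norml; lra.
- move=> t psi t0 Hpsi; pose tau := t.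
  have Kp := csq_cut (tau + 2 * l) Lp; have Kg := csq_cut (tau + 2 * l) Lg.
  have g0' s : s <= 0 -> cut g (tau + 2 * l) s = 0.
    by move=> s0; rewrite /cut patchE; case: ifP => // _; exact: g0.
  have rec' y : - l < y < t - l -> cut p (tau + 2 * l) (y + (l + l)) + cut p (tau + 2 * l) y =
      2^-1 * (cut g (tau + 2 * l) (y + x0) - cut g (tau + 2 * l) (y - x0)).
    move=> /andP[y1 y2]; rewrite !cutE ?rec// /tau; lra.
  have := @wave_weak _ l x0 _ _ l0 x00 x0l Kp Kg g0' t psi t0 rec' Hpsi.
  rewrite -!wave_cut ?normr0 ?(ger0_norm t0)//.
  have -> : \int[mu]_(s in `[0, t]) (cut g (tau + 2 * l) s * psi x0) = \int[mu]_(s in `[0, t]) (g s * psi x0).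
    apply: eq_Rintegral => s; rewrite mem_setE in_itv/= => st; rewrite cutE// /tau; lra.
  have E s : 0 <= s <= t -> forced_wave l x0 (cut p (tau + 2 * l)) (cut g (tau + 2 * l)) s = forced_wave l x0 p g s.
    by move=> /andP[s0 st]; rewrite -wave_cut// ger0_norm.
  have H2 := eq_int_strain psi E.
  move=> H; exact: (etrans (esym (congr1 (fun X => dotL2 0 l (forced_wave l x0 p g t).2 psi -
    dotL2 0 l (forced_wave l x0 p g 0).2 psi + X) H2)) H).
Unshelve. all: by end_near. Qed.

Lemma wave_trace_lsq p g tau : 0 <= tau -> lsq p -> lsq g ->
  weak_deriv 0 tau (fun t => (forced_wave l x0 p g t).1 x0) (forced_trace x0 p g).
Proof.
move=> tau0 Lp Lg; have l0' := l0; have x00' := x00; have x0l' := x0l.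
have Kp := csq_cut (tau + 2 * l) Lp; have Kg := csq_cut (tau + 2 * l) Lg.
have [Lt Ht] := @wave_trace _ l x0 _ _ x00 x0l Kp Kg tau tau0.
have E y : 0 < y < tau -> forced_trace x0 (cut p (tau + 2 * l)) (cut g (tau + 2 * l)) y = forced_trace x0 p g y.
  move=> ytau.
  have tE (q h : R -> R) : forced_trace x0 q h y = q (y + x0) - q (y - x0) + 2^-1 * (h y - h (y - (x0 + x0))) by [].
  by rewrite !tE !cutE//; lra.
have EP : forced_trace x0 p g \_ `]0, tau[ = forced_trace x0 (cut p (tau + 2 * l)) (cut g (tau + 2 * l)) \_ `]0, tau[.
  by apply/funext => y; rewrite !patchE mem_setE in_itv/=; case: ifP => // /E.
have Lt' : L2 0 tau (forced_trace x0 p g) by rewrite /L2 EP.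
apply/weak_derivP => // t /andP[t0 tt].
have ttau : 0 <= t <= tau by rewrite t0.
have := weak_deriv_prim (@wave_trace _ l x0 _ _ x00 x0l Kp Kg tau tau0) ttau.
by rewrite -!wave_cut ?normr0// ?ger0_norm// EP.
Qed.

End GlobalWave.

(** * Free waves with absolutely continuous profile *)

Section Pairing.
Context {R : realType}.
Notation mu := (@lebesgue_measure R).
Implicit Types (f g h p q : R -> R) (a b c d x t s : R).
Variables (l x0 : R).
Hypotheses (l0 : 0 < l) (x00 : 0 < x0) (x0l : x0 <= l).

Lemma sp_deriv k eps s : csq eps -> weak_deriv 0 l (sp (affprim k eps) s) (sm eps s).
Proof.
move=> K; have l0' := l0.
have Ls : lsq (sm eps s) by apply: sm_lsq; exact/sqint_lsq/K.1.
split; first exact: Ls.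
move=> x /andP[x_ge0 xl].
have -> : \int[mu]_(y in `[0, x]) sm eps s y =
    \int[mu]_(y in `[0, x]) transl eps s y - \int[mu]_(y in `[0, x]) refl eps s y.
  by rewrite -RintegralB//; apply: sqint_int; [exact: sqint_shift K.1|exact: sqint_reflect K.1].
rewrite int_transl// int_refl//.
rewrite -[LHS]/(k + prim eps (x + s) + (k + prim eps (s - x))).
rewrite -[sp _ _ 0]/(k + prim eps (0 + s) + (k + prim eps (s - 0))) add0r subr0; ring.
Qed.

Lemma sm_deriv k eps s : csq eps -> weak_deriv 0 l (sm (affprim k eps) s) (sp eps s).
Proof.
move=> K; have l0' := l0.
have Ls : lsq (sp eps s) by apply: sp_lsq; exact/sqint_lsq/K.1.
split; first exact: Ls.
move=> x /andP[x_ge0 xl].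
have -> : \int[mu]_(y in `[0, x]) sp eps s y =
    \int[mu]_(y in `[0, x]) transl eps s y + \int[mu]_(y in `[0, x]) refl eps s y.
  by rewrite -RintegralD//; apply: sqint_int; [exact: sqint_shift K.1|exact: sqint_reflect K.1].
rewrite int_transl// int_refl//.
rewrite -[LHS]/(k + prim eps (x + s) - (k + prim eps (s - x))).
rewrite -[sm _ _ 0]/(k + prim eps (0 + s) - (k + prim eps (s - 0))) add0r subr0; ring.
Qed.

Lemma sm_Hhalf k eps s : csq eps -> Hhalf l (sm (affprim k eps) s).
Proof.
move=> K; split; first by exists (sp eps s); exact: sm_deriv.
by rewrite -[LHS]/(affprim k eps (0 + s) - affprim k eps (s - 0)) add0r subr0 subrr.
Qed.

Lemma patch_idem f D : (f \_ D) \_ D = f \_ D.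
Proof. by apply/funext => y; rewrite !patchE; case: (y \in D). Qed.

Lemma dotH_free z q s : calH l z -> lsq q ->
  dotH l z (free l q s) = ip (strain l z) (sp q s \_ `]0, l[) + ip (speed l z) (sm q s \_ `]0, l[).
Proof.
move=> Hz Lq; have Lk : L2 0 l (sp q s \_ `]0, l[) by apply: sqint_L2; exact: sp_lsq.
have Hf := free_calH l s Lq.
rewrite (dotH_strain Hz Hf (weak_deriv_mk _ Lk)) patch_idem.
by rewrite /speed patch_idem.
Qed.

(** The boundary term at 0 vanishes because z.1 0 = 0, the one at l because the assumption on the
    profile says that the strain of the test wave is 0 there. *)
Lemma by_parts_free z k eps s : calH l z -> csq eps ->
  affprim k eps (s + l) + affprim k eps (s - l) = 0 ->
  ip (strain l z) (sp (affprim k eps) s \_ `]0, l[) = - dotL2 0 l z.1 (sm eps s).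
Proof.
move=> [[Hz z0] Lz] K bc.
have := weak_deriv_by_parts (ltW l0) (wderivP Hz) (sp_deriv k s K).
have -> : sp (affprim k eps) s l = 0 by rewrite -bc -[LHS]/(affprim k eps (l + s) + _) (addrC l).
rewrite z0 mul0r mulr0 subrr => /eqP; rewrite addrC addr_eq0 => /eqP <-.
rewrite dotL2E//; first exact: (wderivP Hz).1.
by apply: sp_lsq; exact: affprim_lsq.
Qed.

End Pairing.

(** * Pairing of wave solutions with free waves *)

Section Small.
Context {R : realType}.
Notation mu := (@lebesgue_measure R).
Implicit Types (f g h p q : R -> R) (a b c d x t s : R).

(** Absolute continuity of the norm: a truncation bounded by N contributes at most N times the
    square root of the length, and the rest is small everywhere. *)
Lemma nm_patch_small f e : 0 < e -> sqint f -> exists2 dl : R, 0 < dl &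
  forall a b, a <= b -> b < a + dl -> nm (f \_ `[a, b]) <= e.
Proof.
move=> e0 Qf; have e20 : 0 < e / 2 by rewrite divr_gt0.
have [N [h mh [hf hN fh]]] := truncation_approx e20 Qf.
have Qh : sqint h := le_sqint mh Qf hf.
have N1 : 0 < N%:R + 1 :> R by rewrite ltr_wpDl.
pose k := e / 2 / (N%:R + 1); have k0 : 0 < k by rewrite divr_gt0.
exists (k ^+ 2); first by rewrite exprn_gt0.
move=> a b ab bk; rewrite -(subrK h f) patchD.
have mi : measurable `[a, b]%classic by exact: measurable_itv.
have Q1 : sqint ((f - h) \_ `[a, b]) by apply: sqint_patch => //; exact: sqintB.
have Q2 : sqint (h \_ `[a, b]) by exact: sqint_patch.
apply: le_trans (nmD Q1 Q2) _.
have h1 : nm ((f - h) \_ `[a, b]) <= e / 2.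
  by apply: le_trans (nm_patch mi (sqintB Qf Qh)) (ltW fh).
have h2 : nm (h \_ `[a, b]) <= (N%:R + 1) * k.
  have Qi : sqint ((N%:R + 1 : R) *: (\1_`[a, b] : R -> R)) by apply: sqintZ; exact: sqint_indic.
  have := @le_nm _ (h \_ `[a, b]) _ (sqint_meas Q2) Qi.
  rewrite (nmZ _ (sqint_indic a b)) nm_indic// gtr0_norm// => H; apply: le_trans (H _) _.
    move=> x; rewrite patch_indic -[X in `|X|]/(h x * \1_`[a, b] x)
      -[X in _ <= `|X|]/((N%:R + 1) * \1_`[a, b] x) !normrM ler_wpM2r//.
    by rewrite (gtr0_norm N1); have := hN x; lra.
  rewrite ler_pM2l//; apply: (@le_trans _ _ (Num.sqrt (k ^+ 2))); first by apply: ler_wsqrtr; lra.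
  by rewrite sqrtr_sqr ger0_norm// ltW.
have E : (N%:R + 1) * k = e / 2 by rewrite /k; field; exact: lt0r_neq0.
by rewrite (splitr e) -{2}E lerD.
Qed.

Lemma int_sub_itv f T a b : itg (f \_ `]0, T[) -> 0 <= a -> a <= b -> b <= T ->
  \int[mu]_(r in `[a, b]) f r = prim (f \_ `]0, T[) b - prim (f \_ `]0, T[) a.
Proof.
move=> If a0 ab bT.
have E : f \_ `]a, b[ = (f \_ `]0, T[) \_ `]a, b[.
  by apply/funext => x; rewrite !patchE; itv_tac.
rewrite -int_itv// !int_oo_cc.
- by rewrite E.
- by apply: itg_patch.
- by rewrite E; exact: itg_patch.
Qed.

Lemma int_increment f T t (h : R) : itg (f \_ `]0, T[) -> 0 <= t -> 0 <= h -> t + h <= T ->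
  \int[mu]_(r in `[0, t + h]) f r - \int[mu]_(r in `[0, t]) f r = \int[mu]_(r in `[t, t + h]) f r.
Proof. by move=> If t0 h0 hT; rewrite !(int_sub_itv If)//; lra. Qed.

Lemma int_close f T a b (c e : R) : itg (f \_ `]0, T[) -> 0 <= a -> a < b -> b <= T ->
  (forall r, a <= r <= b -> `|f r - c| <= e) ->
  `|\int[mu]_(r in `[a, b]) f r - (b - a) * c| <= (b - a) * e.
Proof.
move=> If a0 ab bT H; have e0 : 0 <= e.
  by apply: le_trans (H a _) => //; rewrite lexx ltW.
have cc k : itg ((cst k : R -> R) \_ `]a, b[) /\ \int[mu]_x ((cst k : R -> R) \_ `]a, b[) x = (b - a) * k.
  have I1 : itg ((cst k : R -> R) \_ `]a, b[).
    have -> : (cst k : R -> R) \_ `]a, b[ = (k *: (\1_`[a, b] : R -> R)) \_ `]a, b[.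
      apply/funext => x; rewrite !patchE; case: ifPn => // /set_mem; rewrite /= in_itv/= => /andP[ax xb].
      by rewrite -[RHS]/(k * \1_`[a, b] x) indicE mem_setE in_itv/= !ltW// mulr1.
    rewrite -patchoo_cc; apply: sqint_itg_patch; apply: sqint_patch => //.
    exact/sqintZ/sqint_indic.
  split=> //; rewrite -int_oo_cc// Rintegral_cst//= lebesgue_measure_itv/= lte_fin ab.
  by rewrite mulrC.
have [Ic Ec] := cc c; have [Ie Ee] := cc e.
have E2 : f \_ `]a, b[ = (f \_ `]0, T[) \_ `]a, b[.
  by apply/funext => x; rewrite !patchE; itv_tac.
have I2 : itg (f \_ `]a, b[) by rewrite E2; exact: itg_patch.
rewrite int_oo_cc// -Ec -RintegralB//.
have I3 : itg (f \_ `]a, b[ - (cst c : R -> R) \_ `]a, b[) by exact: itgB.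
apply: le_trans (le_normr_Rintegral _ I3) _ => //; rewrite -Ee.
apply: le_Rintegral => //; first exact: integrable_norm.
move=> x _; rewrite -[X in `|X|]/((f \_ `]a, b[) x - ((cst c : R -> R) \_ `]a, b[) x) !patchE.
case: ifPn => [/set_mem|_]; last by rewrite subrr normr0.
by rewrite /= in_itv/= => /andP[ax xb]; apply: H; rewrite !ltW.
Qed.

End Small.

(** * Consequences of the notion of solution *)

Section WaveSolutionFacts.
Context {R : realType}.
Notation mu := (@lebesgue_measure R).
Implicit Types (f g h p q : R -> R) (a b c d x t s : R).
Variables (l x0 : R) (z0 : state R) (U : R -> state R) (g : R -> R).
Hypotheses (l0 : 0 < l) (x00 : 0 < x0) (x0l : x0 <= l).
Hypothesis HU : wave_solution l x0 z0 U g.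

Lemma ws_calH t : 0 <= t -> calH l (U t).
Proof.
move=> t0; have [H _ _ _] := HU.
have [] // := H (t + 1) _ t; first by lra.
by rewrite t0/=; lra.
Qed.

Lemma ws_cont t e : 0 <= t -> 0 < e -> exists2 dl : R, 0 < dl &
  forall s, 0 <= s -> `|s - t| < dl -> normH l (U s - U t) <= e.
Proof.
move=> t0 e0; have [H _ _ _] := HU.
have t1 : 0 < t + 1 by lra.
have tin : 0 <= t <= t + 1 by rewrite t0/=; lra.
have [_ /cvgr0Pnorm_le /(_ _ e0) /within_nearP[dl dl0 Hd]] := H (t + 1) t1 t tin.
exists (Num.min dl 1); first by rewrite lt_min dl0/=.
move=> s s0; rewrite lt_min => /andP[sd s1].
have sin : [set` `[0, t + 1]] s.
  by rewrite /= in_itv/= s0/=; move: s1; rewrite ltr_norml; lra.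
by have := Hd s sin sd; rewrite /= ger0_norm ?normH_ge0.
Qed.

Lemma nm_strainB z w : calH l z -> calH l w -> nm (strain l z - strain l w) <= normH l (z - w).
Proof.
move=> Hz Hw; have Hzw := calHB Hz Hw.
have E := strain_lin (-1) Hw Hz; rewrite !scaleN1r in E.
have <- : nm (strain l (- w + z)) = nm (strain l z - strain l w).
  apply: ae_nm; first by apply: strain_meas; rewrite addrC.
    by apply: csq_meas; apply: csqB; exact: strain_csq.
  by move: E; apply: (@filterS _ _ (ae_filter_ringOfSetsType mu)) => x ->; rewrite addrC.
by rewrite (addrC (- w)); exact: normH_strain.
Qed.

Lemma speedB z w : speed l (z - w) = speed l z - speed l w.
Proof. by rewrite /speed -patchB. Qed.

Lemma ws_strain_cont chi t e : csq chi -> 0 <= t -> 0 < e -> exists2 dl : R, 0 < dl &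
  forall s, 0 <= s -> `|s - t| < dl ->
    `|ip (strain l (U s)) chi - ip (strain l (U t)) chi| <= e.
Proof.
move=> Kc t0 e0; have n0 := nm_ge0 chi; have n1 : 0 < nm chi + 1 by lra.
have e1 : 0 < e / (nm chi + 1) by rewrite divr_gt0.
have [dl dl0 H] := ws_cont t0 e1; exists dl => // s s0 sd.
have Hs := ws_calH s0; have Ht := ws_calH t0.
have Qs := (strain_csq Hs).1; have Qt := (strain_csq Ht).1.
rewrite -ipBl//; last exact: Kc.1.
apply: le_trans (cauchy_schwarz (sqintB Qs Qt) Kc.1) _.
have h1 := le_trans (nm_strainB Hs Ht) (H s s0 sd).
apply: (le_trans (ler_wpM2r n0 h1)).
by rewrite mulrAC ler_pdivrMr// ler_wpM2l ?ltW//; lra.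
Qed.

Lemma strain_ip_int chi T : csq chi -> 0 <= T ->
  itg ((fun r => ip (strain l (U r)) chi) \_ `]0, T[).
Proof.
move=> Kc T0.
have : mu.-integrable `[0, T] (EFin \o (fun r => ip (strain l (U r)) chi)).
  apply: continuous_compact_integrable; first exact: segment_compact.
  apply/subspace_continuousP => t; rewrite /= in_itv/= => /andP[t0 ts].
  apply/cvgrPdist_le => e e0; have [dl dl0 H] := ws_strain_cont Kc t0 e0.
  exists dl => //= r; rewrite /ball_/= distrC => rd; rewrite in_itv/= => /andP[r0 _].
  have := H r r0 rd; rewrite distrC; exact.
move=> I1; rewrite /itg -restrict_EFin; apply/integrable_restrict => //; rewrite setTI.
by apply: integrableS I1 => // x; exact: subset_itv_oo_cc.
Qed.

Lemma dotL2_cauchy f k : L2 0 l f -> L2 0 l k ->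
  `|dotL2 0 l f k| <= normL2 0 l f * nm (k \_ `]0, l[).
Proof. by move=> Lf Lg; rewrite dotL2E// normL2E//; exact: cauchy_schwarz. Qed.

(** The weak equation always starts from time 0; its instances at t + h and t are subtracted. *)
Lemma ws_increment T t (h : R) psi : L2 0 T g -> 0 <= t -> 0 <= h -> t + h <= T -> Hhalf l psi ->
  dotL2 0 l (U (t + h)).2 psi - dotL2 0 l (U t).2 psi =
  \int[mu]_(r in `[t, t + h]) (g r * psi x0) -
  \int[mu]_(r in `[t, t + h]) ip (strain l (U r)) (wderiv 0 l psi \_ `]0, l[).
Proof.
move=> Lg t0 h0 hT Hpsi; have [_ _ _ W] := HU.
have Kc : csq (wderiv 0 l psi \_ `]0, l[) := L2_csq (wderivP Hpsi.1).1.
have T0 : 0 <= T by lra.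
have E s : 0 <= s -> \int[mu]_(r in `[0, s]) dotL2 0 l (wderiv 0 l (U r).1) (wderiv 0 l psi) =
    \int[mu]_(r in `[0, s]) ip (strain l (U r)) (wderiv 0 l psi \_ `]0, l[).
  move=> s0; apply: eq_Rintegral => r; rewrite mem_setE in_itv/= => /andP[r0 _].
  by rewrite dotL2E//; [exact: (wderivP (ws_calH r0).1.1).1|exact: (wderivP Hpsi.1).1].
have I1 := strain_ip_int Kc T0.
have I2 : itg ((fun r => g r * psi x0) \_ `]0, T[).
  have -> : (fun r => g r * psi x0) \_ `]0, T[ = psi x0 *: (g \_ `]0, T[).
    by rewrite -patchZ; congr (_ \_ _); apply/funext => r; rewrite mulrC.
  by apply: itgZ; exact/csq_itg/L2_csq.
have th0 : 0 <= t + h by lra.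
have W1 := W _ _ th0 Hpsi; have W2 := W _ _ t0 Hpsi.
rewrite (E _ th0) in W1; rewrite (E _ t0) in W2.
rewrite -(int_increment I1 t0 h0 hT) -(int_increment I2 t0 h0 hT).
by move: W1 W2; lra.
Qed.

End WaveSolutionFacts.

(** * The rate of change of the product with a test wave *)

Section Pairing.
Context {R : realType}.
Notation mu := (@lebesgue_measure R).
Implicit Types (f p q : R -> R) (a b c d h x t s : R).
Variables (l x0 : R) (z0 : state R) (U : R -> state R) (g : R -> R).
Hypotheses (l0 : 0 < l) (x00 : 0 < x0) (x0l : x0 <= l).
Hypothesis HU : wave_solution l x0 z0 U g.
Variables (T k : R) (eps : R -> R).
Hypotheses (T0 : 0 <= T) (Lg : L2 0 T g) (K : csq eps).
Local Notation e := (affprim k eps).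
Hypothesis bc : forall s, 0 <= s <= T -> e (s + l) + e (s - l) = 0.

Let Le : lsq e := affprim_lsq k K.
Let Leps : lsq eps := sqint_lsq K.1.

(** A product rule. In time, u is differentiable only as an L^2 function and u_x need not be, so the
    increment of u_x is first integrated by parts onto the test wave; the increment of u_t comes
    from the weak equation. *)
Lemma pairing_step t h : 0 <= t -> 0 <= h -> t + h <= T ->
  dotH l (U (t + h)) (free l e (t + h)) - dotH l (U t) (free l e t) =
  dotH l (U (t + h)) (free l e (t + h) - free l e t)
  - dotL2 0 l ((U (t + h)).1 - (U t).1) (sm eps t)
  + (\int[mu]_(r in `[t, t + h]) (g r * sm e t x0)
  - \int[mu]_(r in `[t, t + h]) ip (strain l (U r)) (sp eps t \_ `]0, l[)).
Proof.
move=> t0 h0 hT; have th0 : 0 <= t + h by lra.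
have H1 := ws_calH HU t0; have H2 := ws_calH HU th0.
have F1 := free_calH l t Le; have F2 := free_calH l (t + h) Le.
have HD := calHB H2 H1.
rewrite dotHBr//.
have -> : dotH l (U (t + h)) (free l e (t + h)) - dotH l (U t) (free l e t) =
    dotH l (U (t + h)) (free l e (t + h)) - dotH l (U (t + h)) (free l e t) +
    dotH l (U (t + h) - U t) (free l e t).
  by rewrite dotHBl// addrA subrK.
rewrite -!addrA; congr (_ + (_ + _)).
have tT : 0 <= t <= T by rewrite t0/=; lra.
rewrite (dotH_free _ HD Le) (by_parts_free l0 HD K (bc tT)).
congr (_ + _).
have Ls : L2 0 l (sm e t) by exact: sm_lsq.
rewrite speedB ipBl; last 3 first.
- exact: (speed_csq H2).1.
- exact: (speed_csq H1).1.
- exact: Ls.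
have Hs := sm_Hhalf l0 k t K.
have := ws_increment HU Lg t0 h0 hT Hs.
rewrite (dotL2E H2.2 Ls) (dotL2E H1.2 Ls) -/(speed l (U (t + h))) -/(speed l (U t)) => ->.
congr (_ + (_ - _)); apply: eq_Rintegral => r; rewrite mem_setE in_itv/= => /andP[tr _].
have Hr := ws_calH HU (le_trans t0 tr).
have D := sm_deriv l0 k t K.
rewrite !(ipC (strain l (U r))); apply: ae_ip; last exact: wderiv_ae.
- exact: sqint_meas (wderivP Hs.1).1.
- exact: sqint_meas D.1.
- exact: strain_meas.
Qed.

Definition pairing_density : R -> R := (fun r => g r * sm e r x0) \_ `]0, T[.

Lemma sm_diff r t : `|sm e r x0 - sm e t x0| <= 2 * nm eps * Num.sqrt `|r - t|.
Proof.
have H (y z : R) : `|e y - e z| <= nm eps * Num.sqrt `|y - z|.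
  have -> : e y - e z = prim eps y - prim eps z by rewrite /affprim; ring.
  case: (leP y z) => yz.
    by rewrite distrC (distrC y) (ger0_norm (_ : 0 <= z - y)) ?subr_ge0//; exact: prim_diff_le.
  by rewrite (gtr0_norm (_ : 0 < y - z)) ?subr_gt0//; apply: prim_diff_le => //; exact: ltW.
have -> : sm e r x0 - sm e t x0 = (e (x0 + r) - e (x0 + t)) - (e (r - x0) - e (t - x0)).
  by rewrite -[LHS]/((e (x0 + r) - e (r - x0)) - (e (x0 + t) - e (t - x0))); ring.
apply: le_trans (ler_normB _ _) _.
have := H (x0 + r) (x0 + t); have := H (r - x0) (t - x0).
have -> : x0 + r - (x0 + t) = r - t by ring.
have -> : r - x0 - (t - x0) = r - t by ring.
lra.
Qed.

Lemma sm_time_continuous : continuous (fun r => sm e r x0).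
Proof.
have c1 := prim_continuous K.
have -> : (fun r => sm e r x0) = (fun r => k + prim eps (x0 + r) - (k + prim eps (r - x0))) by apply/funext.
move=> r; apply: cvgB; (apply: cvgD; first exact: cvg_cst).
  apply: (@cvg_comp _ _ _ (fun r0 => x0 + r0) (prim eps)); last exact: c1.
  by apply: cvgD; [exact: cvg_cst|exact: cvg_id].
apply: (@cvg_comp _ _ _ (fun r0 => r0 - x0) (prim eps)); last exact: c1.
by apply: cvgB; [exact: cvg_id|exact: cvg_cst].
Qed.

Lemma sm_time_bounded : exists M, forall r, 0 < r < T -> `|sm e r x0| <= M.
Proof.
exists (`|sm e 0 x0| + 2 * nm eps * Num.sqrt T) => r /andP[r0 rT].
have := sm_diff r 0; rewrite subr0 (gtr0_norm r0).
have := ler_normD (sm e 0 x0) (sm e r x0 - sm e 0 x0); rewrite subrKC => h1 h2.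
have := ler_wpM2l (nm_ge0 eps) (ler_wsqrtr (ltW rT)); lra.
Qed.

Lemma pairing_density_csq : csq pairing_density.
Proof.
have [M HM] := sm_time_bounded; have Kg := L2_csq Lg.
have E r : pairing_density r = (g \_ `]0, T[) r * sm e r x0.
  by rewrite /pairing_density !patchE; case: ifP; rewrite ?mul0r.
have [Qg [N gN]] := Kg.
split; last by exists N => r /gN gr; rewrite E gr mul0r.
apply: (@le_sqint _ _ (M *: (g \_ `]0, T[))).
- rewrite (_ : pairing_density = (g \_ `]0, T[) \* (fun r => sm e r x0)); last exact/funext.
  apply: measurable_funM; first exact: sqint_meas Qg.
  exact: (continuous_measurable_fun sm_time_continuous).
- exact: sqintZ.
- move=> r; rewrite E -[X in _ <= `|X|]/(M * (g \_ `]0, T[) r) !normrM mulrC patchE.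
  case: ifPn => [/set_mem|_]; last by rewrite normr0 !mulr0.
  rewrite /= in_itv/= => rT; apply: ler_wpM2r => //.
  by apply: le_trans (HM r rT) _; exact: ler_norm.
Qed.

(** The product minus the primitive of its expected derivative; it is shown to be continuous with
    right derivative 0. *)
Definition pairing_gap t : R := dotH l (U t) (free l e t) - prim pairing_density t.

(** The integral of the L^2 source g over [t,t+h] need not be O(h). But the test velocity varies by
    O(sqrt h) and Cauchy-Schwarz gives a second sqrt h; the remaining factor, the norm of g on
    [t,t+h], makes the error o(h). *)
Lemma load_increment t h : 0 <= t -> 0 <= h -> t + h <= T ->
  `|\int[mu]_(r in `[t, t + h]) (g r * sm e t x0)
    - (prim pairing_density (t + h) - prim pairing_density t)|
  <= h * (2 * nm eps * nm ((g \_ `]0, T[) \_ `[t, t + h])).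
Proof.
move=> t0 h0 hT; set G := g \_ `]0, T[.
have KG : csq G := L2_csq Lg.
have I1 : itg ((fun r => g r * sm e t x0) \_ `]0, T[).
  have -> : (fun r => g r * sm e t x0) \_ `]0, T[ = sm e t x0 *: G.
    by rewrite /G -patchZ; congr (_ \_ _); apply/funext => r; rewrite mulrC.
  by apply: itgZ; exact/csq_itg.
have I2 : itg pairing_density := csq_itg pairing_density_csq.
have tth : t <= t + h by lra.
have E1 := int_sub_itv I1 t0 tth hT; have E2 := int_itv tth I1; have E3 := int_itv tth I2.
have E4 : \int[mu]_(r in `[t, t + h]) (((fun r => g r * sm e t x0) \_ `]0, T[) r - pairing_density r) =
  \int[mu]_(r in `[t, t + h]) ((fun r => g r * sm e t x0) \_ `]0, T[) r -
  \int[mu]_(r in `[t, t + h]) pairing_density r.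
  apply: RintegralB => //; [exact: (integrableS _ _ (@subsetT _ _) I1)|exact: (integrableS _ _ (@subsetT _ _) I2)].
have -> : \int[mu]_(r in `[t, t + h]) (g r * sm e t x0) -
    (prim pairing_density (t + h) - prim pairing_density t) = 
  \int[mu]_(r in `[t, t + h]) (((fun r => g r * sm e t x0) \_ `]0, T[) r - pairing_density r).
  exact: (etrans (congr2 (fun x y : R => x - y) (etrans E1 (esym E2)) (esym E3)) (esym E4)).
have -> : (fun r => ((fun r0 => g r0 * sm e t x0) \_ `]0, T[) r - pairing_density r) = 
    G \* (fun r => sm e t x0 - sm e r x0).
  by apply/funext => r; rewrite /pairing_density /G /= !patchE; case: ifP; rewrite ?mul0r ?subr0// -mulrBr.
pose w : R -> R := (2 * nm eps * Num.sqrt h) *: (\1_`[t, t + h] : R -> R).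
have Qi := sqint_indic t (t + h).
have QG : sqint (G \_ `[t, t + h]) by apply: sqint_patch => //; exact: KG.1.
pose v : R -> R := (fun r => sm e t x0 - sm e r x0) \_ `[t, t + h].
have mv : measurable_fun setT v.
  apply/(measurable_restrictT _ _).1 => //.
  apply: (@measurable_funS _ _ _ _ setT) => //.
  apply: measurable_funB => //.
  exact: (continuous_measurable_fun sm_time_continuous).
have vw r : `|v r| <= `|w r|.
  rewrite /v /w -[X in _ <= `|X|]/(2 * nm eps * Num.sqrt h * \1_`[t, t + h] r) patchE indicE.
  case: ifPn => [/set_mem|_]; last by rewrite normr0.
  rewrite /= in_itv/= => /andP[tr rth]; rewrite mulr1 distrC.
  apply: le_trans (sm_diff _ _) (le_trans _ (ler_norm _)).
  rewrite ler_wpM2l// ?mulr_ge0 ?nm_ge0//; apply: ler_wsqrtr.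
  by rewrite ger0_norm ?subr_ge0// lerBlDl.
have Qw : sqint w by exact: sqintZ.
have Qv : sqint v := le_sqint mv Qw vw.
have -> : \int[mu]_(r in `[t, t + h]) (G \* (fun r => sm e t x0 - sm e r x0)) r = ip (G \_ `[t, t + h]) v.
  rewrite int_itv_patch /ip; apply: eq_Rintegral => r _; rewrite /v !patchE.
  by case: ifP => //=; rewrite mul0r.
apply: le_trans (cauchy_schwarz QG Qv) _.
have := le_nm mv Qw vw; rewrite nmZ// nm_indic//.
have -> : t + h - t = h by ring.
rewrite (ger0_norm (_ : 0 <= 2 * nm eps * Num.sqrt h)); last first.
  by rewrite !mulr_ge0 ?nm_ge0 ?sqrtr_ge0.
rewrite -(mulrA (2 * nm eps)) -expr2 sqr_sqrtr// => H.
apply: (le_trans (ler_wpM2l (nm_ge0 _) H)).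
by rewrite le_eqVlt; apply/orP; left; apply/eqP; ring.
Qed.

Lemma pairing_gap_continuous t d : 0 <= t <= T -> 0 < d -> exists2 dl : R, 0 < dl &
  forall s, 0 <= s <= T -> `|s - t| < dl -> `|pairing_gap s - pairing_gap t| <= d.
Proof.
move=> /andP[t0 tT] d0.
have Ht := ws_calH HU t0; have Ft := free_calH l t Le.
(* N majorises the sum of the coefficients of [d1] in the final estimate; [d1 <= 1] bounds the norm
   of U s by that of U t plus 1. *)
pose N := normH l (U t) + normH l (free l e t) + 2.
have n1 := normH_ge0 l (U t); have n2 := normH_ge0 l (free l e t).
have N0 : 0 < N by rewrite /N; lra.
pose d1 := Num.min 1 (d / N); have d10 : 0 < d1 by rewrite lt_min ltr01 divr_gt0.
have d1d : d1 * N <= d.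
  rewrite -ler_pdivlMr//; first by rewrite /d1 ge_min lexx orbT.
have d11 : d1 <= 1 by rewrite /d1 ge_min lexx.
have [a a0 Ha] := ws_cont HU t0 d10.
have [b b0 Hb] := free_cont l0 t d10 Le.
have /cvgrPdist_le/(_ _ d10)[c /= c0 Hc] := prim_continuous pairing_density_csq (x := t).
exists (Num.min a (Num.min b c)); first by rewrite !lt_min a0 b0.
move=> s /andP[s0 sT]; rewrite !lt_min => /and3P[sa sb sc].
have Hs := ws_calH HU s0; have Fs := free_calH l s Le.
have := Ha s s0 sa; have := Hb s sb; have := Hc s; rewrite /ball_/= (distrC t) => /(_ sc).
rewrite distrC => h3 h2 h1.
have -> : pairing_gap s - pairing_gap t = dotH l (U s - U t) (free l e t) +
    dotH l (U s) (free l e s - free l e t) - (prim pairing_density s - prim pairing_density t).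
  rewrite /pairing_gap dotHBl// dotHBr//.
  move: (dotH l (U s) (free l e s)) (dotH l (U s) (free l e t)) (dotH l (U t) (free l e t)).
  move: (prim pairing_density s) (prim pairing_density t) => u1 u2 u3 u4 u5; ring.
apply: le_trans (ler_normB _ _) _.
have h4 := dotH_cauchy (calHB Hs Ht) Ft.
have h5 := dotH_cauchy Hs (calHB Fs Ft).
have h6 : normH l (U s) <= normH l (U t) + 1.
  have := normHD (calHB Hs Ht) Ht; rewrite subrK; lra.
have n3 := normH_ge0 l (U s); have n4 := normH_ge0 l (free l e s - free l e t).
have h7 : normH l (U s - U t) * normH l (free l e t) <= d1 * normH l (free l e t) by exact: ler_wpM2r.
have h8 : normH l (U s) * normH l (free l e s - free l e t) <= (normH l (U t) + 1) * d1 by exact: ler_pM.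
have h9 := ler_normD (dotH l (U s - U t) (free l e t)) (dotH l (U s) (free l e s - free l e t)).
move: d1d; rewrite /N; lra.
Qed.

Lemma pairing_gap_derivative t d : 0 <= t < T -> 0 < d -> exists2 dl : R, 0 < dl &
  forall h, 0 < h -> h < dl -> `|pairing_gap (t + h) - pairing_gap t| <= h * d.
Proof.
move=> /andP[t0 tT] d0; have tT' : 0 <= t <= T by rewrite t0 ltW.
have Ht := ws_calH HU t0.
have Lp : csq (sp eps t \_ `]0, l[) by apply: L2_csq; exact: sp_lsq.
have Lm : L2 0 l (sm eps t) by exact: sm_lsq.
set nf := normH l (free l eps t); set np := nm (sm eps t \_ `]0, l[).
have nf0 : 0 <= nf := normH_ge0 _ _; have np0 : 0 <= np := nm_ge0 _.
have nu0 : 0 <= normH l (U t) := normH_ge0 _ _; have ne0 := nm_ge0 eps.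
pose N := normH l (U t) + 1 + nf + np + 1 + 2 * nm eps.
have N0 : 0 < N by rewrite /N; lra.
pose d1 := Num.min 1 (d / N); have d10 : 0 < d1 by rewrite lt_min ltr01 divr_gt0.
have d1d : d1 * N <= d by rewrite -ler_pdivlMr// /d1 ge_min lexx orbT.
have d11 : d1 <= 1 by rewrite /d1 ge_min lexx.
have [a a0 Ha] := ws_cont HU t0 d10.
have [b b0 Hb] := free_generator l0 k d10 K.
have [c c0 Hc] := nm_patch_small d10 (L2_csq Lg).1.
have [_ _ /(_ t t0)/cvgr0Pnorm_le/(_ _ d10)[v /= v0 Hv] _] := HU.
have [w w0 Hw] := ws_strain_cont HU Lp t0 d10.
have Tt : 0 < T - t by lra.
exists (Num.min a (Num.min b (Num.min c (Num.min v (Num.min w (T - t)))))); first by rewrite !lt_min a0 b0 c0 v0 w0.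
move=> h h0; rewrite !lt_min => /and5P[ha hb hc hv /andP[hw hT]].
have hT' : t + h <= T by lra.
have h00 := ltW h0; have hn0 : h != 0 by rewrite gt_eqF.
have th0 : 0 <= t + h by lra.
have nh : `|t + h - t| = h by rewrite addrAC subrr add0r gtr0_norm.
have H2 := ws_calH HU th0.
have F1 := free_calH l t Le; have F2 := free_calH l (t + h) Le; have Fe := free_calH l t Leps.
have := Ha (t + h) th0; rewrite nh => /(_ ha) h1.
have := Hb h t hn0; rewrite (gtr0_norm h0) => /(_ hb) h2.
have := Hc t (t + h); rewrite lerDl => /(_ h00) h3.
have {h3} h3 : nm ((g \_ `]0, T[) \_ `[t, t + h]) <= d1 by apply: h3; lra.
have h4 : normL2 0 l (h^-1 *: ((U (t + h)).1 - (U t).1) - (U t).2) <= d1.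
  have := Hv (t + h); rewrite /ball_/= distrC nh (_ : t + h - t = h); last by ring.
  rewrite ger0_norm ?sqrtr_ge0//; apply=> //; first by rewrite -subr_eq0 addrAC subrr add0r.
  by rewrite in_itv/= th0.
have h5 r : t <= r <= t + h -> `|ip (strain l (U r)) (sp eps t \_ `]0, l[)
    - ip (strain l (U t)) (sp eps t \_ `]0, l[)| <= d1.
  move=> /andP[tr rh]; apply: Hw; first exact: le_trans tr.
  by rewrite ger0_norm ?subr_ge0// ltrBlDl (le_lt_trans rh)// ltrD2l.
have h6 : `|\int[mu]_(r in `[t, t + h]) ip (strain l (U r)) (sp eps t \_ `]0, l[) -
    h * ip (strain l (U t)) (sp eps t \_ `]0, l[)| <= h * d1.
  have tth : t < t + h by lra.
  have := int_close (strain_ip_int HU Lp T0) t0 tth hT' h5.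
  by rewrite (_ : t + h - t = h); last by ring.
have h7 := load_increment t0 h00 hT'.
have h8 : `|dotH l (U (t + h)) (free l e (t + h) - free l e t) - h * dotH l (U t) (free l eps t)| <=
    h * (d1 * (normH l (U t) + 1 + nf)).
  have HF := calHB F2 F1; have HF' := calHZ h^-1 HF.
  have E : dotH l (U (t + h)) (free l e (t + h) - free l e t) =
      h * dotH l (U (t + h)) (h^-1 *: (free l e (t + h) - free l e t)).
    by rewrite (dotHC _ _ (_ *: _)) dotHZl// dotHC mulrA mulfV// mul1r.
  rewrite E -mulrBr normrM (gtr0_norm h0) ler_pM2l//.
  set q := h^-1 *: _ in h2 HF' *.
  have -> : dotH l (U (t + h)) q - dotH l (U t) (free l eps t) =
      dotH l (U (t + h)) (q - free l eps t) + dotH l (U (t + h) - U t) (free l eps t).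
    by rewrite dotHBr// dotHBl// addrA subrK.
  have HD := calHB H2 Ht; have HQ := calHB HF' Fe.
  have g1 := dotH_cauchy H2 HQ; have g2 := dotH_cauchy HD Fe.
  have g3 : normH l (U (t + h)) <= normH l (U t) + 1.
    have := normHD HD Ht; rewrite subrK => H; apply: le_trans H _.
    by rewrite addrC lerD2l (le_trans h1).
  have g4 : normH l (U (t + h)) * normH l (q - free l eps t) <= (normH l (U t) + 1) * d1.
    by apply: ler_pM => //; exact: normH_ge0.
  have g5 : normH l (U (t + h) - U t) * normH l (free l eps t) <= d1 * nf by exact: ler_wpM2r.
  apply: le_trans (ler_normD _ _) (le_trans (lerD (le_trans g1 g4) (le_trans g2 g5)) _).
  by rewrite mulrDr mulrC.
have h9 : `|dotL2 0 l ((U (t + h)).1 - (U t).1) (sm eps t) - h * dotL2 0 l (U t).2 (sm eps t)| <= h * (d1 * np).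
  have L1 : L2 0 l ((U (t + h)).1 - (U t).1).
    have [[[k1 W1] _] _] := H2; have [[[k2 W2] _] _] := Ht.
    exact: (weak_deriv_L2 (weak_derivB W1 W2)).
  have L3 : L2 0 l (h^-1 *: ((U (t + h)).1 - (U t).1)) by exact: L2Z.
  have L4 : L2 0 l (h^-1 *: ((U (t + h)).1 - (U t).1) - (U t).2).
    by rewrite -(scaleN1r (U t).2); apply: L2D => //; apply: L2Z; exact: Ht.2.
  set D := (U (t + h)).1 - (U t).1 in L1 L3 L4 h4 *.
  have -> : dotL2 0 l D (sm eps t) - h * dotL2 0 l (U t).2 (sm eps t) =
      h * dotL2 0 l (h^-1 *: D - (U t).2) (sm eps t).
    rewrite (dotL2E L1 Lm) (dotL2E Ht.2 Lm) (dotL2E L4 Lm) (patchB (h^-1 *: D)) (patchZ h^-1 D).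
    rewrite ipBl ?ipZl; try exact: L1; try exact: Lm; try exact: Ht.2; last by apply: sqintZ; exact: L1.
    by rewrite mulrBr mulrA mulfV// mul1r.
  rewrite normrM (gtr0_norm h0) ler_pM2l//.
  by apply: le_trans (dotL2_cauchy L4 Lm) _; exact: ler_wpM2r.
have E0 : dotH l (U t) (free l eps t) = ip (strain l (U t)) (sp eps t \_ `]0, l[) + dotL2 0 l (U t).2 (sm eps t).
  by rewrite dotH_free// (dotL2E Ht.2 Lm).
have S := pairing_step t0 h00 hT'.
rewrite /pairing_gap.
have g7 : h * (2 * nm eps * nm ((g \_ `]0, T[) \_ `[t, t + h])) <= h * (2 * nm eps * d1).
  by rewrite ler_pM2l// ler_wpM2l// mulr_ge0.
apply: (@le_trans _ _ (h * (d1 * N))); last by rewrite ler_pM2l.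
move: S h6 h7 h8 h9 E0 g7 (ltW h0).
move: (dotH l (U (t + h)) (free l e (t + h))) (dotH l (U t) (free l e t)) => A1 A2.
move: (dotH l (U (t + h)) (free l e (t + h) - free l e t)) (dotH l (U t) (free l eps t)) => A3 A4.
move: (dotL2 0 l ((U (t + h)).1 - (U t).1) (sm eps t)) (dotL2 0 l (U t).2 (sm eps t)) => A5 A6.
move: (\int[mu]_(r in `[t, t + h]) (g r * sm e t x0)) => A7.
move: (\int[mu]_(r in `[t, t + h]) ip (strain l (U r)) (sp eps t \_ `]0, l[)) => A8.
move: (ip (strain l (U t)) (sp eps t \_ `]0, l[)) (prim pairing_density (t + h)) (prim pairing_density t) => A9 P1 P2.
move: (nm ((g \_ `]0, T[) \_ `[t, t + h])) => A10.
move=> S h6 h7 h8 h9 E0 g7 _.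
(* By [E0] the first-order terms cancel, which is the skew-adjointness of calA; four errors remain,
   each at most h times a multiple of [d1]. *)
have -> : A1 - P1 - (A2 - P2) = (A3 - h * A4) - (A5 - h * A6) + (A7 - (P1 - P2)) - (A8 - h * A9).
  by rewrite E0; move: S => /eqP; rewrite subr_eq => /eqP ->; ring.
have -> : h * (d1 * N) = h * (d1 * (normH l (U t) + 1 + nf)) + h * (d1 * np) + h * (2 * nm eps * d1) + h * d1.
  by rewrite /N; ring.
have := ler_normB (A3 - h * A4 - (A5 - h * A6) + (A7 - (P1 - P2))) (A8 - h * A9).
have := ler_normD (A3 - h * A4 - (A5 - h * A6)) (A7 - (P1 - P2)).
have := ler_normB (A3 - h * A4) (A5 - h * A6).
lra.
Qed.

Theorem pairing : dotH l (U T) (free l e T) - dotH l (U 0) (free l e 0) =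
  \int[mu]_(r in `[0, T]) (g r * sm e r x0).
Proof.
have := right_derivative0 T0 (fun t tT d => @pairing_gap_continuous t d tT)
  (fun t tT d => @pairing_gap_derivative t d tT).
rewrite /pairing_gap => /eqP; rewrite subr_eq => /eqP ->.
have I := csq_itg pairing_density_csq.
have OT : 0 <= T <= T by rewrite T0/=.
rewrite (int_sub_itv I (lexx 0) T0 (lexx T)) -/pairing_density.
by move: (dotH l (U 0) (free l e 0)) => A; ring.
Qed.

End Pairing.

(** * Continuation of profiles *)

Section DelayFixpoint.
Context {R : realType}.
Implicit Types (l y z : R).

(** F looks back by at least l, so its iterates are stationary below y0 + n l after n + 1 steps,
    from whatever they start. No topology on V is involved. *)
Lemma delay_fixpoint (V : Type) (v0 : V) l y0 (F : (R -> V) -> R -> V) : 0 < l ->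
  (forall f f' y, (forall z, z <= y - l -> f z = f' z) -> F f y = F f' y) ->
  (forall f f' y, y < y0 -> F f y = F f' y) ->
  exists q, forall y, q y = F q y.
Proof.
move=> l0 causal base.
have stable n : forall m m' y, y < y0 + n%:R * l -> (n < m)%N -> (n < m')%N ->
    iter m F (fun=> v0) y = iter m' F (fun=> v0) y.
  elim: n => [|n IH] [|m] [|m'] // y; first by rewrite mul0r addr0 => yy _ _; exact: base.
  move=> yn nm nm'; rewrite /= ; apply: causal => z zy; apply: IH => //.
  by move: yn; rewrite -natr1 mulrDl mul1r; lra.
(* A number of delays that is enough to pass y, and so a number of iterations after which the value
   at y is final. *)
pose N y := (Num.truncn ((y - y0) / l)).+1.
have HN y : y < y0 + (N y)%:R * l.
  have [yy|yy] := ltP y y0.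
    by apply: lt_le_trans yy _; rewrite lerDl mulr_ge0// ltW.
  rewrite -ltrBlDl -ltr_pdivrMr//.
  by have := truncnS_gt ((y - y0) / l).
exists (fun y => iter (N y).+1 F (fun=> v0) y) => y; rewrite /=; apply: causal => z zy.
set n := Num.truncn ((y - y0) / l).
have := HN y; rewrite /N -/n -natr1 mulrDl mul1r => yn.
apply: (stable (minn n (N z)) n.+1 (N z).+1).
- by have := HN z; rewrite /minn; case: ifP => _ //; lra.
- by rewrite ltnS geq_minl.
- by rewrite ltnS geq_minr.
Qed.

End DelayFixpoint.

Section HalfLine.
Context {R : realType}.
Notation mu := (@lebesgue_measure R).
Implicit Types (f g p q : R -> R) (a b c d h x t s : R).

(** The class in which recursions with delay are solved: zero far in the past, square integrable up
    to each time, of any growth in the future. *)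
Definition hsq f : Prop := forall b, csq (f \_ `]-oo, b]).

Lemma hsq_lsq f : hsq f -> lsq f.
Proof.
move=> Hf a b; have := (sqint_patch (measurable_itv `]a, b[) (Hf b).1).
rewrite /L2 (_ : (f \_ `]-oo, b]) \_ `]a, b[ = f \_ `]a, b[)//.
by apply/funext => x; rewrite !patchE; itv_tac.
Qed.

Lemma delay_induction (P : R -> Prop) b0 l : 0 < l -> P b0 ->
  (forall b, P b -> P (b + l)) -> (forall b c, c <= b -> P b -> P c) -> forall b, P b.
Proof.
move=> l0 P0 PS Pm b; pose n := (Num.truncn ((b - b0) / l)).+1.
apply: (Pm (b0 + n%:R * l)).
  rewrite -lerBlDl -ler_pdivrMr//; apply: ltW; exact: truncnS_gt.
elim: {b}n => [|n IH]; first by rewrite mul0r addr0.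
by rewrite -natr1 mulrDl mul1r addrA; exact: PS.
Qed.

(** The method of steps: control up to b gives control up to b + l. *)
Lemma hsq_delay f F b0 l : 0 < l -> csq (f \_ `]-oo, b0]) ->
  (forall b, csq (f \_ `]-oo, b]) -> csq (F b)) ->
  (forall b x, x <= b + l -> f x = F b x) -> hsq f.
Proof.
move=> l0 K0 KF E; apply: (delay_induction (P := fun b => csq (f \_ `]-oo, b])) l0 K0).
  move=> b Kb; have -> : f \_ `]-oo, b + l] = F b \_ `]-oo, b + l].
    by apply/funext => x; rewrite !patchE mem_setE in_itv/=; case: ifP => // xb; exact: E.
  by apply: csq_patch => //; exact: KF.
move=> b c cb Kb; have -> : f \_ `]-oo, c] = (f \_ `]-oo, b]) \_ `]-oo, c].
  by apply/funext => x; rewrite !patchE; itv_tac.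
exact: csq_patch.
Qed.

(** The d'Alembert form already contains the condition at 0, and the state at time 0 fixes q on
    ]-l,l[. The condition at l is then a reflection factor rho per time 2 l and determines the later
    values. *)
Lemma profile_continuation l rho q0 : 0 < l -> csq q0 -> exists q,
  [/\ hsq q, forall y, - l < y < l -> q y = q0 y, forall y, y <= - l -> q y = 0
    & forall y, - l < y -> q (y + (l + l)) = rho * q y].
Proof.
move=> l0 K0; pose F f y := if y < l then (q0 \_ `]- l, l[) y else rho * f (y - (l + l)).
have [q Eq] : exists q : R -> R, forall y, q y = F q y.
  apply: (@delay_fixpoint R R 0 l l F) => // [f f' y ff'|f f' y yl]; rewrite /F; last by rewrite yl.
  by case: ifP => // _; rewrite ff'//; lra.
exists q; split.
- pose G b := q0 \_ `]- l, l[ + rho *: (transl (q \_ `]-oo, b]) (- (l + l)) \_ `[l, +oo[).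
  apply: (@hsq_delay q G (- l) l) => //.
  + have -> : q \_ `]-oo, - l] = 0; last exact: csq0.
    apply/funext => x; rewrite patchE mem_setE in_itv/=; case: ifP => // xl.
    have xl' : x < l by lra.
    by rewrite Eq /F xl' patchE; itv_tac.
  + move=> b Kb; apply: csqD; first exact: csq_patch.
    by apply: csqZ; apply: csq_patch => //; exact: csq_transl.
  + move=> b x xb; rewrite Eq /F -[RHS]/((q0 \_ `]- l, l[) x + rho * (transl (q \_ `]-oo, b]) (- (l + l)) \_ `[l, +oo[) x).
    rewrite !patchE /transl !mem_setE !in_itv/= andbT patchE mem_setE in_itv/=.
    case: ltP => xl; first by rewrite mulr0 addr0.
    by rewrite andbF add0r; case: ifPn => // H; exfalso; lra.
- move=> y yl; have /andP[_ yl'] := yl.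
  by rewrite Eq /F yl' patchE mem_setE in_itv/= yl.
- move=> y yl; have yl' : y < l by lra.
  by rewrite Eq /F yl' patchE; itv_tac.
- move=> y yl; rewrite Eq /F ifF ?addrK//.
  by apply/negP => H; lra.
Qed.

Lemma affprim_transl k (eps : R -> R) d : csq eps -> transl (affprim k eps) d = affprim k (transl eps d).
Proof.
move=> K; apply/funext => x; rewrite /transl/affprim; congr (_ + _).
by rewrite prim_shift//; exact: csq_itg.
Qed.

Lemma int_transl_scale q rho a b d : csq q -> a <= b ->
  (forall y, a < y < b -> q (y + d) = rho * q y) ->
  prim q (b + d) - prim q (a + d) = rho * (prim q b - prim q a).
Proof.
move=> K ab H; have I := csq_itg K; have It := csq_itg (csq_transl d K).
rewrite -(int_itv ab I).
have -> : prim q (b + d) - prim q (a + d) = \int[mu]_(y in `[a, b]) transl q d y.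
  by rewrite int_itv// /transl !prim_shift.
rewrite -RintegralZl//; last exact: integrableS I.
apply: int_ae_oo => //; exact: itgZ.
Qed.
End HalfLine.

(** * From states to profiles: density and uniqueness *)

Section Profiles.
Context {R : realType}.
Notation mu := (@lebesgue_measure R).
Implicit Types (f g p q : R -> R) (a b c d h x t s : R) (z w : state R).
Variable l : R.
Hypothesis l0 : 0 < l.

Lemma average_profile q rho M d : hsq q -> (forall y, - l < y -> q (y + (l + l)) = rho * q y) ->
  0 <= M -> 0 < d -> exists eps, [/\ csq eps,
    forall s, 0 <= s <= M -> affprim 0 eps (s + l) = rho * affprim 0 eps (s - l)
    & forall s, 0 <= s <= M -> normH l (free l (affprim 0 eps) s - free l q s) <= d].
Proof.
(* Arguments up to M + l are needed, and up to 1 more for the mean over a length h <= 1. *)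
move=> Hq rec M0 d0; have l0' := l0; pose qc := q \_ `]-oo, M + l + 1].
have K : csq qc by exact: Hq.
have d40 : 0 < d / 4 by rewrite divr_gt0.
have [dl dl0 H] := diff_quotient d40 K.
pose h := Num.min (dl / 2) 1.
have h0 : 0 < h by rewrite lt_min ltr01 andbT divr_gt0.
have h1 : h <= 1 by rewrite ge_min lexx orbT.
have hdl : `|h| < dl.
  rewrite gtr0_norm//; apply: (@le_lt_trans _ _ (dl / 2)); first by rewrite ge_min lexx.
  by rewrite ltr_pdivrMr//; lra.
have hn0 : h != 0 by rewrite gt_eqF.
have [/=] := H h hn0 hdl; set A := (fun x => _ : R) => QA nA.
(* The derivative of the mean. *)
pose eps := h^-1 *: (transl qc h - qc).
have Ke : csq eps by apply: csqZ; apply: csqB => //; exact: csq_transl.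
have EA : affprim 0 eps = A.
  apply/funext => x; rewrite /affprim add0r /eps primZ; last first.
    by apply: itgB; [exact/csq_itg/csq_transl|exact: csq_itg].
  rewrite primB; [|exact/csq_itg/csq_transl|exact: csq_itg].
  by rewrite /transl prim_shift//; exact: csq_itg.
exists eps; rewrite EA; split=> // s /andP[s0 sM].
  rewrite /A mulrCA; congr (_ * _).
  have E := @int_transl_scale _ qc rho (s - l) (s - l + h) (l + l) K.
  have sl : s - l + (l + l) = s + l by ring.
  have sh : s - l + h + (l + l) = s + l + h by ring.
  rewrite sl sh in E; apply: E; first by lra.
  move=> y /andP[y1 y2]; rewrite /qc !patchE !mem_setE !in_itv/=.
  by do 2!(case: ifPn => [_|Hn]; last by exfalso; lra); apply: rec; lra.
have -> : free l q s = free l qc s.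
  apply: free_local => // y /andP[y1 y2]; rewrite /qc patchE mem_setE in_itv/=.
  by case: ifPn => // Hn; exfalso; lra.
have LA : lsq A by rewrite -EA; exact: affprim_lsq.
rewrite -freeB//; last exact/sqint_lsq/K.1.
by apply: le_trans (normH_free _ _ QA) _; move: nA; lra.
Qed.

Lemma antiperiodic_iter f (B : R) : (forall y, - l < y < B -> f (y + (l + l)) = - f y) ->
  forall (n : nat) y, - l < y -> y + n%:R * (4 * l) < B + 2 * l -> f (y + n%:R * (4 * l)) = f y.
Proof.
move=> H; have l0' := l0; elim=> [|n IH] y yl yB; first by rewrite mul0r addr0.
have n0 : 0 <= n%:R * l by rewrite mulr_ge0// ltW.
move: yB; rewrite -natr1 => yB.
have -> : y + (n%:R + 1) * (4 * l) = y + n%:R * (4 * l) + (l + l) + (l + l) by ring.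
rewrite !H ?opprK; first by apply: IH => //; lra.
  by apply/andP; split; lra.
by apply/andP; split; lra.
Qed.

(** Inversion of d'Alembert's form at time 0: (u_x + u_t) / 2 at x > 0 and (u_x - u_t) / 2 at -
    x. *)
Definition profile z : R -> R :=
  2^-1 *: (strain l z + speed l z + (refl (strain l z) 0 - refl (speed l z) 0)).

Lemma profile_csq z : calH l z -> csq (profile z).
Proof.
move=> Hz; have K1 := strain_csq Hz; have K2 := speed_csq Hz.
by apply: csqZ; apply: csqD; [exact: csqD|apply: csqB; exact: csq_refl].
Qed.

Lemma profileE z x : 0 < x < l ->
  profile z x = 2^-1 * (strain l z x + speed l z x) /\
  profile z (- x) = 2^-1 * (strain l z x - speed l z x).
Proof.
move=> /andP[x0 xl]; have E (y : R) : profile z y =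
  2^-1 * (strain l z y + speed l z y + (strain l z (0 - y) - speed l z (0 - y))) by [].
have S0 (f : R -> R) : (f \_ `]0, l[) (- x) = 0 by rewrite patchE; itv_tac.
by rewrite !E !sub0r opprK ![strain l z (- x)]S0 ![speed l z (- x)]S0 subrr addr0 add0r add0r.
Qed.

Lemma free_profile z q : calH l z -> (forall y, - l < y < l -> q y = profile z y) -> eqH l z (free l q 0).
Proof.
move=> Hz E; apply: eqH_trans (eqH_mk Hz) _.
rewrite (_ : free l q 0 = mk (strain l z) (speed l z)); first exact: eqH_refl.
have l0' := l0; rewrite /free; congr mk; apply/funext => x; rewrite patchE mem_setE in_itv/=.
- case: ifPn => xl; last by rewrite /strain patchE mem_setE in_itv/= (negbTE xl).
  have [E1 E2] := profileE z xl.
  rewrite -[LHS]/(q (x + 0) + q (0 - x)) addr0 sub0r !E ?E1 ?E2; try by apply/andP; split; lra.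
  by field.
- case: ifPn => xl; last by rewrite /speed patchE mem_setE in_itv/= (negbTE xl).
  have [E1 E2] := profileE z xl.
  rewrite -[LHS]/(q (x + 0) - q (0 - x)) addr0 sub0r !E ?E1 ?E2; try by apply/andP; split; lra.
  by field.
Qed.

Lemma exists_period T : exists n : nat, T <= n%:R * (4 * l).
Proof.
exists (Num.truncn (T / (4 * l))).+1; rewrite -ler_pdivrMr ?mulr_gt0//.
by apply: ltW; exact: truncnS_gt.
Qed.

(* Test states running backwards from z: they are dense among the final states. *)
Lemma test_state_density z T d : calH l z -> 0 <= T -> 0 < d -> exists eps, [/\ csq eps,
  forall s, 0 <= s <= T -> affprim 0 eps (s + l) + affprim 0 eps (s - l) = 0
  & normH l (free l (affprim 0 eps) T - z) <= d].
Proof.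
move=> Hz T0 d0; have l0' := l0.
have [q [Hq qE _ rec]] := profile_continuation (-1) l0 (profile_csq Hz).
(* Continuation goes forwards, but with rho = -1 it has period 4 l: the wave starting from z is
   again at z at a time P >= T. Delaying it by P - T puts z at time T with the whole of [0,T] before
   it. *)
have [n Tn] := exists_period T; pose P := n%:R * (4 * l).
have P0 : 0 <= P by apply: le_trans Tn.
have [eps [K bc H]] := average_profile Hq rec P0 d0.
exists (transl eps (P - T)); rewrite -affprim_transl//; split; first exact: csq_transl.
  move=> s /andP[s0 sT].
  have -> : transl (affprim 0 eps) (P - T) (s + l) = affprim 0 eps (s + (P - T) + l).
    by rewrite /transl; congr affprim; ring.
  have -> : transl (affprim 0 eps) (P - T) (s - l) = affprim 0 eps (s + (P - T) - l).
    by rewrite /transl; congr affprim; ring.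
  by rewrite bc ?mulN1r ?addNr//; apply/andP; split; rewrite -/P in Tn; lra.
have -> : free l (transl (affprim 0 eps) (P - T)) T = free l (affprim 0 eps) P.
  rewrite (free_transl l0 (affprim 0 eps) (P - T) T); congr (free _ _ _); ring.
have Lq := hsq_lsq Hq; have Le := affprim_lsq 0 K.
have E : eqH l z (free l q P).
  have -> : free l q P = free l q 0; last exact: free_profile.
  apply: free_local => // y /andP[y1 y2]; rewrite addr0.
  apply: (@antiperiodic_iter q (P + l)) => //; last by rewrite -/P; lra.
  by move=> u /andP[u1 _]; rewrite rec// mulN1r.
have F1 := free_calH l P Lq; have F2 := free_calH l P Le.
rewrite normH_sym// (eqH_normH_l (ltW l0) Hz F1 F2 E) normH_sym//.
by apply: H; rewrite P0 lexx.
Qed.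

Lemma wave_solution_unique x0 z0 U V g : 0 < x0 -> x0 <= l ->
  (forall T, 0 <= T -> L2 0 T g) -> wave_solution l x0 z0 U g -> wave_solution l x0 z0 V g ->
  forall t, 0 <= t -> eqH l (U t) (V t).
Proof.
move=> x00 x0l Lg HU HV t t0; have Ht := ws_calH HU t0; have Ht' := ws_calH HV t0.
have H0 := ws_calH HU (lexx 0); have H0' := ws_calH HV (lexx 0).
have HD := calHB Ht Ht'; apply: normHB_eqH => //.
have n0 := normH_ge0 l (U t - V t).
have E0 : eqH l (U 0) (V 0) by have [_ e1 _ _] := HU; have [_ e2 _ _] := HV; apply: eqH_trans e1 (eqH_sym e2).
apply/eqP; rewrite eq_le n0 andbT; apply/ler_addgt0Pl => d d0; rewrite addr0.
have [eps [K bc H]] := test_state_density HD t0 d0.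
have Le := affprim_lsq 0 K; have Ft := free_calH l t Le; have F0 := free_calH l 0 Le.
have P1 := pairing l0 HU t0 (Lg t t0) K bc.
have P2 := pairing l0 HV t0 (Lg t t0) K bc.
have Z : dotH l (U t - V t) (free l (affprim 0 eps) t) = 0.
  rewrite dotHBl//; move: P1; rewrite -P2 (eqH_dotH (ltW l0) H0 H0' F0 E0) => /eqP.
  by rewrite (inj_eq (addIr _)) => /eqP ->; rewrite subrr.
(* The difference is orthogonal to the test state, which is within d of the difference itself. *)
have S : normH l (U t - V t) ^+ 2 <= normH l (U t - V t) * d.
  rewrite normH_sqr.
  have -> : dotH l (U t - V t) (U t - V t) = - dotH l (U t - V t) (free l (affprim 0 eps) t - (U t - V t)).
    by rewrite (dotHBr Ft HD HD) Z sub0r opprK.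
  apply: le_trans (ler_norm _) _; rewrite normrN.
  apply: le_trans (dotH_cauchy HD (calHB Ft HD)) _; exact: ler_wpM2l.
have [->|nn] := eqVneq (normH l (U t - V t)) 0; first exact: ltW.
by move: S; rewrite expr2 ler_pM2l// lt_neqAle eq_sym nn.
Qed.

Lemma prim_refl f b : L2 0 l f -> - l <= b -> 
  prim (refl (f \_ `]0, l[) 0) b = prim (f \_ `]0, l[) l - prim (f \_ `]0, l[) (- b).
Proof.
move=> Lf lb; have K := L2_csq Lf; have I := csq_itg K.
have Z : prim (refl (f \_ `]0, l[) 0) (- l) = 0.
  rewrite primE (_ : _ \_ _ = cst 0) ?Rintegral_cst ?mul0r//.
  by apply/funext => x; rewrite /refl !patchE; itv_tac.
have Ir : itg (refl (f \_ `]0, l[) 0) by exact/csq_itg/csq_refl.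
have := int_itv lb Ir; rewrite Z subr0 => <-.
by rewrite /refl int_reflect// !sub0r opprK.
Qed.

Lemma prim_supp f b : L2 0 l f -> b <= 0 -> prim (f \_ `]0, l[) b = 0.
Proof.
move=> Lf lb; rewrite primE (_ : _ \_ _ = cst 0) ?Rintegral_cst ?mul0r//.
by apply/funext => x; rewrite !patchE; itv_tac.
Qed.

Lemma domA_profile phi T : domA l phi -> 0 <= T -> exists k eps, [/\ csq eps,
  forall s, 0 <= s <= T -> affprim k eps (s + l) + affprim k eps (s - l) = 0
  & eqH l phi (free l (affprim k eps) T)].
Proof.
move=> [[kap [[Dk [kap' Dk']] u0 kl]] [[v' Dv] v0]] T0; have l0' := l0.
have Lk := Dk'.1; have Lv := Dv.1; have Kk := L2_csq Lk; have Kv := L2_csq Lv.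
pose k1 := kap' \_ `]0, l[; pose v1 := v' \_ `]0, l[.
(* The derivative of the profile: (u_xx + u_tx) / 2 at x > 0 and, by the chain rule, (u_tx - u_xx) /
   2 at - x. *)
pose eps0 : R -> R := 2^-1 *: (k1 + v1 + (refl v1 0 - refl k1 0)).
have K0 : csq eps0.
  by apply: csqZ; apply: csqD; [exact: csqD|apply: csqB; exact: csq_refl].
have [q [Hq qE q0 rec]] := profile_continuation (-1) l0 K0.
have [n Tn] := exists_period T; pose P := n%:R * (4 * l).
have P0 : 0 <= P by apply: le_trans Tn.
pose eps := q \_ `]-oo, P + l]; have K : csq eps by exact: Hq.
(* The value of the profile at - l, where [prim eps] vanishes: (u_x - u_t) / 2 at l, with u_x(l) =
   0. *)
pose k := - (2^-1 * phi.2 l); pose e := affprim k eps.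
have ol : 0 <= l <= l by rewrite ltW//=.
have Lq : - l < l by lra.
have epsl : prim eps (- l) = 0.
  rewrite primE (_ : _ \_ _ = cst 0) ?Rintegral_cst ?mul0r//.
  apply/funext => x; rewrite !patchE mem_setE in_itv/=; case: ifPn => // xl.
  by rewrite /eps patchE q0//; case: ifP.
have pE b : - l <= b <= l -> prim eps b = 2^-1 * (prim k1 b + prim v1 b +
    (prim v1 l - prim v1 (- b) - (prim k1 l - prim k1 (- b)))).
  move=> /andP[b1 b2]; have Ie := csq_itg K; have I0 := csq_itg K0.
  have E0l : prim eps0 (- l) = 0.
    rewrite primE (_ : _ \_ _ = cst 0) ?Rintegral_cst ?mul0r//.
    apply/funext => x; rewrite patchE mem_setE in_itv/=; case: ifPn => // xl.
    rewrite -[LHS]/(2^-1 * (k1 x + v1 x + (v1 (0 - x) - k1 (0 - x)))) /k1 /v1 !patchE.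
    have -> : (x \in `]0, l[%classic) = false by rewrite mem_setE in_itv/=; apply/negP => ?; lra.
    have -> : (0 - x \in `]0, l[%classic) = false by rewrite mem_setE in_itv/=; apply/negP => ?; lra.
    by rewrite -[LHS]/(2^-1 * (0 + 0 + (0 - 0))) subrr !addr0 mulr0.
  have -> : prim eps b = prim eps0 b.
    have := int_itv b1 Ie; rewrite epsl subr0 => <-.
    have := int_itv b1 I0; rewrite E0l subr0 => <-.
    apply: int_ae_oo => // x /andP[x1 x2]; rewrite /eps patchE mem_setE in_itv/= qE.
      by case: ifPn => // Hn; exfalso; lra.
    by apply/andP; split; lra.
  have i1 := csq_itg Kk; have i2 := csq_itg Kv.
  have i3 := csq_itg (csq_refl 0 Kk); have i4 := csq_itg (csq_refl 0 Kv).
  rewrite /eps0 primZ; last by apply: itgD; [exact: itgD|exact: itgB].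
  rewrite primD; [|exact: itgD|exact: itgB].
  by rewrite (primD _ i1 i2) (primB _ i4 i3) !prim_refl.
have val x : 0 <= x <= l -> [/\ prim k1 x = kap x - kap 0, prim v1 x = phi.2 x,
    prim k1 (- x) = 0 & prim v1 (- x) = 0].
  move=> xl; have /andP[x0 _] := xl; split.
  - by rewrite (weak_deriv_prim Dk' xl) -/k1; ring.
  - by rewrite (weak_deriv_prim Dv xl) v0 add0r.
  - by rewrite prim_supp// oppr_le0.
  - by rewrite prim_supp// oppr_le0.
have [kl1 vl1 _ _] := val l ol.
have eE x : 0 <= x <= l -> e x = 2^-1 * (kap x + phi.2 x) /\ e (- x) = 2^-1 * (kap x - phi.2 x).
  move=> xl; have [x1 x2 x3 x4] := val x xl; have /andP[xx0 xx1] := xl.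
  have xl1 : - l <= x <= l by rewrite xx1 andbT (le_trans _ xx0)// oppr_le0 ltW.
  have xl2 : - l <= - x <= l by rewrite lerN2 xx1 (le_trans _ (ltW l0))// oppr_le0.
  rewrite /e /affprim !pE// ?opprK.
  by rewrite x1 x2 x3 x4 kl1 vl1 kl /k; split; field.
have e_l := (eE l ol).1; rewrite kl add0r in e_l.
have bc s : 0 <= s <= P -> e (s + l) + e (s - l) = 0.
  move=> /andP[s0 sP].
  have := @int_transl_scale _ eps (-1) (- l) (s - l) (l + l) K.
  have -> : s - l + (l + l) = s + l by ring.
  have -> : - l + (l + l) = l by ring.
  rewrite epsl subr0 => H.
  have {H} H : prim eps (s + l) - prim eps l = -1 * prim eps (s - l).
    apply: H; first lra.
    move=> y /andP[y1 y2]; rewrite /eps !patchE !mem_setE !in_itv/=.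
    by do 2!(case: ifPn => [_|Hn]; last by exfalso; lra); apply: rec.
  move: e_l; rewrite /e /affprim => e_l.
  have -> : k + prim eps (s + l) + (k + prim eps (s - l)) =
    (prim eps (s + l) - prim eps l - -1 * prim eps (s - l)) + (k + prim eps l) + k by ring.
  by rewrite H e_l /k; ring.
exists k, (transl eps (P - T)); rewrite -affprim_transl// -/e; split; first exact: csq_transl.
  move=> s /andP[s0 sT].
  have -> : transl e (P - T) (s + l) = e (s + (P - T) + l) by rewrite /transl; congr e; ring.
  have -> : transl e (P - T) (s - l) = e (s + (P - T) - l) by rewrite /transl; congr e; ring.
  by apply: bc; apply/andP; split; rewrite -/P in Tn; lra.
have -> : free l (transl e (P - T)) T = free l e 0.
  rewrite (free_transl l0 e (P - T) T); apply: free_local => // y /andP[y1 y2]; rewrite addr0.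
  have -> : y + (T + (P - T)) = y + P by ring.
  apply: (@antiperiodic_iter e (P - l)) => //; last by rewrite -/P; lra.
  move=> u /andP[u1 u2]; apply/eqP; rewrite -addr_eq0; apply/eqP.
  have -> : u + (l + l) = (u + l) + l by ring.
  have -> : e u = e ((u + l) - l) by rewrite addrK.
  by apply: bc; apply/andP; split; lra.
have -> : free l e 0 = mk (kap \_ `]0, l[) (phi.2 \_ `]0, l[).
  rewrite /free; congr mk; apply/funext => x; rewrite !patchE mem_setE in_itv/=; case: ifPn => // xl.
    have [|E1 E2] := eE x; first by apply/andP; split; lra.
    by rewrite -[LHS]/(e (x + 0) + e (0 - x)) addr0 sub0r E1 E2; field.
  have [|E1 E2] := eE x; first by apply/andP; split; lra.
  by rewrite -[LHS]/(e (x + 0) - e (0 - x)) addr0 sub0r E1 E2; field.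
split=> [x xl|/=].
  have L1 : L2 0 l (kap \_ `]0, l[) by apply: sqint_L2; exact: Dk.1.
  by rewrite (weak_deriv_prim Dk xl) u0 add0r /= (int_prim L1 xl) patch_idem.
by apply: aeW => x /= xl; rewrite patchE mem_setE; rewrite /= in xl; rewrite xl.
Qed.

End Profiles.

(** * Identification of the semigroups *)

Section SemigroupFacts.
Context {R : realType}.
Notation mu := (@lebesgue_measure R).
Implicit Types (f g p q : R -> R) (a b c d h x t s : R) (z w : state R).
Variables (l : R) (T : R -> state R -> state R).
Hypotheses (l0 : 0 < l) (HT : C0_contraction_semigroup l T).

Lemma sg_diff t z w : 0 <= t -> calH l z -> calH l w ->
  normH l (T t z - T t w) <= normH l (z - w).
Proof.
move=> t0 Hz Hw; have Tz := sg_stable HT t0 Hz; have Tw := sg_stable HT t0 Hw.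
have E := sg_linear HT (-1) t0 Hw Hz; rewrite !scaleN1r in E.
have HD : calH l (- w + z) by rewrite addrC; exact: calHB.
have TD := sg_stable HT t0 HD.
have HD' : calH l (- T t w + T t z) by rewrite addrC; exact: calHB.
rewrite (addrC (T t z)) -(eqH_normH (ltW l0) TD HD' E).
by apply: le_trans (sg_contraction HT t0 HD) _; rewrite addrC.
Qed.

(** Uniform in a and b: by contraction, continuity at time 0 is transported to every later time. *)
Lemma sg_orbit_continuous z d : calH l z -> 0 < d -> exists2 dl : R, 0 < dl &
  forall a b, 0 <= a -> 0 <= b -> `|a - b| < dl -> normH l (T a z - T b z) <= d.
Proof.
move=> Hz d0; have /cvgr0Pnorm_le/(_ _ d0)/at_right_nearP[dl dl0 H] := sg_continuous HT Hz.
exists dl => //.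
suff S a b : 0 <= a -> a < b -> b - a < dl -> normH l (T a z - T b z) <= d.
  move=> a b a0 b0 ab; have [e|e|->] := ltgtP a b.
  - by apply: S => //; move: ab; rewrite distrC gtr0_norm ?subr_gt0.
  - have Ha := sg_stable HT a0 Hz; have Hb := sg_stable HT b0 Hz.
    by rewrite normH_sym//; apply: S => //; move: ab; rewrite gtr0_norm ?subr_gt0.
  - have Hb := sg_stable HT b0 Hz.
    by rewrite (eqH_normHB (ltW l0) Hb Hb) ?ltW//; exact: eqH_refl.
move=> a0 ab abd; have h0 : 0 < b - a by rewrite subr_gt0.
have h00 := ltW h0.
have Th := sg_stable HT h00 Hz; have Ta := sg_stable HT a0 Hz.
have Tah := sg_stable HT a0 Th.
have E := sg_D HT a0 h00 Hz; rewrite addrC subrK in E.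
have Tb : calH l (T b z) by apply: sg_stable => //; lra.
rewrite normH_sym// (eqH_normH_l (ltW l0) Tb Tah Ta E).
apply: le_trans (sg_diff a0 Th Hz) _.
by have := H _ h0 abd; rewrite ger0_norm ?normH_ge0.
Qed.

Lemma ler_dist (a b c : R) : a <= c + b -> b <= c + a -> `|a - b| <= c.
Proof. by move=> h1 h2; rewrite ler_norml; apply/andP; split; lra. Qed.

(* s |-> T (t - s) (Phi s) is constant, its right derivative being zero. *)
Lemma sg_orbit (Phi : R -> state R) t : 0 <= t ->
  (forall s, 0 <= s <= t -> calH l (Phi s)) ->
  (forall s d, 0 <= s <= t -> 0 < d -> exists2 dl : R, 0 < dl &
    forall r, 0 <= r <= t -> `|r - s| < dl -> normH l (Phi r - Phi s) <= d) ->
  (forall s d, 0 <= s < t -> 0 < d -> exists2 dl : R, 0 < dl &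
    forall h, 0 < h -> h < dl -> normH l (T h (Phi s) - Phi (s + h)) <= h * d) ->
  eqH l (T t (Phi 0)) (Phi t).
Proof.
move=> t0 HP cP dP; have ot : 0 <= (0 : R) <= t by rewrite lexx.
have tt : 0 <= t <= t by rewrite lexx andbT.
have TP s : 0 <= s <= t -> calH l (T (t - s) (Phi s)).
  by move=> st; apply: sg_stable; [|lra|]; [exact: HT|exact: HP].
have T0 := TP 0 ot; rewrite subr0 in T0.
(* The distance to the value at s = 0 turns the statement into one on a real function. *)
pose F s := normH l (T (t - s) (Phi s) - T t (Phi 0)).
have dF s r : 0 <= s <= t -> 0 <= r <= t ->
    `|F r - F s| <= normH l (T (t - r) (Phi r) - T (t - s) (Phi s)).
  move=> st rt; have Hs := TP s st; have Hr := TP r rt.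
  apply: ler_dist; first exact: normH_tri.
  by rewrite (normH_sym Hr Hs); exact: normH_tri.
have F0 : F t = F 0.
  apply: right_derivative0 => //.
    move=> s st d d0; have d20 : 0 < d / 2 by rewrite divr_gt0.
    have [a a0 Ha] := cP s _ st d20.
    have [b b0 Hb] := sg_orbit_continuous (HP s st) d20.
    exists (Num.min a b); first by rewrite lt_min a0.
    move=> r rt; rewrite lt_min => /andP[ra rb]; apply: le_trans (dF s r st rt) _.
    have Hr := HP r rt; have Hs := HP s st.
    have r0 : 0 <= t - r by lra.
    have s0 : 0 <= t - s by lra.
    have Hrs := sg_stable HT r0 Hs.
    apply: le_trans (normH_tri (TP r rt) Hrs (TP s st)) _.
    have := sg_diff r0 Hr Hs; have := Ha r rt ra; have := Hb _ _ r0 s0.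
    have -> : t - r - (t - s) = s - r by ring.
    rewrite distrC => /(_ rb); lra.
  move=> s st d d0; have [a a0 Ha] := dP s d st d0.
  have /andP[s0 s1] := st; have ts0 : 0 < t - s by lra.
  exists (Num.min a (t - s)); first by rewrite lt_min a0.
  move=> h h0; rewrite lt_min => /andP[ha hts].
  have st' : 0 <= s <= t by rewrite s0 ltW.
  have sht : 0 <= s + h <= t by apply/andP; split; lra.
  apply: le_trans (dF s (s + h) st' sht) _.
  have Hs := HP s st'; have Hsh := HP _ sht.
  have h00 := ltW h0; have Th := sg_stable HT h00 Hs.
  have k0 : 0 <= t - (s + h) by lra.
  have Tk := sg_stable HT k0 Th.
  have E := sg_D HT k0 h00 Hs; rewrite (_ : t - (s + h) + h = t - s) in E; last by ring.
  rewrite (normH_sym (TP _ sht) (TP _ st')).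
  rewrite (eqH_normH_l (ltW l0) (TP _ st') Tk (TP _ sht) E).
  by apply: le_trans (sg_diff k0 Th Hsh) _; exact: Ha.
have Ht := HP t tt; have S0 := sg_0 HT Ht.
have Tt := TP t tt; have Tt' := Tt; rewrite subrr in Tt'.
have E2 : eqH l (T t (Phi 0)) (T 0 (Phi t)).
  apply: normHB_eqH => //; rewrite normH_sym//.
  have := F0; rewrite /F subrr subr0 => ->; apply: (eqH_normHB (ltW l0)) => //; exact: eqH_refl.
exact: eqH_trans E2 S0.
Qed.

(** All that is used of a generator: along an absolutely continuous wave with reflection factor rho
    it acts as the time derivative. Both semigroups are identified from this alone. *)
Definition generated_on (rho : R) : Prop := forall eps M, csq eps ->
  (forall s, 0 <= s <= M -> affprim 0 eps (s + l) = rho * affprim 0 eps (s - l)) ->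
  forall s, 0 <= s <= M ->
  (fun h => normH l (h^-1 *: (T h (free l (affprim 0 eps) s) - free l (affprim 0 eps) s) - free l eps s))
    @ 0^'+ --> (0 : R).

Lemma sg_free_core rho eps M : generated_on rho -> 0 <= M -> csq eps ->
  (forall s, 0 <= s <= M -> affprim 0 eps (s + l) = rho * affprim 0 eps (s - l)) ->
  eqH l (T M (free l (affprim 0 eps) 0)) (free l (affprim 0 eps) M).
Proof.
move=> G M0 K bc; have Le := affprim_lsq 0 K; have Leps := sqint_lsq K.1.
have HP s := free_calH l s Le.
apply: (sg_orbit M0) => [s _|s d _ d0|s d /andP[s0 sM] d0]; first exact: HP.
  by have [a a0 Ha] := free_cont l0 s d0 Le; exists a => // r _; exact: Ha.
have d20 : 0 < d / 2 by rewrite divr_gt0.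
have sM' : 0 <= s <= M by rewrite s0 ltW.
have /cvgr0Pnorm_le/(_ _ d20)/at_right_nearP[a a0 Ha] := G eps M K bc s sM'.
have [b b0 Hb] := free_generator l0 0 d20 K.
exists (Num.min a b); first by rewrite lt_min a0.
move=> h h0; rewrite lt_min => /andP[ha hb].
have hn0 : h != 0 by rewrite gt_eqF.
have := Ha h h0 ha; rewrite (ger0_norm (normH_ge0 _ _)) => h1.
have := Hb h s hn0; rewrite (gtr0_norm h0) => /(_ hb) h2.
have Th := sg_stable HT (ltW h0) (HP s).
have H1 := calHZ h^-1 (calHB Th (HP s)); have H2 := calHZ h^-1 (calHB (HP (s + h)) (HP s)).
have Fe := free_calH l s Leps.
have -> : T h (free l (affprim 0 eps) s) - free l (affprim 0 eps) (s + h) =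
    h *: (h^-1 *: (T h (free l (affprim 0 eps) s) - free l (affprim 0 eps) s) -
          h^-1 *: (free l (affprim 0 eps) (s + h) - free l (affprim 0 eps) s)).
  by rewrite -scalerBr scalerA mulfV// scale1r opprB addrA subrK.
rewrite normHZ; last exact: calHB.
rewrite (gtr0_norm h0) ler_pM2l//; apply: le_trans (normH_tri H1 Fe H2) _.
by rewrite (normH_sym Fe H2) (splitr d) lerD.
Qed.

(** Both evolutions are continuous in their data, so the absolutely continuous case passes to the
    limit along averaged profiles. *)
Lemma sg_free rho q z t : generated_on rho -> hsq q ->
  (forall y, - l < y -> q (y + (l + l)) = rho * q y) -> 0 <= t -> calH l z ->
  eqH l z (free l q 0) -> eqH l (T t z) (free l q t).
Proof.
move=> G Hq rec t0 Hz E; have Lq := hsq_lsq Hq.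
have Tz := sg_stable HT t0 Hz; have Ft := free_calH l t Lq; have F0 := free_calH l 0 Lq.
apply: normHB_eqH => //; apply/eqP; rewrite eq_le normH_ge0 andbT.
apply/ler_addgt0Pl => d d0; rewrite addr0; have d20 : 0 < d / 2 by rewrite divr_gt0.
have [eps [K bc H]] := average_profile l0 Hq rec t0 d20.
have Le := affprim_lsq 0 K; have F0' := free_calH l 0 Le; have Ft' := free_calH l t Le.
have Tz' := sg_stable HT t0 F0'.
have C := sg_free_core G t0 K bc.
apply: le_trans (normH_tri Tz Tz' Ft) _.
rewrite (eqH_normH_l (ltW l0) Tz' Ft' Ft C) (splitr d); apply: lerD.
  apply: le_trans (sg_diff t0 Hz F0') _.
  by rewrite (eqH_normH_l (ltW l0) Hz F0 F0' E) normH_sym//; apply: H; rewrite lexx.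
by apply: H; rewrite t0 lexx.
Qed.

End SemigroupFacts.

(** * The generators on absolutely continuous waves *)

Section Generators.
Context {R : realType}.
Notation mu := (@lebesgue_measure R).
Implicit Types (f g p q : R -> R) (a b c d h x t s : R) (z w : state R).
Variables (l : R) (T : R -> state R -> state R).
Hypotheses (l0 : 0 < l).

Lemma weak_deriv_patch f g a b : weak_deriv a b f g <-> weak_deriv a b f (g \_ `]a, b[).
Proof.
split=> [H|H].
  have L : L2 a b (g \_ `]a, b[) by apply: sqint_L2; exact: H.1.
  by apply/(weak_derivP _ L) => x; rewrite patch_idem; exact: weak_deriv_prim H x.
have L : L2 a b g by have := H.1; rewrite /L2 patch_idem.
by apply/(weak_derivP _ L) => x xab; rewrite (weak_deriv_prim H xab) patch_idem.
Qed.

(* Unlike the cut-off velocity of free (affprim k eps) s, that of z is the continuous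
   representative, as domA and domAd require. *)
Lemma free_derivatives k eps s : csq eps ->
  let z := ((free l (affprim k eps) s).1, sm (affprim k eps) s) in
  [/\ eqH l (free l (affprim k eps) s) z, weak_deriv 0 l z.1 (sp (affprim k eps) s),
      weak_deriv 0 l (sp (affprim k eps) s) (free l eps s).2,
      Hhalf l z.2 & forall x, 0 <= x <= l -> (free l eps s).1 x = z.2 x].
Proof.
move=> K z; have Le := affprim_lsq k K.
have Ls : L2 0 l (sp (affprim k eps) s) by exact: sp_lsq.
split.
- split=> //; apply: aeW => x /= xl; rewrite patchE mem_setE; by rewrite /= in xl; rewrite xl.
- by apply/weak_deriv_patch/weak_deriv_mk/sqint_L2; exact: Ls.
- by apply: (weak_deriv_patch _ _ 0 l).1; exact: sp_deriv.
- exact: sm_Hhalf.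
- move=> x xl; have D := sm_deriv l0 k s K.
  have [_ z0] := sm_Hhalf l0 k s K.
  have L1 : L2 0 l (sp eps s \_ `]0, l[) by apply: sqint_L2; exact: D.1.
  by rewrite /z/= (weak_deriv_prim D xl) z0 add0r (int_prim L1 xl) patch_idem.
Qed.

Lemma generated_calA : generates l (calA l) T -> generated_on l T (-1).
Proof.
move=> [HT G] eps M K bc s sM; have Le := affprim_lsq 0 K; have Leps := sqint_lsq K.1.
have [E D1 D2 D3 D4] := free_derivatives 0 s K.
apply/(G _ _ (free_calH l s Le) (free_calH l s Leps)).
exists ((free l (affprim 0 eps) s).1, sm (affprim 0 eps) s); split=> //.
split=> //; last by exists (sp (affprim 0 eps) s).
split=> //; exists (sp (affprim 0 eps) s); split.
- by split=> //; exists (free l eps s).2.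
- exact: mk0.
- by rewrite -[LHS]/(affprim 0 eps (l + s) + affprim 0 eps (s - l)) (addrC l) bc// mulN1r addNr.
Qed.

(** The assumption on the profile is u_x(l) = mu2 u_t(l), read off at time s. *)
Lemma calAd_core mu2 k eps s : csq eps ->
  affprim k eps (s + l) + affprim k eps (s - l) = mu2 * (affprim k eps (s + l) - affprim k eps (s - l)) ->
  exists z', eqH l (free l (affprim k eps) s) z' /\ calAd l mu2 z' (free l eps s).
Proof.
move=> K bc; have Le := affprim_lsq k K; have Leps := sqint_lsq K.1.
have [E D1 D2 D3 D4] := free_derivatives k s K.
exists ((free l (affprim k eps) s).1, sm (affprim k eps) s); split=> //.
split=> //; [|exact: free_calH|by exists (sp (affprim k eps) s)].
split.
- split; first exact: (free_calH l s Le).1.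
  exact: sm_lsq.
- exact: D3.1.
- exists (sp (affprim k eps) s); split; first by split=> //; exists (free l eps s).2.
  rewrite -[LHS]/(affprim k eps (l + s) + affprim k eps (s - l)).
  by rewrite -[RHS]/(mu2 * (affprim k eps (l + s) - affprim k eps (s - l))) (addrC l).
Qed.

(** The factor comes from solving the condition at l for the value at s + l. *)
Lemma generated_calAd mu2 : mu2 != 1 -> generates l (calAd l mu2) T ->
  generated_on l T (- ((1 + mu2) / (1 - mu2))).
Proof.
move=> m1 [HT G] eps M K bc s sM; have Le := affprim_lsq 0 K; have Leps := sqint_lsq K.1.
apply/(G _ _ (free_calH l s Le) (free_calH l s Leps)).
apply: calAd_core => //; rewrite bc//; field.
by rewrite subr_eq0 eq_sym.
Qed.

(** Contraction gives (T h z, z) <= |z|^2, so the difference quotient at z has a nonpositive product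
    with z; the sign passes to the limit w. *)
Lemma dissipative B z w : generates l B T -> calH l z -> calH l w ->
  (exists z', eqH l z z' /\ B z' w) -> dotH l z w <= 0.
Proof.
move=> [HT G] Hz Hw /(G _ _ Hz Hw) /cvgr0Pnorm_le lim.
have n0 := normH_ge0 l z; have n1 : 0 < normH l z + 1 by lra.
apply/ler_addgt0Pl => d d0; rewrite addr0.
have e0 : 0 < d / (normH l z + 1) by rewrite divr_gt0.
have [a a0 Ha] := at_right_nearP (lim _ e0).
have h0 : 0 < a / 2 by rewrite divr_gt0.
have ha : a / 2 < a by rewrite ltr_pdivrMr//; lra.
have := Ha _ h0 ha; rewrite (ger0_norm (normH_ge0 _ _)); set h := a / 2 in h0 *.
have Th := sg_stable HT (ltW h0) Hz.
have HD := calHB Th Hz; have HD' := calHZ h^-1 HD.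
set v := h^-1 *: _ in HD' * => nv.
have vz : dotH l v z <= 0.
  rewrite /v dotHZl// dotHBl// pmulr_rle0 ?invr_gt0// subr_le0 -normH_sqr.
  apply: le_trans (ler_norm _) _; apply: le_trans (dotH_cauchy Th Hz) _.
  by rewrite expr2; apply: ler_wpM2r => //; exact: (sg_contraction HT (ltW h0)).
have -> : dotH l z w = dotH l v z - dotH l (v - w) z by rewrite dotHBl// (dotHC l w z) opprB addrC subrK.
have := dotH_cauchy (calHB HD' Hw) Hz; have := ler_norm (- dotH l (v - w) z); rewrite normrN.
have : normH l (v - w) * normH l z <= d / (normH l z + 1) * (normH l z + 1).
  by apply: ler_pM => //; [exact: normH_ge0|lra].
rewrite divfK ?gt_eqF//; lra.
Qed.

(* Test the dissipativity on (mu2 l x, x), with image (x, 0). *)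
Lemma generates_calAd_le0 mu2 : generates l (calAd l mu2) T -> mu2 <= 0.
Proof.
move=> G; have l0' := l0.
(* With this [eps] and [k] the profile is (mu2 l + y) / 2 on [-l,l], hence u_x = mu2 l and u_t = x,
   and the product to be tested is mu2 l^2. *)
pose eps : R -> R := 2^-1 *: (\1_`[- l, l] : R -> R).
pose k := mu2 * l / 2 - l / 2.
have K : csq eps.
  apply: csqZ; split; first exact: sqint_indic.
  by exists l => x lx; rewrite indicE mem_setE in_itv/= -ler_norml leNgt lx.
have epsE x : - l <= x <= l -> eps x = 2^-1.
  by move=> xl; rewrite -[LHS]/(2^-1 * \1_`[- l, l] x) indicE mem_setE in_itv/= xl mulr1.
have Ie := csq_itg K.
have pl : prim eps (- l) = 0.
  rewrite /prim -Rintegral_itv_bndo_bndc; last exact: integrableS Ie.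
  rewrite (_ : \int[mu]_(x in `]-oo, - l[) eps x = \int[mu]_(x in `]-oo, (- l)[) cst 0 x).
    by rewrite Rintegral_cst// mul0r.
  apply: eq_Rintegral => x; rewrite mem_setE in_itv/= => xl.
  rewrite -[LHS]/(2^-1 * \1_`[- l, l] x) indicE mem_setE in_itv/= leNgt xl/=; exact: mulr0.
have cstE (u v m : R) : u <= v -> \int[mu]_(x in `[u, v]) cst m x = (v - u) * m.
  move=> uv; rewrite Rintegral_cst//= lebesgue_measure_itv/= lte_fin.
  case: ltP => uv'; first by rewrite mulrC.
  by rewrite /= mulr0 (_ : v - u = 0) ?mul0r//; lra.
have eE x : - l <= x <= l -> affprim k eps x = mu2 * l / 2 + x / 2.
  move=> /andP[x1 x2]; have := int_itv x1 Ie; rewrite pl subr0 /affprim => <-.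
  have -> : \int[mu]_(y in `[- l, x]) eps y = \int[mu]_(y in `[- l, x]) cst 2^-1 y.
    apply: eq_Rintegral => y; rewrite mem_setE in_itv/= => /andP[y1 y2].
    by rewrite epsE//; apply/andP; split; lra.
  by rewrite cstE// /k; field.
have bc : affprim k eps (0 + l) + affprim k eps (0 - l) = mu2 * (affprim k eps (0 + l) - affprim k eps (0 - l)).
  by rewrite add0r sub0r !eE; [field|apply/andP; split; lra..].
have Le := affprim_lsq k K; have Leps := sqint_lsq K.1.
have Hz := free_calH l 0 Le; have Hw := free_calH l 0 Leps.
have := dissipative G Hz Hw (calAd_core K bc).
rewrite dotH_free//.
have -> : sm eps 0 \_ `]0, l[ = 0.
  apply/funext => x; rewrite patchE mem_setE in_itv/=; case: ifP => // /andP[x1 x2].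
  by rewrite -[LHS]/(eps (x + 0) - eps (0 - x)) addr0 sub0r !epsE ?subrr//; apply/andP; split; lra.
rewrite (ipC (speed _ _)) ip0l addr0.
have -> : ip (strain l (free l (affprim k eps) 0)) (sp eps 0 \_ `]0, l[) = (free l (affprim k eps) 0).1 l.
  have ll : 0 <= l <= l by rewrite ltW//=.
  rewrite (calH_val Hz ll) primE; apply: eq_Rintegral => x _.
  rewrite /strain !patchE !mem_setE !in_itv/=; case: ifPn => xl; last by rewrite mul0r; case: ifP.
  have -> : sp eps 0 x = 1.
    rewrite -[LHS]/(eps (x + 0) + eps (0 - x)) addr0 sub0r !epsE; [lra|apply/andP; split; lra..].
  by rewrite mulr1; case: ifPn => // Hn; exfalso; lra.
have -> : (free l (affprim k eps) 0).1 l = mu2 * l * l.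
  have [_ [_ D1] _ _ _] := free_derivatives k 0 K.
  have ll : 0 <= l <= l by rewrite ltW//=.
  apply: etrans (D1 l ll) _.
  have -> : ((free l (affprim k eps) 0).1, sm (affprim k eps) 0).1 0 = 0 by exact: mk0.
  rewrite add0r.
  have -> : \int[mu]_(y in `[0, l]) sp (affprim k eps) 0 y = \int[mu]_(y in `[0, l]) cst (mu2 * l) y.
    apply: eq_Rintegral => y; rewrite mem_setE in_itv/= => /andP[y1 y2].
    rewrite -[LHS]/(affprim k eps (y + 0) + affprim k eps (0 - y)) addr0 sub0r !eE; [by field|apply/andP; split; lra..].
  by rewrite cstE ?ltW// subr0 mulrC.
by rewrite !pmulr_lle0.
Qed.

End Generators.

(** * The extrapolated semigroup and the formula of Duhamel *)

Section DualExtension.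
Context {R : realType}.
Notation mu := (@lebesgue_measure R).
Notation mR := (measurableTypeR R).
Implicit Types (f p q : R -> R) (a b c d h x t s : R) (z w phi psi : state R).
Variables (l : R).
Hypothesis l0 : 0 < l.

Lemma integrable_oo_cc f a b : itg (f \_ `]a, b[) -> mu.-integrable `[a, b] (EFin \o f).
Proof.
move=> If.
have mf : measurable_fun (`]a, b[%classic : set mR) f.
  by apply/(measurable_restrictT _ _) => //; exact: itg_meas If.
have I1 : mu.-integrable `]a, b[ (EFin \o f).
  by apply/integrable_mkcond => //; rewrite restrict_EFin.
apply/integrableP; split.
  apply/measurable_EFinP; exact: measurable_fun_itv_cc mf.
rewrite integral_itv_bndoo//; first by have /integrableP[] := I1.
by apply/measurable_EFinP; apply: measurableT_comp.
Qed.

Lemma L2_sub f a b a' b' : L2 a b f -> a <= a' -> b' <= b -> L2 a' b' f.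
Proof.
move=> Lf aa bb; have := sqint_patch (measurable_itv `]a', b'[) Lf; rewrite /L2.
rewrite (_ : (f \_ `]a, b[) \_ `]a', b'[ = f \_ `]a', b'[)//.
by apply/funext => x; rewrite !patchE; itv_tac.
Qed.

Lemma calA_calH phi w : calA l phi w -> [/\ domA l phi, calH l phi & calH l w].
Proof.
move=> [D E [g [_ Dg]]]; split=> //.
  have [[k [[Dk _] u0 _]] [[v Dv] _]] := D.
  by split; [split=> //; exists k|exact: weak_deriv_L2 Dv].
have [_ [[v Dv] v0]] := D; split; last exact: Dg.1.
split; last by rewrite E ?lexx ?ltW.
by exists v; apply: weak_deriv_ext Dv; [move=> x xl; rewrite E|exact: ltW].
Qed.

Lemma domA_calA phi : domA l phi -> exists w, calA l phi w.
Proof.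
move=> D; have [[k [[Dk [k' Dk']] u0 kl]] _] := D.
by exists (phi.2, k'); split=> //; exists k.
Qed.

Lemma domA_calH phi : domA l phi -> calH l phi.
Proof. by move=> /domA_calA[w /calA_calH[]]. Qed.

Lemma in_dual_pivot z : calH l z -> in_dual l (pivot l z).
Proof.
move=> Hz; split=> [k phi psi /domA_calH Hphi /domA_calH Hpsi|].
  by rewrite /pivot !(dotHC l z) dotH_linl.
exists (normH l z) => phi w /calA_calH[_ Hphi _].
apply: le_trans (dotH_cauchy Hz Hphi) _; apply: ler_wpM2l; first exact: normH_ge0.
by rewrite lerDl normH_ge0.
Qed.

(** On D(calA) the velocity is the first component of the image under calA, so it lies in H_{1/2},
    where evaluation at a point is bounded. *)
Lemma in_dual_dirac x0 : 0 <= x0 <= l -> in_dual l (velocity_load (dirac_mass x0)).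
Proof.
move=> x0l; split=> [//|]; exists (Num.sqrt l) => phi w A; have [_ Hphi Hw] := calA_calH A.
have [_ E _] := A; rewrite /velocity_load /dirac_mass -E//.
apply: le_trans (calH_val_le l0 Hw x0l) _; rewrite mulrC; apply: ler_wpM2l; first exact: sqrtr_ge0.
by rewrite lerDr normH_ge0.
Qed.

(** An element of calH approximating (0, delta_{x0}). It lies on the left of x0 so that x0 = l is
    allowed. *)
Definition bump x0 h : state R := (0, h^-1 *: (\1_`[x0 - h, x0] : R -> R)).

Lemma bump_calH x0 h : calH l (bump x0 h).
Proof.
split; last by apply: sqint_L2; apply: sqintZ; exact: sqint_indic.
by split=> //; exists 0; exact: weak_deriv0.
Qed.

Lemma dotH_bump x0 h w : calH l w -> dotH l (bump x0 h) w = dotL2 0 l (bump x0 h).2 w.2.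
Proof.
move=> Hw; have Hb := bump_calH x0 h.
have Db : weak_deriv 0 l (bump x0 h).1 0 by exact: weak_deriv0.
rewrite dotHC (dotH_strain Hw Hb Db) (_ : 0 \_ _ = 0); last first.
  by apply/funext => x; rewrite patchE; case: ifP.
by rewrite (ipC (strain l w)) ip0l add0r ipC dotL2E//; [exact: Hb.2|exact: Hw.2].
Qed.

Lemma bump_close x0 h f c : 0 < h -> 0 <= x0 - h -> x0 <= l -> L2 0 l f ->
  (forall x, x0 - h <= x <= x0 -> `|f x - f x0| <= c) ->
  `|dotL2 0 l (bump x0 h).2 f - f x0| <= c.
Proof.
move=> h0 xh x0l Lf H; have K := L2_csq Lf; have If := csq_itg K.
have x1 : x0 - h < x0 by lra.
have := int_close If xh x1 x0l H; rewrite (_ : x0 - (x0 - h) = h); last by ring.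
have -> : dotL2 0 l (bump x0 h).2 f = h^-1 * \int[mu]_(r in `[x0 - h, x0]) f r.
  have Li : L2 0 l (bump x0 h).2 := (bump_calH x0 h).2.
  have Qi := sqint_indic (x0 - h) x0.
  have Qp : sqint ((\1_`[x0 - h, x0] : R -> R) \_ `]0, l[) by exact: sqint_patch.
  rewrite (dotL2E Li Lf) /bump/= (patchZ h^-1 (\1_`[x0 - h, x0] : R -> R)) (ipZl _ Qp K.1); congr (_ * _).
  rewrite (int_sub_itv If xh (ltW x1) x0l) -(int_itv (ltW x1) If) int_itv_patch.
  apply: eq_Rintegral => x _; rewrite !patchE indicE.
  by case: (x \in `]0, l[%classic); case: (x \in _); rewrite ?mul1r ?mul0r.
move=> I; rewrite -(ler_pM2l h0) -{1}(gtr0_norm h0) -normrM mulrBr mulrA mulfV ?gt_eqF// mul1r.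
exact: I.
Qed.

Variables (T : R -> state R -> state R) (Tm : R -> (state R -> R) -> (state R -> R)).
Hypotheses (HG : generates l (calA l) T) (HE : dual_extension l T Tm).
Let HT := HG.1.

Lemma sg_wave z : calH l z -> exists q, [/\ hsq q,
  forall y, - l < y -> q (y + (l + l)) = -1 * q y, eqH l z (free l q 0)
  & forall t, 0 <= t -> eqH l (T t z) (free l q t)].
Proof.
move=> Hz; have [q [Hq qE _ rec]] := profile_continuation (-1) l0 (profile_csq Hz).
have E := free_profile l0 Hz qE; exists q; split=> // t t0.
exact: (sg_free l0 HT (generated_calA l0 HG) Hq rec t0 Hz E).
Qed.

Lemma free_wave_solution x0 q : 0 < x0 -> x0 <= l -> hsq q ->
  (forall y, - l < y -> q (y + (l + l)) = -1 * q y) ->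
  wave_solution l x0 (free l q 0) (free l q) 0.
Proof.
move=> x00 x0l Hq rec; have Lq := hsq_lsq Hq.
have -> : free l q = forced_wave l x0 q 0 by apply/funext => s; exact: free_wave.
apply: wave_solution_explicit => //; first exact: lsq0.
by move=> y yl; rewrite rec// mulN1r addNr subrr mulr0.
Qed.

(** [pairing] with source 0, applied to the free wave that T t z is known to be: the adjoint of T t
    runs the test wave back to time 0. *)
Lemma sg_adjoint z k eps t : calH l z -> 0 <= t -> csq eps ->
  (forall s, 0 <= s <= t -> affprim k eps (s + l) + affprim k eps (s - l) = 0) ->
  dotH l (T t z) (free l (affprim k eps) t) = dotH l z (free l (affprim k eps) 0).
Proof.
move=> Hz t0 K bc; have [q [Hq rec E0 E]] := sg_wave Hz.
have Lq := hsq_lsq Hq; have Le := affprim_lsq k K.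
have W := free_wave_solution l0 (lexx l) Hq rec.
have := pairing l0 W t0 (L2_0 0 t) K bc.
have -> : \int[mu]_(r in `[0, t]) ((0 : R -> R) r * sm (affprim k eps) r l) = 0.
  rewrite (_ : (fun r => _) = cst 0) ?Rintegral_cst ?mul0r//.
  by apply/funext => r; exact: mul0r.
move/eqP; rewrite subr_eq0 => /eqP P.
have F1 := free_calH l t Le; have F0 := free_calH l 0 Le.
have Q1 := free_calH l t Lq; have Q0 := free_calH l 0 Lq.
rewrite (eqH_dotH (ltW l0) (sg_stable HT t0 Hz) Q1 F1 (E t t0)) P.
exact: (esym (eqH_dotH (ltW l0) Hz Q0 F0 E0)).
Qed.

Lemma sg_adjoint_shift z k eps t a : calH l z -> 0 <= t -> csq eps ->
  (forall s, a <= s <= a + t -> affprim k eps (s + l) + affprim k eps (s - l) = 0) ->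
  dotH l (T t z) (free l (affprim k eps) (t + a)) = dotH l z (free l (affprim k eps) a).
Proof.
move=> Hz t0 K bc; set e := affprim k eps.
have E : affprim k (transl eps a) = transl e a by rewrite -(affprim_transl k a K).
have bc' s : 0 <= s <= t -> affprim k (transl eps a) (s + l) + affprim k (transl eps a) (s - l) = 0.
  move=> /andP[s0 st]; rewrite E.
  have -> : transl e a (s + l) = e (s + a + l) by rewrite /transl; congr e; ring.
  have -> : transl e a (s - l) = e (s + a - l) by rewrite /transl; congr e; ring.
  by apply: bc; apply/andP; split; lra.
have := sg_adjoint Hz t0 (csq_transl a K) bc'.
by rewrite E (free_transl l0 e a t) (free_transl l0 e a 0) add0r.
Qed.

Lemma ext_scale t k F phi : 0 <= t -> in_dual l F -> domA l phi -> Tm t (k *: F) phi = k * Tm t F phi.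
Proof.
move=> t0 HF Hphi; have H0 : in_dual l (0 : state R -> R).
  split=> [k' p1 p2 _ _|]; first by rewrite -[RHS]/(k' * 0 + 0) mulr0 addr0.
  by exists 0 => p1 w _; rewrite mul0r normr0.
(* Additivity with all arguments 0. *)
have Z : Tm t 0 phi = 0.
  have := ext_linear HE 1 t0 H0 H0 Hphi; rewrite scaler0 addr0 -[RHS]/(1 * Tm t 0 phi + Tm t 0 phi) mul1r.
  by move=> e; lra.
have := ext_linear HE k t0 HF H0 Hphi; rewrite addr0 => ->.
by rewrite -[LHS]/(k * Tm t F phi + Tm t 0 phi) Z addr0.
Qed.

(** The extension is known only on calH and by its continuity. On a bump its value is a mean of the
    test velocity at time t - tau near x0; the bound on Dirac mass minus bump lets h tend to 0. *)
Lemma ext_dirac x0 tau t k eps phi : 0 < x0 -> x0 <= l -> 0 <= tau -> tau <= t ->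
  csq eps -> (forall s, 0 <= s <= t -> affprim k eps (s + l) + affprim k eps (s - l) = 0) ->
  domA l phi -> eqH l phi (free l (affprim k eps) t) ->
  Tm tau (velocity_load (dirac_mass x0)) phi = sm (affprim k eps) (t - tau) x0.
Proof.
move=> x00 x0l tau0 taut K bc Dphi Ephi; set e := affprim k eps.
have Le : lsq e := affprim_lsq k K.
have Hphi := domA_calH Dphi; have Ft := free_calH l t Le; have F0 := free_calH l (t - tau) Le.
have [w Aw] := domA_calA Dphi; have [_ _ Hw] := calA_calH Aw.
have [M HM] := ext_bounded HE tau0.
have x0l' : 0 <= x0 <= l by rewrite ltW.
have Id := in_dual_dirac x0l'.
have [ev Dev] : exists ev, weak_deriv 0 l (sm e (t - tau)) ev by exists (sp eps (t - tau)); exact: sm_deriv.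
(* The first term bounds the extension on Dirac mass minus bump, the second is the Hoelder constant
   of the test velocity at time t - tau. *)
pose C := `|M| * (normH l phi + normH l w) + nm (ev \_ `]0, l[).
have C0 : 0 <= C by rewrite addr_ge0 ?nm_ge0 ?mulr_ge0 ?addr_ge0 ?normH_ge0.
have main h : 0 < h -> h <= x0 ->
    `|Tm tau (velocity_load (dirac_mass x0)) phi - sm e (t - tau) x0| <= C * Num.sqrt h.
  move=> h0 hx; have xh : 0 <= x0 - h by lra.
  have Hb := bump_calH x0 h; have Ib := in_dual_pivot Hb.
  have L := ext_linear HE (-1) tau0 Ib Id Dphi.
  pose G := -1 *: pivot l (bump x0 h) + velocity_load (dirac_mass x0).
  have IG : in_dual l G.
    split=> [k' p1 p2 D1 D2|].
      rewrite -[LHS]/(-1 * pivot l (bump x0 h) (k' *: p1 + p2) + velocity_load (dirac_mass x0) (k' *: p1 + p2)).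
      rewrite Ib.1// Id.1//.
      rewrite -[RHS]/(k' * (-1 * pivot l (bump x0 h) p1 + velocity_load (dirac_mass x0) p1)
        + (-1 * pivot l (bump x0 h) p2 + velocity_load (dirac_mass x0) p2)); ring.
    have [_ [K1 B1]] := Ib; have [_ [K2 B2]] := Id; exists (K1 + K2) => p1 w1 A1.
    rewrite -[X in `|X|]/(-1 * pivot l (bump x0 h) p1 + velocity_load (dirac_mass x0) p1).
    apply: le_trans (ler_normD _ _) _; rewrite mulN1r normrN mulrDl.
    by apply: lerD; [exact: B1|exact: B2].
  (* The velocity [p1.2] equals [w1.1], which is Hoelder with constant |w1|, so its mean over
     [x0-h,x0] misses its value at x0 by at most |w1| sqrt h. *)
  have BG : dual_bound l G (Num.sqrt h).
    move=> p1 w1 A1; have [D1 H1 Hw1] := calA_calH A1; have [_ E1 _] := A1.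
    rewrite -[X in `|X|]/(-1 * dotH l (bump x0 h) p1 + p1.2 x0) dotH_bump// mulN1r addrC distrC.
    apply: le_trans (bump_close h0 xh x0l H1.2 (c := normH l w1 * Num.sqrt h) _) _.
      move=> x /andP[x1 x2]; rewrite -!E1//; last by apply/andP; split; lra.
      apply: le_trans (calH_diff Hw1 _ x0l') _; first by apply/andP; split; lra.
      apply: ler_wpM2l; first exact: normH_ge0.
      by apply: ler_wsqrtr; rewrite distrC ger0_norm; lra.
    by rewrite mulrC; apply: ler_wpM2l; rewrite ?sqrtr_ge0// lerDr normH_ge0.
  have S1 : `|Tm tau G phi| <= `|M| * Num.sqrt h * (normH l phi + normH l w).
    apply: le_trans (HM G _ IG BG phi w Aw) _; apply: ler_wpM2r; first by rewrite addr_ge0 ?normH_ge0.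
    by apply: ler_wpM2r; [exact: sqrtr_ge0|exact: ler_norm].
  have X := ext_extends HE tau0 Hb Dphi.
  have A : pivot l (T tau (bump x0 h)) phi = dotL2 0 l (bump x0 h).2 (sm e (t - tau)).
    have Tb := sg_stable HT tau0 Hb.
    rewrite /pivot (dotHC l (T tau _)) (eqH_dotH (ltW l0) Hphi Ft Tb Ephi) dotHC.
    have bc' s : t - tau <= s <= t - tau + tau -> e (s + l) + e (s - l) = 0.
      by move=> /andP[s0 st]; apply: bc; apply/andP; split; lra.
    have := sg_adjoint_shift Hb tau0 K bc'; rewrite -/e (addrC tau) subrK => ->.
    rewrite dotH_bump//.
    have Ls : L2 0 l (sm e (t - tau)) by exact: sm_lsq.
    have Ls' : L2 0 l (sm e (t - tau) \_ `]0, l[) by exact: sqint_L2.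
    by rewrite (dotL2E Hb.2 Ls) (dotL2E Hb.2 Ls') patch_idem.
  have S2 : `|dotL2 0 l (bump x0 h).2 (sm e (t - tau)) - sm e (t - tau) x0| <= nm (ev \_ `]0, l[) * Num.sqrt h.
    apply: bump_close => //; first exact: (weak_deriv_L2 Dev).
    move=> x /andP[x1 x2].
    apply: le_trans (weak_deriv_diff Dev _ x0l') _; first by apply/andP; split; lra.
    apply: ler_wpM2l; first exact: nm_ge0.
    by apply: ler_wsqrtr; rewrite distrC ger0_norm; lra.
  have -> : Tm tau (velocity_load (dirac_mass x0)) phi - sm e (t - tau) x0 = 
      Tm tau G phi + (dotL2 0 l (bump x0 h).2 (sm e (t - tau)) - sm e (t - tau) x0).
    rewrite -A -X L -[(_ *: _ + _) phi]/(-1 * Tm tau (pivot l (bump x0 h)) phi + Tm tau (velocity_load (dirac_mass x0)) phi).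
    ring.
  apply: le_trans (ler_normD _ _) _; rewrite /C mulrDl; apply: lerD => //.
  by rewrite mulrAC.
apply/eqP; rewrite -subr_eq0 -normr_le0; apply/ler_addgt0Pl => d d0; rewrite addr0.
have C1 : 0 < C + 1 by lra.
pose r := d / (C + 1); have r0 : 0 < r by rewrite divr_gt0.
pose h := Num.min (r ^+ 2) x0.
have h0 : 0 < h by rewrite lt_min exprn_gt0.
apply: le_trans (main h h0 _) _; first by rewrite ge_min lexx orbT.
apply: (@le_trans _ _ ((C + 1) * r)); last by rewrite /r mulrC divfK ?gt_eqF.
apply: ler_pM; rewrite ?sqrtr_ge0//; first lra.
have -> : r = Num.sqrt (r ^+ 2) by rewrite sqrtr_sqr gtr0_norm.
by apply: ler_wsqrtr; rewrite ge_min lexx.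
Qed.

(** The pairing identities over [0,t] and [0,t0], with one and the same test wave, are
    subtracted. *)
Lemma duhamel_formula x0 z0 U g (c : R -> R) k t0 t1 : 0 < x0 -> x0 <= l -> 0 <= t0 -> t0 <= t1 ->
  wave_solution l x0 z0 U g -> L2 0 t1 g ->
  (forall r, t0 < r < t1 -> g r = k * c (r - 2 * l)) ->
  duhamel l T Tm x0 t0 t1 k (U t0) c U.
Proof.
move=> x00 x0l t00 t01 HU Lg gE t /andP[t0t tt1] F.
have t_0 : 0 <= t := le_trans t00 t0t.
have Lg' : L2 0 t g := L2_sub Lg (lexx 0) tt1.
have x0l' : 0 <= x0 <= l by rewrite ltW.
have Id := in_dual_dirac x0l'.
suff main phi : domA l phi ->
    mu.-integrable `[t0, t] (fun s => (F s phi)%:E) /\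
    dotH l (U t) phi = dotH l (T (t - t0) (U t0)) phi + \int[mu]_(s in `[t0, t]) F s phi.
  by split=> phi D; have [] := main phi D.
(* The functional phi is the state at time t of a test wave, whose backward run makes both T and the
   integrand explicit. *)
move=> D; have [kk [eps [K bc E]]] := domA_profile l0 D t_0; set e := affprim kk eps.
have FE s : t0 <= s <= t -> F s phi = k * c (s - 2 * l) * sm e s x0.
  move=> /andP[s0 st]; have ts : 0 <= t - s by lra.
  have tst : t - s <= t by lra.
  have := ext_dirac x00 x0l ts tst K bc D E; rewrite (_ : t - (t - s) = s); last by ring.
  move=> <-; rewrite -ext_scale//.
(* Strictly inside only: the rule for g says nothing at the ends of the interval. *)
have FE' s : t0 < s < t -> F s phi = g s * sm e s x0.
  move=> /andP[s0 st]; rewrite FE; last by rewrite !ltW.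
  by rewrite gE//; apply/andP; split; lra.
have Kd := pairing_density_csq x0 kk Lg' K; have Id' := csq_itg Kd.
have EP : (fun s => F s phi) \_ `]t0, t[ = pairing_density x0 g t kk eps \_ `]t0, t[.
  apply/funext => s; rewrite !patchE mem_setE in_itv/=; case: ifPn => // st.
  have /andP[st1 st2] := st.
  by rewrite FE'// /pairing_density patchE mem_setE in_itv/= (le_lt_trans t00 st1) st2.
have IF : itg ((fun s => F s phi) \_ `]t0, t[) by rewrite EP; exact: itg_patch.
split; first exact: integrable_oo_cc.
have Le : lsq e := affprim_lsq kk K.
have Hphi := domA_calH D; have Ft := free_calH l t Le; have Ft0 := free_calH l t0 Le.
have Ut := ws_calH HU t_0; have U0 := ws_calH HU t00.
have tt0 : 0 <= t - t0 by lra.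
have TU := sg_stable HT tt0 U0.
have e1 : dotH l (U t) phi = dotH l (U t) (free l e t).
  by rewrite dotHC (eqH_dotH (ltW l0) Hphi Ft Ut E) dotHC.
have e2 : dotH l (T (t - t0) (U t0)) phi = dotH l (U t0) (free l e t0).
  rewrite dotHC (eqH_dotH (ltW l0) Hphi Ft TU E) dotHC.
  have bc' s : t0 <= s <= t0 + (t - t0) -> e (s + l) + e (s - l) = 0.
    by move=> /andP[s0 st]; apply: bc; apply/andP; split; lra.
  by have := sg_adjoint_shift U0 tt0 K bc'; rewrite subrK.
have P1 := pairing l0 HU t_0 Lg' K bc.
have Lg0 : L2 0 t0 g := L2_sub Lg (lexx 0) t01.
have P0 : dotH l (U t0) (free l e t0) - dotH l (U 0) (free l e 0) = \int[mu]_(r in `[0, t0]) (g r * sm e r x0).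
  by apply: (pairing l0 HU t00 Lg0 K) => s /andP[s0 st]; apply: bc; rewrite s0 (le_trans st).
rewrite e1 e2.
have I1 := int_sub_itv Id' t00 t0t (lexx t).
have I2 : \int[mu]_(s in `[t0, t]) F s phi = \int[mu]_(r in `[t0, t]) (g r * sm e r x0).
  rewrite !int_oo_cc//; last first.
    rewrite (_ : _ \_ _ = (fun s => F s phi) \_ `]t0, t[)//.
    by apply/funext => s; rewrite !patchE mem_setE in_itv/=; case: ifPn => // st; rewrite FE'.
  by apply: eq_Rintegral => s _; rewrite !patchE mem_setE in_itv/=; case: ifPn => // st; rewrite FE'.
have ot : t0 + (t - t0) = t by rewrite addrC subrK.
have := int_increment Id' t00 tt0 (t := t0) (h := t - t0) (T := t); rewrite ot => /(_ (lexx t)) I3.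
rewrite I2 -I3.
move: P1 P0; rewrite -/e.
move: (dotH l (U t) (free l e t)) (dotH l (U 0) (free l e 0)) (dotH l (U t0) (free l e t0)) => A1 A2 A3.
by move=> <- <-; ring.
Qed.

End DualExtension.

(** * Recursions with delay *)

Section DelayRecursion.
Context {R : realType}.
Notation mu := (@lebesgue_measure R).
Notation mR := (measurableTypeR R).
Implicit Types (f p q g h : R -> R) (a b c d x y z t s : R).

Definition upto f b : R -> R := f \_ `]-oo, b].

Lemma uptoE f b x : x <= b -> upto f b x = f x.
Proof. by move=> xb; rewrite /upto patchE mem_setE in_itv/= xb. Qed.

Lemma upto_congr f f' b : (forall x, x <= b -> f x = f' x) -> upto f b = upto f' b.
Proof.
move=> E; apply/funext => x; rewrite /upto !patchE mem_setE in_itv/=; case: ifP => // xb.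
exact: E.
Qed.

Lemma upto_upto f b c : c <= b -> upto (upto f b) c = upto f c.
Proof. by move=> cb; apply: upto_congr => x xc; rewrite uptoE// (le_trans xc). Qed.

Lemma csq_upto_le f b c : c <= b -> csq (upto f b) -> csq (upto f c).
Proof. by move=> cb K; rewrite -(upto_upto f cb); exact: csq_patch. Qed.

Lemma nm_upto_le f b c : hsq f -> c <= b -> nm (upto f c) <= nm (upto f b).
Proof. by move=> Hf cb; rewrite -(upto_upto f cb); apply: nm_patch => //; exact: (Hf b).1. Qed.

Lemma hsqB f h : hsq f -> hsq h -> hsq (f - h).
Proof. by move=> Hf Hh b; rewrite patchB; apply: csqB; [exact: Hf|exact: Hh]. Qed.

Lemma hsqD f h : hsq f -> hsq h -> hsq (f + h).
Proof. by move=> Hf Hh b; rewrite patchD; apply: csqD; [exact: Hf|exact: Hh]. Qed.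

Lemma hsqZ k f : hsq f -> hsq (k *: f).
Proof. by move=> Hf b; rewrite patchZ; apply: csqZ; exact: Hf. Qed.

Lemma hsq_patch f (D : set R) : measurable D -> hsq f -> hsq (f \_ D).
Proof.
move=> mD Hf b; have -> : (f \_ D) \_ `]-oo, b] = (f \_ `]-oo, b]) \_ D.
  by apply/funext => x; rewrite !patchE; do !case: ifP.
by apply: csq_patch => //; exact: Hf.
Qed.

Lemma hsq_transl f d : hsq f -> hsq (transl f d).
Proof.
move=> Hf b; have -> : (transl f d) \_ `]-oo, b] = transl (f \_ `]-oo, b + d]) d.
  by apply/funext => x; rewrite /transl !patchE !mem_setE !in_itv/= lerD2r.
exact/csq_transl/Hf.
Qed.

Variables (l x0 : R).
Hypotheses (l0 : 0 < l) (x00 : 0 < x0) (x0l : x0 <= l).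
Local Notation trace := (forced_trace x0).

(* u_x(l,.) = 0 reads p (y + 2 l) = - p y + (g (y + x0) - g (y - x0)) / 2 for y > - l. *)
Definition bounce p g : R -> R :=
  (2^-1 *: (transl g (x0 - (l + l)) - transl g (- x0 - (l + l))) - transl p (- (l + l))) \_ `[l, +oo[.

Lemma bounceE p g y : bounce p g y =
  if y < l then 0 else 2^-1 * (g (y + (x0 - (l + l))) - g (y + (- x0 - (l + l)))) - p (y - (l + l)).
Proof. by rewrite /bounce patchE mem_setE in_itv/= andbT leNgt; case: ltP. Qed.

(** The latest argument read is y + x0 - 2 l, and x0 <= l gives the delay l. *)
Lemma bounce_causal p g p' g' y : (forall z, z <= y - l -> p z = p' z /\ g z = g' z) ->
  bounce p g y = bounce p' g' y.
Proof.
move=> E; rewrite !bounceE; case: ltP => // ly; have l0' := l0; have x0l' := x0l; have x00' := x00.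
have [_ ->] : p (y + (x0 - (l + l))) = p' (y + (x0 - (l + l))) /\ g (y + (x0 - (l + l))) = g' (y + (x0 - (l + l))) by apply: E; lra.
have [_ ->] : p (y + (- x0 - (l + l))) = p' (y + (- x0 - (l + l))) /\ g (y + (- x0 - (l + l))) = g' (y + (- x0 - (l + l))) by apply: E; lra.
by have [-> _] : p (y - (l + l)) = p' (y - (l + l)) /\ g (y - (l + l)) = g' (y - (l + l)) by apply: E; lra.
Qed.

Lemma bounce_csq p g : csq p -> csq g -> csq (bounce p g).
Proof.
move=> Kp Kg; apply: csq_patch => //; apply: csqB; last exact: csq_transl.
by apply: csqZ; apply: csqB; exact: csq_transl.
Qed.

Lemma nm_bounce p g : sqint p -> sqint g -> nm (bounce p g) <= nm p + nm g.
Proof.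
move=> Qp Qg; have Q1 : sqint (transl g (x0 - (l + l))) by exact: sqint_shift.
have Q2 : sqint (transl g (- x0 - (l + l))) by exact: sqint_shift.
have Q3 : sqint (transl p (- (l + l))) by exact: sqint_shift.
have Q4 := sqintZ 2^-1 (sqintB Q1 Q2).
apply: le_trans (nm_patch _ (sqintB Q4 Q3)) _ => //.
apply: le_trans (nmB Q4 Q3) _; rewrite nmZ//; last exact: sqintB.
have := nmB Q1 Q2; rewrite /transl !nm_shift// ger0_norm//.
have := nm_ge0 ((fun x => g (x + (x0 - (l + l)))) - (fun x => g (x + (- x0 - (l + l)))))
; lra.
Qed.

(** The source rule F is left general: it is used with the feedback law to construct solutions, and
    with a frozen source to represent given ones. *)
Lemma recursion_exists (F : (R -> R) -> (R -> R) -> R -> R) P0 : csq P0 ->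
  (forall p g p' g' y, (forall z, z <= y - l -> p z = p' z /\ g z = g' z) -> F p g y = F p' g' y) ->
  (forall p g p' g' y, y < l -> F p g y = F p' g' y) ->
  (forall b p g, csq p -> csq g -> csq (upto (F p g) b)) ->
  exists p g, [/\ hsq p, hsq g, forall y, p y = (P0 \_ `]- l, l[) y + bounce p g y
    & forall t, g t = F p g t].
Proof.
move=> KP causal base KF; have l0' := l0.
pose Phi (f : R -> R * R) y : R * R :=
  ((P0 \_ `]- l, l[) y + bounce (fst \o f) (snd \o f) y, F (fst \o f) (snd \o f) y).
have [q Eq] : exists q : R -> R * R, forall y, q y = Phi q y.
  apply: (@delay_fixpoint R (R * R)%type (0, 0) l l Phi) => // [f f' y E|f f' y yl].
    rewrite /Phi (bounce_causal (p' := fst \o f') (g' := snd \o f')); last by move=> z /E /= ->.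
    by rewrite (causal _ _ (fst \o f') (snd \o f'))//; move=> z /E /= ->.
  by rewrite /Phi !bounceE yl (base _ _ (fst \o f') (snd \o f')).
set p := fst \o q; set g := snd \o q.
have Ep y : p y = (P0 \_ `]- l, l[) y + bounce p g y by rewrite /p /= Eq.
have Eg y : g y = F p g y by rewrite /g /= Eq.
have H b : csq (upto p b) /\ csq (upto g b).
  apply: (delay_induction (P := fun b => csq (upto p b) /\ csq (upto g b)) (b0 := 0) l0).
  - have e1 : upto p 0 = upto (P0 \_ `]- l, l[) 0.
      by apply: upto_congr => x x0'; rewrite Ep bounceE ifT ?addr0//; lra.
    have e2 : upto g 0 = upto (F 0 0) 0.
      by apply: upto_congr => x x0'; rewrite Eg; apply: base; lra.
    rewrite e1 e2; split; first by apply: csq_patch => //; exact: csq_patch.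
    by apply: KF; exact: csq0.
  - move=> c [Kp Kg].
    have cc y : y <= c + l -> forall z, z <= y - l -> p z = upto p c z /\ g z = upto g c z.
      by move=> yc z zy; rewrite !uptoE//; lra.
    have -> : upto p (c + l) = upto (P0 \_ `]- l, l[ + bounce (upto p c) (upto g c)) (c + l).
      by apply: upto_congr => y yc; rewrite Ep (bounce_causal (cc y yc)).
    have -> : upto g (c + l) = upto (F (upto p c) (upto g c)) (c + l).
      by apply: upto_congr => y yc; rewrite Eg; exact: causal (cc y yc).
    split; last exact: KF.
    by apply: csq_patch => //; apply: csqD; [exact: csq_patch|exact: bounce_csq].
  - by move=> c d dc [h1 h2]; split; exact: csq_upto_le dc _.
by exists p, g; split=> // b; have [] := H b.
Qed.

(** [A] holds the times without delay. It is empty for the interior problem; for the boundary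
    problem, where x0 = l, it is the union of the damped intervals. The remaining times after 2 l,
    the set [B], carry the delay. *)
Variables (A : set R) (k1 k2 : R).
Hypotheses (mA : measurable A) (Al : forall t, A t -> l + l < t) (Ax0 : forall t, A t -> x0 = l) (k1n : k1 != 1).

Let B : set R := `]l + l, +oo[%classic `\` A.
Let mB : measurable B. Proof. exact: measurableD. Qed.

(* On A the relation g = k1 u_t(l,t) is solved for g. *)
Definition feedback p g : R -> R :=
  (k1 / (1 - k1)) *: (((-2) *: transl p (- l) - transl g (- (l + l))) \_ A) +
  k2 *: (transl (trace p g) (- (l + l)) \_ B).

Lemma traceE p g t : trace p g t = p (t + x0) - p (t - x0) + 2^-1 * (g t - g (t - (x0 + x0))).
Proof. by []. Qed.

Lemma feedbackE p g t : feedback p g t =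
  k1 / (1 - k1) * (if t \in A then -2 * p (t - l) - g (t - (l + l)) else 0) +
  k2 * (if t \in B then trace p g (t - (l + l)) else 0).
Proof.
rewrite -[LHS]/(k1 / (1 - k1) * ((_ : R -> R) \_ A) t + k2 * (transl (trace p g) (- (l + l)) \_ B) t).
by rewrite !patchE.
Qed.

Lemma feedback_causal p g p' g' y : (forall z, z <= y - l -> p z = p' z /\ g z = g' z) ->
  feedback p g y = feedback p' g' y.
Proof.
move=> E; rewrite !feedbackE !traceE; have l0' := l0; have x0l' := x0l; have x00' := x00.
have pE z : z <= y - l -> p z = p' z by move=> /E[].
have gE z : z <= y - l -> g z = g' z by move=> /E[].
by rewrite !(pE, gE)//; lra.
Qed.

Lemma B_gt t : B t -> l + l < t.
Proof. by move=> [/= + _]; rewrite in_itv/= andbT. Qed.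

Lemma feedback_lt p g y : y <= l + l -> feedback p g y = 0.
Proof.
move=> yl; rewrite feedbackE ifF; last first.
  by apply/negP => /set_mem /Al; rewrite ltNge yl.
rewrite ifF; last by apply/negP => /set_mem /B_gt; rewrite ltNge yl.
by rewrite !mulr0 addr0.
Qed.

Lemma trace_csq p g : csq p -> csq g -> csq (trace p g).
Proof.
move=> Kp Kg; apply: csqD; first by apply: csqB; exact: csq_transl.
by apply: csqZ; apply: csqB => //; exact: csq_transl.
Qed.

Lemma nm_trace p g : sqint p -> sqint g -> nm (trace p g) <= 2 * nm p + nm g.
Proof.
move=> Qp Qg; have Q1 : sqint (transl p x0) by exact: sqint_shift.
have Q2 : sqint (transl p (- x0)) by exact: sqint_shift.
have Q3 : sqint (transl g (- (x0 + x0))) by exact: sqint_shift.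
apply: le_trans (nmD (sqintB Q1 Q2) (sqintZ 2^-1 (sqintB Qg Q3))) _.
rewrite nmZ; last exact: sqintB.
have := nmB Q1 Q2; have := nmB Qg Q3; rewrite /transl !nm_shift// ger0_norm//; lra.
Qed.

Lemma feedback_csq p g : csq p -> csq g -> csq (feedback p g).
Proof.
move=> Kp Kg; apply: csqD; apply: csqZ; apply: csq_patch => //.
  by apply: csqB; [apply: csqZ|]; exact: csq_transl.
exact/csq_transl/trace_csq.
Qed.

Lemma nm_feedback p g : sqint p -> sqint g ->
  nm (feedback p g) <= (2 * `|k1 / (1 - k1)| + 2 * `|k2|) * (nm p + nm g).
Proof.
move=> Qp Qg; have Q1 : sqint (transl p (- l)) by exact: sqint_shift.
have Q2 : sqint (transl g (- (l + l))) by exact: sqint_shift.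
have Qt : sqint (trace p g).
  apply: sqintD; first by apply: sqintB; exact: sqint_shift.
  by apply: sqintZ; apply: sqintB => //; exact: sqint_shift.
have Q3 : sqint (transl (trace p g) (- (l + l))) by exact: sqint_shift.
have Q12 := sqintB (sqintZ (-2) Q1) Q2.
have QA := sqint_patch mA Q12; have QB := sqint_patch mB Q3.
apply: le_trans (nmD (sqintZ _ QA) (sqintZ _ QB)) _.
rewrite !nmZ// mulrDl; apply: lerD; rewrite (mulrC 2) -mulrA; apply: ler_wpM2l => //.
  apply: le_trans (nm_patch mA Q12) _; apply: le_trans (nmB (sqintZ _ Q1) Q2) _.
  rewrite nmZ// /transl !nm_shift// normrN ger0_norm//.
  have := nm_ge0 g; lra.
apply: le_trans (nm_patch mB Q3) _; rewrite /transl nm_shift//.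
apply: le_trans (nm_trace Qp Qg) _; have := nm_ge0 g; lra.
Qed.

(** Almost everywhere only, because the trace of a given solution is determined no better. *)
Definition recursive P0 p g : Prop :=
  [/\ hsq p, hsq g, {ae mu, forall y, p y = (P0 \_ `]- l, l[) y + bounce p g y}
    & {ae mu, forall t, g t = feedback p g t}].

Lemma ae_upto_nm f h b : {ae mu, forall x, f x = h x} -> measurable_fun setT (upto f b) ->
  measurable_fun setT (upto h b) -> nm (upto f b) = nm (upto h b).
Proof.
move=> E mf mh; apply: ae_nm => //.
by move: E; apply: (@filterS _ _ (ae_filter_ringOfSetsType mu)) => x e; rewrite /upto !patchE e.
Qed.

(** The method of steps from - l, where p and g vanish almost everywhere on the past: a bound C up
    to c gives the bound 1 + N C up to c + l. *)
Lemma recursive_bound b : exists2 C, 0 <= C & forall P0 p g, csq P0 -> recursive P0 p g ->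
  nm (upto p b) + nm (upto g b) <= C * nm P0.
Proof.
pose Q b := exists2 C, 0 <= C & forall P0 p g, csq P0 -> recursive P0 p g ->
  nm (upto p b) + nm (upto g b) <= C * nm P0.
(* The norm bound 1 of [bounce] plus that of [feedback]. *)
pose N := 1 + 2 * `|k1 / (1 - k1)| + 2 * `|k2|.
have N0 : 0 <= N by rewrite /N !addr_ge0 ?mulr_ge0.
have l0' := l0.
apply: (delay_induction (P := Q) (b0 := - l) l0).
- exists 0 => // P0 p g KP [Hp Hg Ep Eg].
  have Z f h : hsq f -> {ae mu, forall y, f y = h y} -> (forall y, y <= - l -> h y = 0) ->
      nm (upto f (- l)) = 0.
    move=> Hf E h0; rewrite ae_nm0//; first exact: csq_meas (Hf _).
    move: E; apply: (@filterS _ _ (ae_filter_ringOfSetsType mu)) => x e.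
    by rewrite /upto patchE mem_setE in_itv/=; case: ifP => // xl; rewrite e h0.
  rewrite (Z p _ Hp Ep) ?(Z g _ Hg Eg) ?addr0 ?mul0r// => y yl.
    by rewrite feedback_lt//; lra.
  rewrite bounceE ifT ?addr0; last lra.
  by rewrite patchE mem_setE in_itv/= ltNge yl.
- move=> c [C C0 HC]; exists (1 + N * C); first by rewrite addr_ge0 ?mulr_ge0.
  move=> P0 p g KP HR; have [Hp Hg Ep Eg] := HR; have := HC P0 p g KP HR.
  set pc := upto p c; set gc := upto g c => bc.
  have Kp : csq pc := Hp c; have Kg : csq gc := Hg c.
  have cc y : y <= c + l -> forall z, z <= y - l -> p z = pc z /\ g z = gc z.
    by move=> yc z zy; rewrite /pc /gc !uptoE//; lra.
  have KP' := csq_patch (measurable_itv `]- l, l[) KP.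
  have K1 := bounce_csq Kp Kg; have K2 := feedback_csq Kp Kg.
  have mU : measurable `]-oo, (c + l)]%classic by exact: measurable_itv.
  have e1 : upto (fun y => (P0 \_ `]- l, l[) y + bounce p g y) (c + l) = upto (P0 \_ `]- l, l[ + bounce pc gc) (c + l).
    by apply: upto_congr => y yc; rewrite (bounce_causal (cc y yc)).
  have e2 : upto (feedback p g) (c + l) = upto (feedback pc gc) (c + l).
    by apply: upto_congr => y yc; rewrite (feedback_causal (cc y yc)).
  have s1 : nm (upto p (c + l)) <= nm P0 + (nm pc + nm gc).
    have K3 : csq (upto (P0 \_ `]- l, l[ + bounce pc gc) (c + l)) by apply: csq_patch => //; exact: csqD.
    rewrite (ae_upto_nm Ep); [|exact: csq_meas (Hp _)|by rewrite e1; exact: csq_meas].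
    rewrite e1; apply: le_trans (nm_patch mU (sqintD KP'.1 K1.1)) _.
    apply: le_trans (nmD KP'.1 K1.1) _; apply: lerD; last by apply: nm_bounce; [exact: Kp.1|exact: Kg.1].
    by apply: nm_patch => //; exact: KP.1.
  have s2 : nm (upto g (c + l)) <= (N - 1) * (nm pc + nm gc).
    have K3 : csq (upto (feedback pc gc) (c + l)) by exact: csq_patch.
    rewrite (ae_upto_nm Eg); [|exact: csq_meas (Hg _)|by rewrite e2; exact: csq_meas].
    rewrite e2; apply: le_trans (nm_patch mU K2.1) _.
    by apply: le_trans (nm_feedback Kp.1 Kg.1) _; rewrite /N; lra.
  have s3 := ler_wpM2l N0 bc; rewrite mulrDl mul1r -mulrA; lra.
- move=> c d dc [C C0 HC]; exists C => // P0 p g KP HR; have [Hp Hg _ _] := HR.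
  apply: le_trans (HC P0 p g KP HR); apply: lerD; exact: nm_upto_le.
Qed.

End DelayRecursion.

(** * Changing the source or the data on null sets *)

Section Forcing.
Context {R : realType}.
Notation mu := (@lebesgue_measure R).
Notation mR := (measurableTypeR R).
Implicit Types (f p q g h : R -> R) (a b c d x y t s : R) (z w : state R).

(** Borel measurability does not pass through almost everywhere equality; it does through changes on
    a countable set, all of whose subsets are Borel. The switching times form such a set. *)
Lemma measurable_off_countable f h (E : set R) : countable E -> measurable_fun setT h ->
  (forall x, ~ E x -> f x = h x) -> measurable_fun setT f.
Proof.
move=> cE mh fh _ Y mY; rewrite setTI.
have mE (D : set R) : D `<=` E -> measurable (D : set mR).
  move=> DE; apply: countable_measurable => //; exact: sub_countable (subset_card_le DE) cE.
have -> : f @^-1` Y = ((h @^-1` Y) `\` E) `|` ((f @^-1` Y) `&` E).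
  apply/seteqP; split => x /=.
    by move=> Yx; have [Ex|nEx] := pselect (E x); [right|left; rewrite -fh].
  by move=> [[Yx nEx]|[]//]; rewrite fh.
apply: measurableU; last by apply: mE => x [].
by apply: measurableD; [rewrite -[X in measurable X]setTI; exact: mh|exact: mE].
Qed.

Lemma countable_ae (E : set R) : countable E -> {ae mu, forall x, ~ E x}.
Proof.
move=> cE; exists E; split.
- by apply: (@countable_measurable _ mR) => //; exact: measurable_set1.
- exact: countable_lebesgue_measure0.
- by move=> x /= /contrapT.
Qed.

Lemma wave_solution_forcing l x0 z0 U g h : measurable_fun setT (g \_ `]0, +oo[) ->
  measurable_fun setT h -> {ae mu, forall t, 0 < t -> g t = h t} ->
  wave_solution l x0 z0 U g -> wave_solution l x0 z0 U h.
Proof.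
move=> mg mh E [W1 W2 W3 W4]; split=> // t psi t0 Hpsi; rewrite (W4 t psi t0 Hpsi).
rewrite /Rintegral; congr fine; apply: ae_eq_integral => //.
- apply/measurable_EFinP; apply: measurable_funM => //.
  apply: (@measurable_fun_itv_cc _ _ _ false true).
  have : measurable_fun (`]0, +oo[%classic : set mR) g.
    by apply/(measurable_restrictT _ _).
  by apply: measurable_funS => // s; rewrite /= !in_itv/= => /andP[->].
- by apply/measurable_EFinP; apply: measurable_funM => //; exact: measurable_funTS.
- have E0 := countable_ae (countable1 (0 : R)).
  apply: (@filterS2 _ _ (ae_filter_ringOfSetsType mu) _ _ _ _ E E0) => s /= gh s0; rewrite in_itv/= => /andP[s0' _].
  by rewrite gh// lt_neqAle s0' andbT eq_sym; apply/eqP.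
Qed.

Lemma wave_solution_data l x0 z0 w0 U g : calH l z0 -> calH l w0 -> eqH l z0 w0 ->
  wave_solution l x0 z0 U g -> wave_solution l x0 w0 U g.
Proof.
move=> Hz Hw E [W1 W2 W3 W4]; split=> //; first exact: eqH_trans W2 E.
move=> t psi t0 Hpsi; rewrite -(W4 t psi t0 Hpsi); congr (_ - _ + _).
have [[v Dv] _] := Hpsi; have Lpsi := weak_deriv_L2 Dv.
rewrite (dotL2E Hz.2 Lpsi) (dotL2E Hw.2 Lpsi); apply: esym; apply: ae_ip.
- exact: sqint_meas Hz.2.
- exact: sqint_meas Hw.2.
- exact: sqint_meas Lpsi.
- exact: eqH_speed E.
Qed.

Lemma hsq_meas f : hsq f -> measurable_fun setT f.
Proof.
move=> Hf; have -> : [set: R] = \bigcup_n [set` `]-oo, n%:R : R]].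
  apply/seteqP; split=> // x _; exists (Num.truncn x).+1 => //.
  by rewrite /= in_itv/= ltW// truncnS_gt.
apply/measurable_fun_bigcup => n; first exact: measurable_itv.
by apply/(measurable_restrictT _ _) => //; exact: csq_meas (Hf _).
Qed.

End Forcing.

(** * A common form of the two problems *)

Section SwitchingProblem.
Context {R : realType}.
Notation mu := (@lebesgue_measure R).
Notation mR := (measurableTypeR R).
Implicit Types (f p q g h c d : R -> R) (a b x y t s : R) (z w : state R).
Variables (l x0 : R).
Hypotheses (l0 : 0 < l) (x00 : 0 < x0) (x0l : x0 <= l).
Local Notation trace := (forced_trace x0).
Local Notation wave := (forced_wave l x0).
Variables (A : set R) (k1 k2 : R).
Hypotheses (mA : measurable A) (Al : forall t, A t -> l + l < t) (Ax0 : forall t, A t -> x0 = l) (k1n : k1 != 1).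
Local Notation bounce := (bounce l x0).
Local Notation feedback := (feedback l x0 A k1 k2).
Local Notation recursive := (recursive l x0 A k1 k2).
Local Notation B := (`]l + l, +oo[%classic `\` A).

(** One rule for both problems: the interior one has [A] empty and k2 = - a. *)
Definition law c t : R :=
  if t \in A then k1 * c t else if l + l < t then k2 * c (t - (l + l)) else 0.

(** [E] is for the switching times, at which the problems leave g arbitrary; constructed solutions
    have [E] empty. *)
Definition solves (E : set R) z0 (U : R -> state R) c g : Prop :=
  [/\ forall tau, 0 < tau -> velocity_trace 0 tau x0 U c,
      forall t, 0 < t -> ~ E t -> g t = law c t
    & wave_solution l x0 z0 U g].

Lemma bounce_reflection P0 p g : (forall y, p y = (P0 \_ `]- l, l[) y + bounce p g y) ->
  forall y, - l < y -> p (y + (l + l)) + p y = 2^-1 * (g (y + x0) - g (y - x0)).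
Proof.
move=> Ep y yl; rewrite Ep bounceE patchE mem_setE in_itv/=.
rewrite ifF; last by apply/negP => ?; lra.
rewrite ifF; last by apply/negP => ?; lra.
have -> : y + (l + l) + (x0 - (l + l)) = y + x0 by ring.
have -> : y + (l + l) + (- x0 - (l + l)) = y - x0 by ring.
by rewrite addrK add0r subrK.
Qed.

Lemma wave_initial p g : (forall s, s <= 0 -> g s = 0) -> wave p g 0 = free l p 0.
Proof.
move=> g0; rewrite (free_wave l x0) /forced_wave; congr mk; apply/funext => x; rewrite !patchE mem_setE in_itv/=;
  case: ifP => // /andP[x1 x2]; rewrite !(kapE, velE); have x00' := x00;
  case: ltP => xx; rewrite !g0 //; lra.
Qed.

(** For x0 = l the trace contains the future value p (t + l). The reflection at l expresses it
    through g t and older values, which leaves g t with coefficient 1; so the rule g = k1 u_t(l,.)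
    has the factor 1 - k1 in front of g t. *)
Lemma trace_at_end p g t : (forall y, - l < y -> p (y + (l + l)) + p y = 2^-1 * (g (y + x0) - g (y - x0))) ->
  A t -> trace p g t = g t + (-2 * p (t - l) - g (t - (l + l))).
Proof.
move=> rec At; have l0' := l0; have tl := Al At; rewrite traceE (Ax0 At) in rec *.
have := rec (t - l); rewrite (_ : t - l + (l + l) = t + l); last by ring.
rewrite subrK (_ : t - l - l = t - (l + l)); last by ring.
have tl' : - l < t - l by lra.
by move=> /(_ tl'); lra.
Qed.

Lemma feedback_law p g : (forall y, - l < y -> p (y + (l + l)) + p y = 2^-1 * (g (y + x0) - g (y - x0))) ->
  forall t, g t = feedback p g t <-> g t = law (trace p g) t.
Proof.
move=> rec t; rewrite feedbackE /law.
have k1n' : 1 - k1 != 0 by rewrite subr_eq0 eq_sym.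
have [At|nAt] := pselect (A t).
  rewrite mem_set// [t \in B]memNset ?mulr0 ?addr0; last by move=> [].
  rewrite (trace_at_end rec At); set X := -2 * _ - _.
  split=> [->|E]; first by field.
  have : (1 - k1) * g t = k1 * X by rewrite mulrBl mul1r {1}E; ring.
  by move=> /(congr1 (fun v => v / (1 - k1))); rewrite mulrC mulKf// => ->; field.
rewrite memNset// mulr0 add0r; case: ltP => tl.
  by have Bt : B t; [split=> //=; rewrite in_itv/= tl|rewrite mem_set].
rewrite [t \in B]memNset ?mulr0// => -[/=]; by rewrite in_itv/= andbT ltNge tl.
Qed.

Lemma explicit_solution z0 : calH l z0 -> exists p g,
  [/\ hsq p, hsq g, forall y, - l < y -> p (y + (l + l)) + p y = 2^-1 * (g (y + x0) - g (y - x0)),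
      forall t, g t = law (trace p g) t & solves set0 z0 (wave p g) (trace p g) g].
Proof.
move=> Hz.
have [|||p [g [Hp Hg Ep Eg]]] := @recursion_exists _ l x0 l0 x00 x0l feedback (profile l z0) (profile_csq Hz).
- by move=> p g p' g' y; exact: feedback_causal.
- move=> p g p' g' y yl; have l0' := l0; rewrite !feedback_lt//; lra.
- by move=> b p g Kp Kg; apply: csq_patch => //; exact: feedback_csq.
have rec := bounce_reflection Ep.
have gl t : t <= l + l -> g t = 0 by move=> tl; rewrite Eg feedback_lt.
have g0 s : s <= 0 -> g s = 0 by move=> s0; apply: gl; have l0' := l0; lra.
have Lg : forall t, g t = law (trace p g) t by move=> t; apply/(feedback_law rec).
have Lp := hsq_lsq Hp; have Lg' := hsq_lsq Hg.
exists p, g; split=> //; split=> [tau tau0|t _ _|] //.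
  exact: (wave_trace_lsq l0 x00 x0l (ltW tau0) Lp Lg').
have W := wave_solution_explicit l0 x00 x0l Lp Lg' g0 rec.
have E : eqH l z0 (wave p g 0).
  rewrite wave_initial//; apply: free_profile => // y yl.
  have /andP[_ y2] := yl.
  by rewrite Ep bounceE y2 addr0 patchE mem_setE in_itv/= yl.
have H0 : calH l (wave p g 0) by exact: wave_calH_lsq.
exact: wave_solution_data H0 Hz (eqH_sym E) W.
Qed.

Lemma trace_hsq (U : R -> state R) c : (forall tau, 0 < tau -> velocity_trace 0 tau x0 U c) ->
  hsq (c \_ `]0, +oo[).
Proof.
move=> H b; have t0 : 0 < `|b| + 1 by rewrite ltr_wpDl.
have := L2_csq (H _ t0).1; have bb := ler_norm b.
have -> : (c \_ `]0, +oo[) \_ `]-oo, b] = (c \_ `]0, `|b| + 1[) \_ `]-oo, b].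
  by apply/funext => x; rewrite !patchE; itv_tac.
exact: csq_patch.
Qed.

Lemma trace_ae (U V : R -> state R) c d :
  (forall tau, 0 < tau -> velocity_trace 0 tau x0 U c) ->
  (forall tau, 0 < tau -> velocity_trace 0 tau x0 V d) ->
  (forall t, 0 <= t -> eqH l (U t) (V t)) -> {ae mu, forall t, 0 < t -> c t = d t}.
Proof.
move=> HU HV E.
have H (n : nat) : {ae mu, forall t, 0 < t < n%:R + 1 -> c t = d t}.
  have n0 : 0 < n%:R + 1 :> R by rewrite ltr_wpDl.
  apply: weak_deriv_unique (HV _ n0); apply: weak_deriv_ext (HU _ n0); last exact: ltW.
  by move=> t /andP[t0 _]; have [e _] := E t t0; apply: e; rewrite ltW.
have /= := ae_foralln (mu := mu) H.
apply: (@filterS _ _ (ae_filter_ringOfSetsType mu)) => t ct t0.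
by apply: (ct (Num.truncn t)); rewrite t0/= natr1 truncnS_gt.
Qed.

Lemma law_ae c d : {ae mu, forall t, 0 < t -> c t = d t} -> {ae mu, forall t, law c t = law d t}.
Proof.
move=> H; have l0' := l0.
have H' := preserves_ae (preserves_shift (- (l + l))) H.
apply: (@filterS2 _ _ (ae_filter_ringOfSetsType mu) _ _ _ _ H H') => t /= h1 h2.
rewrite /law; case: ifPn => [/set_mem/Al tl|_]; first by rewrite h1//; lra.
by case: ltP => // tl; rewrite h2//; lra.
Qed.

(** The trace of U prescribes its source, and uniqueness for a given source identifies U with an
    explicit wave. The trace of that wave is then almost everywhere the original one, so the source
    satisfies the feedback law of the explicit wave. *)
Lemma solution_representation (E : set R) z0 U c g : countable E -> calH l z0 ->
  solves E z0 U c g -> exists p h, recursive (profile l z0) p h /\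
    forall t, 0 <= t -> eqH l (U t) (wave p h t).
Proof.
move=> cE Hz [HU Hg W]; have l0' := l0.
pose c0 := c \_ `]0, +oo[; have Hc : hsq c0 := trace_hsq HU.
(* A measurable version of g that obeys the rule at all times; g itself is arbitrary at negative
   times and on E. *)
pose h : R -> R := k1 *: (c0 \_ A) + k2 *: (transl c0 (- (l + l)) \_ B).
have mB : measurable B by exact: measurableD.
have Hh : hsq h.
  by apply: hsqD; apply: hsqZ; apply: hsq_patch => //; exact: hsq_transl.
have c0E t : 0 < t -> c0 t = c t by move=> t0; rewrite /c0 patchE mem_setE in_itv/= t0.
have hE t : h t = law c t.
  rewrite -[LHS]/(k1 * (c0 \_ A) t + k2 * (transl c0 (- (l + l)) \_ B) t) !patchE /law.
  have [At|nAt] := pselect (A t).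
    rewrite mem_set// [t \in B]memNset; last by move=> [].
    rewrite c0E; last by have := Al At; lra.
    by apply: etrans (addr0 _); congr (_ + _); exact: mulr0.
  rewrite memNset//; case: ltP => tl.
    have Bt : B t by split=> //=; rewrite in_itv/= tl.
    rewrite mem_set// /transl c0E; last lra.
    by apply: etrans (add0r _); congr (_ + _); exact: mulr0.
  rewrite memNset; last by move=> [/=]; rewrite in_itv/= andbT ltNge tl.
  by apply: etrans (add0r 0); congr (_ + _); exact: mulr0.
have hl t : t <= l + l -> h t = 0.
  move=> tl; rewrite hE /law ifF; last by apply/negP => /set_mem /Al; rewrite ltNge tl.
  by rewrite ltNge tl.
have h0 s : s <= 0 -> h s = 0 by move=> s0; apply: hl; lra.
have mh : measurable_fun setT h := hsq_meas Hh.
have Eg x : ~ E x -> (g \_ `]0, +oo[) x = h x.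
  move=> nE; rewrite patchE mem_setE in_itv/= andbT; case: ltP => x_0; last by rewrite h0.
  by rewrite hE Hg.
have W1 : wave_solution l x0 z0 U h.
  apply: wave_solution_forcing W => //; first exact: measurable_off_countable Eg.
  apply: (@filterS _ _ (ae_filter_ringOfSetsType mu) _ _ _ (countable_ae cE)) => t nE t0.
  by rewrite hE Hg.
(* The source is frozen to h, so that only the profile is solved for. *)
have [|||p [g' [Hp _ Ep Eg']]] := @recursion_exists _ l x0 l0 x00 x0l (fun _ _ => h) _ (profile_csq Hz) => //.
  by move=> b p g' _ _; exact: Hh.
have {g' Eg' Ep} Ep y : p y = (profile l z0 \_ `]- l, l[) y + bounce p h y.
  by rewrite Ep; congr (_ + bounce _ _ _); exact/funext.
have rec := bounce_reflection Ep.
have Lp := hsq_lsq Hp; have Lh := hsq_lsq Hh.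
have W2 := wave_solution_explicit l0 x00 x0l Lp Lh h0 rec.
have E0 : eqH l z0 (wave p h 0).
  rewrite wave_initial//; apply: free_profile => // y yl.
  have /andP[_ y2] := yl.
  by rewrite Ep bounceE y2 addr0 patchE mem_setE in_itv/= yl.
have H0 : calH l (wave p h 0) by exact: wave_calH_lsq.
have {}W2 := wave_solution_data H0 Hz (eqH_sym E0) W2.
have UE := wave_solution_unique l0 x00 x0l (fun T _ => Lh 0 T) W1 W2.
exists p, h; split=> //; split=> //; first exact: aeW.
have tr tau : 0 < tau -> velocity_trace 0 tau x0 (wave p h) (trace p h).
  by move=> tau0; exact: (wave_trace_lsq l0 x00 x0l (ltW tau0) Lp Lh).
have := law_ae (trace_ae HU tr UE).
apply: (@filterS _ _ (ae_filter_ringOfSetsType mu)) => t e.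
by apply/(feedback_law rec); rewrite hE.
Qed.

Lemma recursiveB P Q p q g h : recursive P p g -> recursive Q q h ->
  recursive (P - Q) (p - q) (g - h).
Proof.
move=> [Hp Hg Ep Eg] [Hq Hh Eq Eh]; split; try exact: hsqB.
- apply: (@filterS2 _ _ (ae_filter_ringOfSetsType mu) _ _ _ _ Ep Eq) => y e1 e2.
  rewrite patchB -[LHS]/(p y - q y) -[(_ - _) y]/((P \_ `]- l, l[) y - (Q \_ `]- l, l[) y) e1 e2 !bounceE.
  case: ifP => _; first ring.
  rewrite -![(p - q) _]/(p _ - q _) -![(g - h) _]/(g _ - h _); ring.
- apply: (@filterS2 _ _ (ae_filter_ringOfSetsType mu) _ _ _ _ Eg Eh) => t e1 e2.
  rewrite -[LHS]/(g t - h t) {1}e1 {1}e2 !feedbackE !traceE.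
  rewrite -![(p - q) _]/(p _ - q _) -![(g - h) _]/(g _ - h _).
  by case: ifP => _; case: ifP => _; ring.
Qed.

Lemma wave_csqB p q g h t : csq p -> csq q -> csq g -> csq h ->
  wave (p - q) (g - h) t = wave p g t - wave q h t.
Proof.
move=> Kp Kq Kg Kh; rewrite -mkB; last 2 first.
- by apply: sqint_patch => //; exact: (kap_csq x0 Kp Kg t).1.
- by apply: sqint_patch => //; exact: (kap_csq x0 Kq Kh t).1.
congr mk; rewrite -patchB; congr (_ \_ _); apply/funext => x.
  rewrite -[RHS]/(forced_strain x0 p g t x - forced_strain x0 q h t x) !kapE.
  rewrite -![(p - q) _]/(p _ - q _) -![(g - h) _]/(g _ - h _); case: ifP => _; ring.
rewrite -[RHS]/(forced_speed x0 p g t x - forced_speed x0 q h t x) !velE.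
rewrite -![(p - q) _]/(p _ - q _) -![(g - h) _]/(g _ - h _); case: ifP => _; ring.
Qed.

Lemma nm_profileB z w : calH l z -> calH l w -> nm (profile l z - profile l w) <= 2 * normH l (z - w).
Proof.
move=> Hz Hw; pose S := strain l z - strain l w; pose V := speed l z - speed l w.
have QS : sqint S := (csqB (strain_csq Hz) (strain_csq Hw)).1.
have QV : sqint V := (csqB (speed_csq Hz) (speed_csq Hw)).1.
have -> : profile l z - profile l w = 2^-1 *: (S + V + (refl S 0 - refl V 0)).
  apply/funext => x; set f := strain l z; set g := strain l w; set f' := speed l z; set g' := speed l w.
  rewrite -[LHS]/(2^-1 * (f x + f' x + (f (0 - x) - f' (0 - x))) - 2^-1 * (g x + g' x + (g (0 - x) - g' (0 - x)))).
  rewrite -[RHS]/(2^-1 * (f x - g x + (f' x - g' x) + (f (0 - x) - g (0 - x) - (f' (0 - x) - g' (0 - x))))); ring.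
have Q1 : sqint (refl S 0) by exact: sqint_reflect.
have Q2 : sqint (refl V 0) by exact: sqint_reflect.
rewrite nmZ; last by apply: sqintD; [exact: sqintD|exact: sqintB].
have := nmD (sqintD QS QV) (sqintB Q1 Q2); have := nmD QS QV; have := nmB Q1 Q2.
rewrite /refl !nm_reflect//; have := nm_strainB Hz Hw.
have := normH_speed (calHB Hz Hw); rewrite speedB -/V -/S ger0_norm//; lra.
Qed.

Lemma wave_upto p g t b : t + l <= b -> wave p g t = wave (upto p b) (upto g b) t.
Proof.
move=> tb; have x00' := x00; have x0l' := x0l; have l0' := l0.
rewrite /forced_wave; congr mk; apply/funext => x; rewrite !patchE mem_setE in_itv/=; case: ifP => // /andP[x1 x2];
  rewrite !(kapE, velE); case: ltP => xx; rewrite !uptoE//; lra.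
Qed.

Lemma solution_dependence tau : exists C, forall (E F : set R) z0 w0 U V c d g h,
  countable E -> countable F -> calH l z0 -> calH l w0 ->
  solves E z0 U c g -> solves F w0 V d h ->
  forall t, 0 <= t <= tau -> normH l (U t - V t) <= C * normH l (z0 - w0).
Proof.
have [C C0 HC] := recursive_bound l0 x00 x0l k1 k2 mA Al (tau + l).
(* A factor 4 from the profile to the wave and a factor 2 from the state to the profile. *)
exists (8 * C) => E F z0 w0 U V c d g h cE cF Hz Hw SU SV t /andP[t0 tt].
have [p [g' [R1 EU]]] := solution_representation cE Hz SU.
have [q [h' [R2 EV]]] := solution_representation cF Hw SV.
have [Hp Hg _ _] := R1; have [Hq Hh _ _] := R2.
have Lp := hsq_lsq Hp; have Lq := hsq_lsq Hq; have Lg := hsq_lsq Hg; have Lh := hsq_lsq Hh.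
have [_ _ WU] := SU; have [_ _ WV] := SV.
have HU := ws_calH WU t0; have HV := ws_calH WV t0.
have H1 : calH l (wave p g' t) by exact: wave_calH_lsq.
have H2 : calH l (wave q h' t) by exact: wave_calH_lsq.
rewrite (eqH_normH_l (ltW l0) HU H1 HV (EU t t0)) (normH_sym H1 HV).
rewrite (eqH_normH_l (ltW l0) HV H2 H1 (EV t t0)) (normH_sym H2 H1).
have tl : t + l <= tau + l by rewrite lerD2r.
rewrite (wave_upto p g' tl) (wave_upto q h' tl) -wave_csqB; [|exact: Hp|exact: Hq|exact: Hg|exact: Hh].
have RB := recursiveB R1 R2; have [HD HD' _ _] := RB.
have K : csq (profile l z0 - profile l w0) by apply: csqB; exact: profile_csq.
have := normH_wave l x0 (HD (tau + l)) (HD' (tau + l)) t; rewrite !patchB => H.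
apply: le_trans H _; rewrite -!patchB.
have b1 := HC _ _ _ K RB.
have := ler_wpM2l C0 (nm_profileB Hz Hw); rewrite /upto in b1; lra.
Qed.

End SwitchingProblem.

(** * The two problems *)

Section Identification.
Context {R : realType}.
Notation mu := (@lebesgue_measure R).
Notation mR := (measurableTypeR R).
Implicit Types (f p q g h c d : R -> R) (a b x y t s : R) (z w : state R).
Variable l : R.
Hypothesis l0 : 0 < l.

Lemma eqH_mk_ae k k' (v v' : R -> R) : sqint k -> sqint k' -> {ae mu, forall x, k x = k' x} ->
  {ae mu, forall x, v x = v' x} -> eqH l (mk k v) (mk k' v').
Proof.
move=> Qk Qk' E Ev; split=> [x /andP[x1 x2]|] /=.
  have xx : (0 : R) <= x <= x by rewrite x1/=.
  rewrite (int_prim (sqint_L2 0 x Qk) xx) (int_prim (sqint_L2 0 x Qk') xx).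
  apply: prim_ae.
  - exact/csq_itg/L2_csq/sqint_L2.
  - exact/csq_itg/L2_csq/sqint_L2.
  - by apply: ae_patch; move: E; apply: (@filterS _ _ (ae_filter_ringOfSetsType mu)) => y e _.
by move: Ev; apply: (@filterS _ _ (ae_filter_ringOfSetsType mu)) => y e _.
Qed.

Lemma free_ae p q s t : lsq p -> lsq q -> {ae mu, forall y, - l < y < l -> p (y + s) = q (y + t)} ->
  eqH l (free l p s) (free l q t).
Proof.
move=> Lp Lq E; have E' := preserves_ae (@preserves_opp R) E.
have l0' := l0.
apply: eqH_mk_ae.
- exact: sp_lsq.
- exact: sp_lsq.
- apply: (@filterS2 _ _ (ae_filter_ringOfSetsType mu) _ _ _ _ E E') => y e e'; rewrite !patchE.
  rewrite mem_setE in_itv/=; case: ifP => // /andP[y1 y2].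
  rewrite -[LHS]/(p (y + s) + p (s - y)) -[RHS]/(q (y + t) + q (t - y)) (addrC s) (addrC t) e ?e'//.
    by apply/andP; split; lra.
  by apply/andP; split; lra.
- apply: (@filterS2 _ _ (ae_filter_ringOfSetsType mu) _ _ _ _ E E') => y e e'; rewrite !patchE.
  rewrite mem_setE in_itv/=; case: ifP => // /andP[y1 y2].
  rewrite -[LHS]/(p (y + s) - p (s - y)) -[RHS]/(q (y + t) - q (t - y)) (addrC s) (addrC t) e ?e'//.
    by apply/andP; split; lra.
  by apply/andP; split; lra.
Qed.

(** Here p obeys the reflection rule on one interval of length 2 l only. It is replaced by the
    continuation q of its part around t0, which agrees with it up to the time t0 + 3 l except at one
    point. *)
Lemma sg_free_local T rho p z t0 t : C0_contraction_semigroup l T -> generated_on l T rho -> lsq p ->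
  (forall y, t0 - l < y < t0 + l -> p (y + (l + l)) = rho * p y) -> t0 <= t <= t0 + (l + l) ->
  calH l z -> eqH l z (free l p t0) -> eqH l (T (t - t0) z) (free l p t).
Proof.
move=> HT G Lp rec /andP[t1 t2] Hz E; have l0' := l0.
have Kb : csq (transl p t0 \_ `]- l, l[) by apply: L2_csq; exact: lsq_transl.
have [q [Hq qE _ recq]] := profile_continuation rho l0 Kb.
have qE' y : - l < y < l -> q y = p (y + t0).
  by move=> yl; rewrite qE// patchE mem_setE in_itv/= yl.
have tt0 : 0 <= t - t0 by lra.
have Ez : eqH l z (free l q 0).
  have -> : free l q 0 = free l p t0; last by [].
  by apply: free_local => // y yl; rewrite addr0 qE'.
apply: eqH_trans (sg_free l0 HT G Hq recq tt0 Hz Ez) _.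
apply: free_ae => //; first exact: hsq_lsq.
(* The exceptional point is the argument l of q: the recursions hold only strictly above - l. *)
have := countable_ae (countable1 (l - (t - t0))).
apply: (@filterS _ _ (ae_filter_ringOfSetsType mu)) => y /= /eqP yn /andP[y1 y2].
have [u|u|e] := ltgtP (y + (t - t0)) l; last by move: yn; rewrite -e addrK eqxx.
  rewrite qE'; first by congr p; ring.
  by apply/andP; split; lra.
have -> : y + (t - t0) = y + (t - t0) - (l + l) + (l + l) by ring.
have Y : - l < y + (t - t0) - (l + l) < l by apply/andP; split; lra.
have /andP[Y1 _] := Y; rewrite recq// qE'// -rec; first by congr p; ring.
by apply/andP; split; lra.
Qed.

Lemma wave_unforced x0 p g t : 0 < x0 -> (forall s, s <= t -> g s = 0) -> forced_wave l x0 p g t = free l p t.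
Proof.
move=> x00 g0; rewrite (free_wave l x0) /forced_wave; congr mk; apply/funext => x; rewrite !patchE mem_setE in_itv/=;
  case: ifP => // /andP[x1 x2]; rewrite !(kapE, velE);
  case: ltP => xx; rewrite !g0 //; lra.
Qed.

(** With x0 = l the whole string lies to the left of the source, so the source merely modifies the
    profile of a free wave. *)
Lemma wave_at_end p g t : forced_wave l l p g t = free l (p + 2^-1 *: transl g (- l)) t.
Proof.
rewrite /free /forced_wave; congr mk; apply/funext => x; rewrite !patchE mem_setE in_itv/=;
  case: ifP => // /andP[x1 x2]; rewrite (kapE, velE) x2.
- rewrite -[RHS]/((p (x + t) + 2^-1 * g (x + t - l)) + (p (t - x) + 2^-1 * g (t - x - l))).
  have -> : x + (t - l) = x + t - l by ring.
  have -> : t - l - x = t - x - l by ring.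
  by ring.
- rewrite -[RHS]/((p (x + t) + 2^-1 * g (x + t - l)) - (p (t - x) + 2^-1 * g (t - x - l))).
  have -> : x + (t - l) = x + t - l by ring.
  have -> : t - l - x = t - x - l by ring.
  by ring.
Qed.

Lemma contH_sub a b a' b' (U : R -> state R) : contH l a b U -> a <= a' -> b' <= b -> contH l a' b' U.
Proof.
move=> H aa bb t /andP[t1 t2].
have tab : a <= t <= b by rewrite (le_trans aa t1) (le_trans t2 bb).
have [Ht Hc] := H t tab; split=> //; apply: cvg_trans Hc; apply: cvg_app.
apply: within_subset => x; rewrite /= !in_itv/= => /andP[x1 x2].
by rewrite (le_trans aa x1) (le_trans x2 bb).
Qed.

(** Uniqueness is continuous dependence with equal data; existence has to be supplied for the
    problem at hand. *)
Lemma well_posed_switching x0 A k1 k2 (P : state R -> (R -> state R) -> Prop) :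
  0 < x0 -> x0 <= l -> measurable A -> (forall t, A t -> l + l < t) -> (forall t, A t -> x0 = l) -> k1 != 1 ->
  (forall z0, calH l z0 -> exists U, P z0 U) ->
  (forall z0 U, P z0 U -> exists E c g, countable E /\ solves l x0 A k1 k2 E z0 U c g) ->
  well_posed l P.
Proof.
move=> x00 x0l mA Al Ax0 k1n ex HP.
have dep tau : exists C : R, forall z0 w0 U V, calH l z0 -> calH l w0 -> P z0 U -> P w0 V ->
    forall t, 0 <= t <= tau -> normH l (U t - V t) <= C * normH l (z0 - w0).
  have [C HC] := solution_dependence l0 x00 x0l k2 mA Al Ax0 k1n tau.
  exists C => z0 w0 U V Hz Hw /HP[E [c [g [cE SU]]]] /HP[F [d [h [cF SV]]]] t tt.
  exact: HC cE cF Hz Hw SU SV t tt.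
split=> // z0 U V Hz PU PV t t0.
have [C HC] := dep t; have tt : 0 <= t <= t by rewrite t0/=.
have [E [c [g [_ [_ _ WU]]]]] := HP _ _ PU; have [F [d [h [_ [_ _ WV]]]]] := HP _ _ PV.
apply: (normHB_eqH l0 (ws_calH WU t0) (ws_calH WV t0)).
apply/eqP; rewrite eq_le normH_ge0 andbT; apply: le_trans (HC _ _ _ _ Hz Hz PU PV t tt) _.
by rewrite (eqH_normHB (ltW l0) Hz Hz (eqH_refl _ _)) mulr0.
Qed.

End Identification.

(** * The interior delay problem and the boundary switching problem *)

Section Problems.
Context {R : realType}.
Implicit Types (f p q g h c d : R -> R) (a b x y t s : R) (z w : state R).
Variables (l : R) (T : R -> state R -> state R) (Tm : R -> (state R -> R) -> (state R -> R)).
Hypotheses (l0 : 0 < l) (HG : generates l (calA l) T) (HE : dual_extension l T Tm).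

Definition time (n : nat) : R := (2 * n)%:R * l.

Lemma time_le n m : (n <= m)%N -> time n <= time m.
Proof. by move=> nm; rewrite ler_pM2r// ler_nat leq_mul2l nm orbT. Qed.

Lemma time0 n : 0 <= time n.
Proof. by rewrite mulr_ge0// ltW. Qed.

Lemma time1 : time 1 = l + l.
Proof. by rewrite /time; ring. Qed.

Lemma timeS n : time n.+1 = time n + (l + l).
Proof. by rewrite /time mulnS natrD; ring. Qed.

(** The formulas common to both problems. On [0,2l] the source is 0, so the reflection is the free
    one; afterwards [duhamel_formula] applies to each delayed interval. *)
Lemma solution_chain x0 A k1 k2 z0 p g :
  0 < x0 -> x0 <= l -> (forall t, A t -> l + l < t) -> calH l z0 -> hsq p -> hsq g ->
  (forall y, - l < y -> p (y + (l + l)) + p y = 2^-1 * (g (y + x0) - g (y - x0))) ->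
  (forall t, g t = law l A k1 k2 (forced_trace x0 p g) t) ->
  solves l x0 A k1 k2 set0 z0 (forced_wave l x0 p g) (forced_trace x0 p g) g ->
  let U := forced_wave l x0 p g in let c := forced_trace x0 p g in
  [/\ forall t, 0 <= t <= 2 * l -> eqH l (U t) (T t z0),
      forall n m, velocity_trace (time n) (time (n + m)%N) x0 U c,
      forall n k, (forall r, time n < r < time n.+1 -> g r = k * c (r - 2 * l)) ->
        duhamel l T Tm x0 (time n) (time n.+1) k (U (time n)) c U
    & forall n, contH l (time n) (time n.+1) U].
Proof.
move=> x00 x0l Al Hz Hp Hg rec Lg [HU _ W] U c; have l0' := l0.
have Lp := hsq_lsq Hp; have Lg' := hsq_lsq Hg.
have gl t : t <= l + l -> g t = 0.
  move=> tl; rewrite Lg /law ifF; last by apply/negP => /set_mem /Al; rewrite ltNge tl.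
  by rewrite ltNge tl.
split.
- move=> t /andP[t1 t2]; have tl : t <= l + l by lra.
  have e s : s <= l + l -> forced_wave l x0 p g s = free l p s.
    by move=> sl; apply: wave_unforced => // r rs; apply: gl; exact: le_trans rs sl.
  have [_ /eqH_sym W0 _ _] := W; rewrite (e 0) in W0; last lra.
  rewrite /U (e t tl); apply: eqH_sym; rewrite -{1}(subr0 t).
  apply: (sg_free_local l0 HG.1 (generated_calA l0 HG) Lp) => //; last by rewrite t1 add0r.
  move=> y /andP[y1 y2]; apply/eqP; rewrite mulN1r -addr_eq0 rec; last lra.
  by rewrite !gl ?subrr ?mulr0//; lra.
- move=> n m; have t0 : 0 < time (n + m)%N + 1 by rewrite ltr_wpDl ?time0.
  apply: weak_deriv_itv (HU _ t0) (time0 n) _ _; first by rewrite lerDl.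
  by apply: time_le; exact: leq_addr.
- by move=> n k H; apply: (duhamel_formula l0 HG HE x00 x0l (time0 n) _ W) => //; exact: time_le.
- move=> n; have [W1 _ _ _] := W.
  have t0 : 0 < time n.+1 + 1 by rewrite ltr_wpDl ?time0.
  by apply: contH_sub (W1 _ t0) (time0 n) _; rewrite lerDl.
Qed.

(** The only positive time at which the problem leaves g arbitrary is 2 l. *)
Lemma interior_solves xi a z0 U : interior_delay_problem l xi a z0 U ->
  exists E c g, countable E /\ solves l xi set0 0 (- a) E z0 U c g.
Proof.
move=> [c [g [HU g0 g1 W]]]; exists [set l + l], c, g; split; first exact: countable1.
split=> // t t0 /= /eqP tn; rewrite /law memNset//.
by case: ltgtP tn => // tl _; [rewrite g1|rewrite g0] => //; [congr (_ * c (_ - _)); ring|lra|lra].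
Qed.

Lemma solves_interior xi a z0 U c g : (forall t, g t = law l set0 0 (- a) c t) ->
  solves l xi set0 0 (- a) set0 z0 U c g -> interior_delay_problem l xi a z0 U.
Proof.
move=> Lg [HU _ W]; exists c, g; split=> // t tl; rewrite Lg /law memNset//.
  by rewrite ifF//; apply/negP => ?; lra.
rewrite ifT; last lra.
by congr (_ * c (_ - _)); ring.
Qed.

Definition odd_times : set R := \bigcup_(i : nat) [set` `]time (2 * i + 1)%N, time (2 * i + 2)%N[].

Lemma odd_timesP t : odd_times t <-> exists i : nat, time (2 * i + 1)%N < t < time (2 * i + 2)%N.
Proof.
split=> [[i _ /=]|[i ti]]; first by rewrite in_itv/= => ti; exists i.
by exists i => //=; rewrite in_itv.
Qed.

Lemma odd_times_gt t : odd_times t -> l + l < t.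
Proof.
move=> /odd_timesP[i /andP[ti _]]; apply: le_lt_trans ti; rewrite -time1.
by apply: time_le; rewrite addn1.
Qed.

Lemma even_times t (i : nat) : time (2 * i + 2)%N < t < time (2 * i + 3)%N -> ~ odd_times t.
Proof.
move=> /andP[t1 t2] /odd_timesP[j /andP[t3 t4]].
have := lt_trans t1 t4; have := lt_trans t3 t2; rewrite !ltr_pM2r// !ltr_nat; lia.
Qed.

Lemma measurable_odd_times : measurable (odd_times : set (measurableTypeR R)).
Proof. by apply: bigcup_measurable => i _; exact: measurable_itv. Qed.

Lemma boundary_solves k1 k2 z0 U : boundary_switching_problem l k1 k2 z0 U ->
  exists E c g, countable E /\ solves l l odd_times k1 k2 E z0 U c g.
Proof.
move=> [c [g [HU g0 g1 g2 W]]]; exists (range time), c, g; split.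
  exact: card_image_le.
split=> // t t0 tn; pose n := Num.truncn (t / (l + l)).
have l2 : 0 < l + l by rewrite addr_gt0.
(* Time is cut into intervals of length 2 l; t lies in the n-th one, and strictly inside because the
   end points are excluded. The parity of n decides which rule applies. *)
have tE m : time m = m%:R * (l + l) by rewrite /time natrM; ring.
have n1 : time n <= t.
  by rewrite tE -ler_pdivlMr//; have /andP[] := truncn_itv (divr_ge0 (ltW t0) (ltW l2)).
have n2 : t < time n.+1 by rewrite tE -ltr_pdivrMr//; exact: truncnS_gt.
have {}n1 : time n < t by rewrite lt_neqAle n1 andbT; apply/eqP => e; apply: tn; exists n.
rewrite /law; case: n n1 n2 => [|n] n1 n2.
  rewrite memNset; last by move=> /odd_times_gt; rewrite -time1 ltNge ltW.
  rewrite ltNge -time1 ltW// g0//; move: n2; rewrite time1; lra.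
have [On|On] := boolP (odd n).
  have nE : n.+1 = (2 * (n./2) + 2)%N by rewrite -{1}(odd_double_half n) On -mul2n; lia.
  have nE' : n.+2 = (2 * (n./2) + 3)%N by rewrite nE; lia.
  rewrite nE in n1; rewrite nE' in n2.
  have tt : time (2 * n./2 + 2)%N < t < time (2 * n./2 + 3)%N by rewrite n1.
  rewrite memNset; last exact: even_times tt.
  rewrite ifT; last by rewrite -time1; apply: le_lt_trans n1; apply: time_le; lia.
  by rewrite (g2 _ _ tt); congr (_ * c (_ - _)); ring.
have nE : n.+1 = (2 * (n./2) + 1)%N by rewrite -{1}(odd_double_half n) (negbTE On) -mul2n; lia.
have nE' : n.+2 = (2 * (n./2) + 2)%N by rewrite nE; lia.
rewrite nE in n1; rewrite nE' in n2.
have tt : time (2 * n./2 + 1)%N < t < time (2 * n./2 + 2)%N by rewrite n1.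
by rewrite mem_set ?(g1 _ _ tt)//; apply/odd_timesP; exists n./2.
Qed.

Lemma solves_boundary k1 k2 z0 U c g : (forall t, g t = law l odd_times k1 k2 c t) ->
  solves l l odd_times k1 k2 set0 z0 U c g -> boundary_switching_problem l k1 k2 z0 U.
Proof.
move=> Lg [HU _ W]; exists c, g; split=> // [t tl|i t tt|i t tt]; rewrite Lg /law.
- rewrite memNset; last by move=> /odd_times_gt ?; lra.
  by rewrite ifF//; apply/negP => ?; lra.
- by rewrite mem_set//; apply/odd_timesP; exists i.
- rewrite memNset; last exact: even_times tt.
  rewrite ifT; last first.
    by rewrite -time1; have /andP[t1 _] := tt; apply: le_lt_trans t1; apply: time_le; lia.
  by congr (_ * c (_ - _)); ring.
Qed.

(* On an interval without delay the profile of the outgoing wave is multiplied by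
   - (1 + k1) / (1 - k1) at each reflection, as under the damped semigroup. *)
Lemma damped_interval (Td : R -> state R -> state R) mu2 k2 p g i t :
  generates l (calAd l mu2) Td -> mu2 != 1 -> hsq p -> hsq g ->
  (forall y, - l < y -> p (y + (l + l)) + p y = 2^-1 * (g (y + l) - g (y - l))) ->
  (forall t, g t = law l odd_times mu2 k2 (forced_trace l p g) t) ->
  time (2 * i + 1)%N <= t <= time (2 * i + 2)%N ->
  eqH l (Td (t - time (2 * i + 1)%N) (forced_wave l l p g (time (2 * i + 1)%N))) (forced_wave l l p g t).
Proof.
move=> HGd m1 Hp Hg rec Lg tt; have l0' := l0; set s := time (2 * i + 1)%N.
have tS : time (2 * i + 2)%N = s + (l + l) by rewrite /s -timeS; congr time; lia.
have s0 : 0 <= s := time0 _.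
pose q : R -> R := p + 2^-1 *: transl g (- l); rewrite !wave_at_end -/q.
have Lq : lsq q.
  by apply: lsqD; [exact: hsq_lsq|apply: lsqZ; apply: lsq_transl; exact: hsq_lsq].
have Hz := free_calH l s Lq.
apply: (sg_free_local l0 HGd.1 (generated_calAd l0 m1 HGd) Lq) => //.
- move=> y /andP[y1 y2].
  have Ot : odd_times (y + l) by apply/odd_timesP; exists i; rewrite tS -/s; apply/andP; split; lra.
  have gy := Lg (y + l); rewrite /law mem_set// in gy.
  have yl : - l < y by lra.
  have := rec y yl; rewrite -[q (y + (l + l))]/(p (y + (l + l)) + 2^-1 * g (y + (l + l) - l)).
  rewrite -[q y]/(p y + 2^-1 * g (y - l)).
  move: gy; rewrite traceE.
  have -> : y + l + l = y + (l + l) by ring.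
  have -> : y + l - l = y by ring.
  have -> : y + l - (l + l) = y - l by ring.
  have -> : y + (l + l) - l = y + l by ring.
  move: (g (y + l)) (g (y - l)) (p y) => G1 G2 P1 e1 e2.
  have m1' : 1 - mu2 != 0 by rewrite subr_eq0 eq_sym.
  have -> : p (y + (l + l)) = 2^-1 * (G1 - G2) - P1 by rewrite -e2 addrK.
  (* The rule at time y + l, from which p (y + 2 l) has been eliminated by the reflection. *)
  have e3 : (1 - mu2) * G1 = mu2 * (- G2 - 2 * P1).
    move: e1; have -> : p (y + (l + l)) = 2^-1 * (G1 - G2) - P1 by rewrite -e2 addrK.
    by move=> e1; apply/eqP; rewrite mulrBl mul1r subr_eq; apply/eqP; rewrite [LHS]e1; field.
  have -> : G1 = (1 - mu2)^-1 * (mu2 * (- G2 - 2 * P1)) by rewrite -e3 mulKf.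
  by field.
- by rewrite -tS.
- exact: eqH_refl.
Qed.

End Problems.

(* In the second part the coefficients of the boundary conditions are those of the problem
   solved by the displayed formulas: u_x(l,t) = mu2 u_t(l,t) without delay, as
   in D(calA_d), and u_x(l,t) = - mu1 u_t(l,t-2l) with delay. *)
Theorem proposition1p1 (R : realType) (l mu1 mu2 a xi : R)
    (T : R -> state R -> state R)
    (Tm : R -> (state R -> R) -> (state R -> R)) :
  0 < l -> 0 < xi < l ->
  generates l (calA l) T -> dual_extension l T Tm ->
  let time (n : nat) : R := (2 * n)%:R * l in
  (well_posed l (interior_delay_problem l xi a) /\
   forall z0, calH l z0 ->
     exists (U : R -> state R) (V : nat -> R -> state R) (c : nat -> R -> R),
       [/\ interior_delay_problem l xi a z0 U,
           forall j t, time j <= t <= time j.+1 -> eqH l (U t) (V j t),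
           forall t, 0 <= t <= 2 * l -> eqH l (V 0%N t) (T t z0),
           forall j,
             velocity_trace (time j) (time j.+1) xi (V j) (c j) /\
             duhamel l T Tm xi (time j.+1) (time j.+2) (- a)
               (V j (time j.+1)) (c j) (V j.+1)
         & forall j, contH l (time j) (time j.+1) (V j)]) /\
  (forall Td : R -> state R -> state R,
   generates l (calAd l mu2) Td ->
   well_posed l (boundary_switching_problem l mu2 (- mu1)) /\
   forall z0, calH l z0 ->
     exists (U : R -> state R) (V : nat -> R -> state R) (c : nat -> R -> R),
       [/\ boundary_switching_problem l mu2 (- mu1) z0 U,
           forall j t, time j <= t <= time j.+1 -> eqH l (U t) (V j t),
           forall t, 0 <= t <= 2 * l -> eqH l (V 0%N t) (T t z0),
           forall j : nat,
             [/\ forall t, time (2 * j + 1)%N <= t <= time (2 * j + 2)%N ->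
                   eqH l (V (2 * j + 1)%N t)
                     (Td (t - time (2 * j + 1)%N)
                       (V (2 * j)%N (time (2 * j + 1)%N))),
                 velocity_trace (time (2 * j + 1)%N) (time (2 * j + 2)%N) l
                   (V (2 * j + 1)%N) (c (2 * j + 1)%N)
               & duhamel l T Tm l (time (2 * j + 2)%N) (time (2 * j + 3)%N)
                   (- mu1) (V (2 * j + 1)%N (time (2 * j + 2)%N))
                   (c (2 * j + 1)%N) (V (2 * j + 2)%N)]
         & forall j, contH l (time j) (time j.+1) (V j)]).
Proof.
move=> l0 /andP[xi0 xil] HG HE.
move=> time'; rewrite -[time']/(time l) => {time'}.
(* In the interior problem no time is without delay: [A] is empty and k1 = 0 is a convenient value
   different from 1. *)
have n01 : (0 : R) != 1 by rewrite eq_sym oner_neq0.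
split.
  have A0 (P : R -> Prop) t : set0 t -> P t by [].
  have ex z0 : calH l z0 -> _ :=
    @explicit_solution R l xi l0 xi0 (ltW xil) set0 0 (- a) measurable0 (A0 _) (A0 _) n01 z0.
  split.
    apply: (@well_posed_switching R l l0 xi set0 0 (- a) _ xi0 (ltW xil) measurable0 (A0 _) (A0 _) n01).
      move=> z0 /ex[p [g [_ _ _ Lg S]]]; exists (forced_wave l xi p g).
      exact: solves_interior Lg S.
    exact: interior_solves.
  move=> z0 Hz; have [p [g [Hp Hg rec Lg S]]] := ex z0 Hz.
  have [c1 c2 c3 c4] := solution_chain l0 HG HE xi0 (ltW xil) (A0 _) Hz Hp Hg rec Lg S.
  (* The successive pieces are restrictions of a single global wave, so their junctions need no
     argument. *)
  exists (forced_wave l xi p g), (fun=> forced_wave l xi p g), (fun=> forced_trace xi p g); split=> //.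
  - exact: solves_interior Lg S.
  - by move=> j t _; exact: eqH_refl.
  - move=> j; split; first by have := c2 j 1%N; rewrite addn1.
    apply: c3 => r /andP[r1 _]; rewrite Lg /law memNset// ifT.
      by congr (_ * forced_trace _ _ _ (_ - _)); ring.
    by rewrite -time1; apply: le_lt_trans r1; exact: time_le.
(* Generation of contractions gives mu2 <= 0, which excludes the value 1 at which the rule without
   delay could not be solved for g. *)
move=> Td HGd; have m0 := generates_calAd_le0 l0 HGd.
have m1 : mu2 != 1 by rewrite lt_eqF// (le_lt_trans m0).
have Ax (t : R) : odd_times l t -> l = l by [].
have ex z0 : calH l z0 -> _ := @explicit_solution R l l l0 l0 (lexx l) (odd_times l) mu2 (- mu1)
  (measurable_odd_times l) (odd_times_gt l0) Ax m1 z0.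
split.
  apply: (@well_posed_switching R l l0 l (odd_times l) mu2 (- mu1) _ l0 (lexx l)
    (measurable_odd_times l) (odd_times_gt l0) Ax m1).
    move=> z0 /ex[p [g [_ _ _ Lg S]]]; exists (forced_wave l l p g).
    exact: solves_boundary Lg S.
  exact: boundary_solves.
move=> z0 Hz; have [p [g [Hp Hg rec Lg S]]] := ex z0 Hz.
have [c1 c2 c3 c4] := solution_chain l0 HG HE l0 (lexx l) (odd_times_gt l0) Hz Hp Hg rec Lg S.
exists (forced_wave l l p g), (fun=> forced_wave l l p g), (fun=> forced_trace l p g); split=> //.
- exact: solves_boundary Lg S.
- by move=> j t _; exact: eqH_refl.
- move=> j; split.
  + by move=> t tt; apply: eqH_sym; have := damped_interval l0 HGd m1 Hp Hg rec Lg tt; exact.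
  + by have := c2 (2 * j + 1)%N 1%N; rewrite -addnA.
  + have e : (2 * j + 3)%N = (2 * j + 2).+1 by rewrite -addnS.
    rewrite e; apply: c3 => r; rewrite -e => rr; rewrite Lg /law memNset; last exact: even_times rr.
    rewrite ifT; first by congr (_ * forced_trace _ _ _ (_ - _)); ring.
    by have /andP[r1 _] := rr; rewrite -time1; apply: le_lt_trans r1; apply: time_le; lia.
Qed.
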